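(* Let $x:M^3\rightarrow\mathbb{R}^{4}$ be a locally strongly convex affine hypersphere with parallel Ricci tensor, i.e. the Ricci tensor of the affine metric $h$ is parallel with respect to the Levi-Civita connection of $h$. Then either $M^3$ is an open part of a locally strongly convex hyperquadric, or $x:M^3\rightarrow\mathbb{R}^{4}$ is locally affinely equivalent to one of the following two hypersurfaces: (i) $x_1x_2x_3x_4=1$, (ii) $x_1^2(x_4^2-x_2^2-x_3^2)^3=1$, where $(x_1,x_2,x_3,x_4)$ are the standard coordinates of $\mathbb{R}^4$.
   Context: $\mathbb{R}^{n+1}$ is the real unimodular affine space with its standard flat connection $D$ and the parallel volume form given by the determinant (here $n=3$). Let $x:M^n\to\mathbb{R}^{n+1}$ be an immersed nondegenerate hypersurface. Its affine normal $\xi$ is the canonical transversal vector field, determined up to sign by: writing $D_Xx_*(Y)=x_*(\nabla_XY)+h(X,Y)\xi$, the derivative $D_X\xi$ is tangential, $D_X\xi=-x_*(SX)$, and the volume form $\det(x_*X_1,\ldots,x_*X_n,\xi)$ agrees up to sign with the (pseudo-)Riemannian volume form of $h$. The symmetric bilinear form $h$ is called the affine metric and $S$ the affine shape operator. $M^n$ is locally strongly convex if (for a suitable choice of sign of $\xi$, which is then fixed) $h$ is positive definite, so that $(M^n,h)$ is a Riemannian manifold. $M^n$ is an affine hypersphere if all affine normal lines pass through a fixed point (proper) or all affine normals are parallel (improper); equivalently $S=H\,\mathrm{id}$ with $H$ constant. ''Locally affinely equivalent'' to a hypersurface means that locally the image of $x$ is carried onto an open part of that hypersurface by an affine transformation of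 $\mathbb{R}^{n+1}$. *)

(* Defs.v *)
From mathcomp Require Import all_boot all_order all_algebra.
From mathcomp Require Import all_classical all_reals all_analysis.

Set Implicit Arguments.
Unset Strict Implicit.
Unset Printing Implicit Defensive.

Import Order.TTheory GRing.Theory Num.Theory.
Import numFieldNormedType.Exports.

Local Open Scope classical_set_scope.
Local Open Scope ring_scope.

Definition partial (R : realType) (n : nat) (W : normedModType R) (i : 'I_n)
    (f : 'rV[R]_n -> W) : 'rV[R]_n -> W :=
  'D_(delta_mx 0 i) f.

Definition partials (R : realType) (n : nat) (W : normedModType R)
    (s : seq 'I_n) (f : 'rV[R]_n -> W) : 'rV[R]_n -> W :=
  foldr (fun i g => partial i g) f s.

(* C^oo on the open set U: every iterated partial derivative is (Frechet)
   differentiable, hence also continuous, at every point of U. *)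
Definition smooth_on (R : realType) (n : nat) (W : normedModType R)
    (U : set 'rV[R]_n) (f : 'rV[R]_n -> W) : Prop :=
  forall (s : seq 'I_n) (u : 'rV[R]_n), U u -> differentiable (partials s f) u.

(* The maps [chart a] and [param a] are total; only their values on
   [chart_dom a] and [chart_codom a] are meaningful. *)
Record smooth_atlas (R : realType) (n : nat) (M : topologicalType) :=
  SmoothAtlas {
    chart_index : Type ;
    chart_dom : chart_index -> set M ;
    chart_codom : chart_index -> set 'rV[R]_n ;
    chart : chart_index -> M -> 'rV[R]_n ;
    param : chart_index -> 'rV[R]_n -> M ;
    chart_dom_open : forall a, open (chart_dom a) ;
    chart_codom_open : forall a, open (chart_codom a) ;
    chart_dom_cover : forall p, exists a, chart_dom a p ;
    chart_fun : forall a p, chart_dom a p -> chart_codom a (chart a p) ;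
    param_fun : forall a u, chart_codom a u -> chart_dom a (param a u) ;
    chartK : forall a p, chart_dom a p -> param a (chart a p) = p ;
    paramK : forall a u, chart_codom a u -> chart a (param a u) = u ;
    chart_continuous : forall a, {within chart_dom a, continuous (chart a)} ;
    param_continuous :
      forall a, {within chart_codom a, continuous (param a)} ;
    transition_smooth : forall a b,
      smooth_on (chart_codom a `&` (param a @^-1` chart_dom b))
                (chart b \o param a)
  }.

Definition smooth_map (R : realType) (n : nat) (M : topologicalType)
    (A : smooth_atlas R n M) (W : normedModType R) (f : M -> W) : Prop :=
  forall a : chart_index A, smooth_on (chart_codom a) (f \o param a).

(* The rows of the Jacobian ['J f u] are the partial derivatives of f at u. *)
Definition immersion (R : realType) (n m : nat) (M : topologicalType)
    (A : smooth_atlas R n M) (x : M -> 'rV[R]_m) : Prop :=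
  smooth_map A x /\
  forall (a : chart_index A) (u : 'rV[R]_n), chart_codom a u ->
    row_free ('J (x \o param a) u).

(* Hypersurfaces in coordinates: f : 'rV_n -> 'rV_(n + 1) is a local
   parametrization and xi a vector field along it. *)

(* The rows are d_1 f, ..., d_n f, xi. *)
Definition frame (R : realType) (n : nat) (f xi : 'rV[R]_n -> 'rV[R]_(n + 1))
    (u : 'rV[R]_n) : 'M[R]_(n + 1) :=
  col_mx ('J f u) (xi u).

(* h_ij is the component along xi of d_i d_j f in the frame above, that is
   d_i d_j f = \sum_k Gamma^k_ij d_k f + h_ij xi. *)
Definition affine_metric (R : realType) (n : nat)
    (f xi : 'rV[R]_n -> 'rV[R]_(n + 1)) (u : 'rV[R]_n) : 'M[R]_n :=
  \matrix_(i, j)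
    (partial i (partial j f) u *m invmx (frame f xi u)) 0 (rshift n 0).

Definition affine_normal (R : realType) (n : nat) (M : topologicalType)
    (A : smooth_atlas R n M) (x xi : M -> 'rV[R]_(n + 1)) : Prop :=
  smooth_map A xi /\
  forall (a : chart_index A) (u : 'rV[R]_n), chart_codom a u ->
    let f := x \o param a in
    let nu := xi \o param a in
    [/\ (* transversality *)
        frame f nu u \in unitmx,
        (* D_X xi is tangential *)
        ('J nu u <= 'J f u)%MS
      & (* the volume form induced by xi is, up to sign, that of h *)
        `|\det (frame f nu u)| = Num.sqrt `|\det (affine_metric f nu u)| ].

Definition positive_definite (R : realType) (n : nat) (g : 'M[R]_n) : Prop :=
  forall v : 'rV[R]_n, v != 0 -> 0 < (v *m g *m v^T) 0 0.

(* [xi] is an affine normal of [x], with the sign that makes h positive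
   definite. *)
Definition locally_strongly_convex (R : realType) (n : nat)
    (M : topologicalType) (A : smooth_atlas R n M)
    (x xi : M -> 'rV[R]_(n + 1)) : Prop :=
  affine_normal A x xi /\
  forall (a : chart_index A) (u : 'rV[R]_n), chart_codom a u ->
    positive_definite (affine_metric (x \o param a) (xi \o param a) u).

Definition proper_affine_hypersphere (R : realType) (m : nat) (M : Type)
    (x xi : M -> 'rV[R]_m) : Prop :=
  exists c : 'rV[R]_m, forall p : M, exists t : R, c = x p + t *: xi p.

Definition improper_affine_hypersphere (R : realType) (m : nat) (M : Type)
    (xi : M -> 'rV[R]_m) : Prop :=
  exists v : 'rV[R]_m, forall p : M, exists t : R, xi p = t *: v.

Definition affine_hypersphere (R : realType) (m : nat) (M : Type)
    (x xi : M -> 'rV[R]_m) : Prop :=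
  proper_affine_hypersphere x xi \/ improper_affine_hypersphere xi.

Definition metric_comp (R : realType) (n : nat) (g : 'rV[R]_n -> 'M[R]_n)
    (i j : 'I_n) (u : 'rV[R]_n) : R := g u i j.

(* Levi-Civita connection: nabla_(d_i) d_j = \sum_k Gamma^k_ij d_k. *)
Definition christoffel (R : realType) (n : nat) (g : 'rV[R]_n -> 'M[R]_n)
    (k i j : 'I_n) (u : 'rV[R]_n) : R :=
  2^-1 * \sum_(l < n) invmx (g u) k l *
    (partial i (metric_comp g j l) u + partial j (metric_comp g i l) u
     - partial l (metric_comp g i j) u).

(* R(d_i, d_j) d_k = \sum_l R^l_kij d_l, where
   R(X, Y) = [nabla_X, nabla_Y] - nabla_[X, Y]. *)
Definition riemann (R : realType) (n : nat) (g : 'rV[R]_n -> 'M[R]_n)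
    (l k i j : 'I_n) (u : 'rV[R]_n) : R :=
  partial i (christoffel g l j k) u - partial j (christoffel g l i k) u
  + \sum_(m < n) (christoffel g l i m u * christoffel g m j k u
                  - christoffel g l j m u * christoffel g m i k u).

(* Ric(Y, Z) is the trace of X |-> R(X, Y) Z. *)
Definition ricci (R : realType) (n : nat) (g : 'rV[R]_n -> 'M[R]_n)
    (j k : 'I_n) (u : 'rV[R]_n) : R :=
  \sum_(i < n) riemann g i k i j u.

(* The components (nabla_(d_l) T)(d_i, d_j). *)
Definition covariant_derivative (R : realType) (n : nat)
    (g : 'rV[R]_n -> 'M[R]_n) (T : 'I_n -> 'I_n -> 'rV[R]_n -> R)
    (l i j : 'I_n) (u : 'rV[R]_n) : R :=
  partial l (T i j) u - \sum_(m < n) christoffel g m l i u * T m j u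
                      - \sum_(m < n) christoffel g m l j u * T i m u.

Definition parallel_ricci (R : realType) (n : nat) (M : topologicalType)
    (A : smooth_atlas R n M) (x xi : M -> 'rV[R]_(n + 1)) : Prop :=
  forall (a : chart_index A) (u : 'rV[R]_n), chart_codom a u ->
    let h := affine_metric (x \o param a) (xi \o param a) in
    forall l i j : 'I_n, covariant_derivative h (ricci h) l i j u = 0.

Definition open_part (T : topologicalType) (S Q : set T) : Prop :=
  exists2 O : set T, open O & S = Q `&` O.

Definition quadratic_function (R : realType) (m : nat) (B : 'M[R]_m)
    (b : 'rV[R]_m) (c : R) (y : 'rV[R]_m) : R :=
  (y *m B *m y^T) 0 0 + 2 * (b *m y^T) 0 0 + c.

(* The hypersurface F = 0 is regular, and its second fundamental form is
   definite everywhere: differentiating dF(Y) = 0 along it shows that, for any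
   transversal field xi, h(X, Y) dF(xi) = - Hess F(X, Y) on tangent vectors. *)
Definition locally_strongly_convex_level (R : realType) (m : nat)
    (F : 'rV[R]_m -> R) : Prop :=
  forall y : 'rV[R]_m, F y = 0 ->
    (exists v : 'rV[R]_m, 'D_v F y != 0) /\
    ((forall v : 'rV[R]_m, v != 0 -> 'D_v F y = 0 -> 0 < 'D_v ('D_v F) y) \/
     (forall v : 'rV[R]_m, v != 0 -> 'D_v F y = 0 -> 'D_v ('D_v F) y < 0)).

(* A nondegenerate quadric of R^m (with invertible bordered matrix, so
   paraboloids are included) that is a locally strongly convex hypersurface. *)
Definition locally_strongly_convex_hyperquadric (R : realType) (m : nat)
    (Q : set 'rV[R]_m) : Prop :=
  exists (B : 'M[R]_m) (b : 'rV[R]_m) (c : R),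
    [/\ B^T = B,
        block_mx B b^T b c%:M \in unitmx,
        locally_strongly_convex_level (quadratic_function B b c)
      & Q = [set y | quadratic_function B b c y = 0] ].

Definition locally_affinely_equivalent (R : realType) (m : nat)
    (M : topologicalType) (x : M -> 'rV[R]_m) (S : set 'rV[R]_m) : Prop :=
  forall p : M, exists (U : set M) (L : 'M[R]_m) (t : 'rV[R]_m),
    [/\ open U, U p, L \in unitmx
      & open_part ((fun q => x q *m L + t) @` U) S ].

Definition hypersurface_i (R : realType) : set 'rV[R]_4 :=
  [set y | y 0 0 * y 0 1 * y 0 2 * y 0 3 = 1].

Definition hypersurface_ii (R : realType) : set 'rV[R]_4 :=
  [set y | y 0 0 ^+ 2 * (y 0 3 ^+ 2 - y 0 1 ^+ 2 - y 0 2 ^+ 2) ^+ 3 = 1].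

Arguments hypersurface_i R : clear implicits.
Arguments hypersurface_ii R : clear implicits.

(* Main.v *)
(* In a frame that is orthonormal for the affine metric h, the derivative of the
   frame splits into the Levi-Civita connection and a totally symmetric, trace
   free cubic form K (apolarity is the volume condition).  The structure
   equations give Ric = 2 H + T with T_ab = tr (K_a K_b), so T is parallel, and
   the Codazzi equation makes the covariant derivative S of K a totally symmetric
   trace free quartic form.  Parallelism of T says that tr (S_da K_b) is skew in
   (a, b); being symmetric in (d, a), it vanishes.

   Choose e_1 maximizing K on the unit sphere.  Then S = 0 at the point unless K
   is invariant under rotations about e_1; on an open set where it is, K is a
   polynomial in the vector field tr (K_a T), which is parallel because T is.
   Hence K is parallel everywhere, and the Ricci identity leaves three normal
   forms for K: zero, axial, and tetrahedral, told apart by the constant |K|^2.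

   The coordinates (v, s) of a fixed point y in the moving frame satisfy a linear
   system with a polynomial first integral, which is the equation of a quadric if
   K = 0, of x1 x2 x3 x4 = 1 if K is tetrahedral, and of
   x1^2 (x4^2 - x2^2 - x3^2)^3 = 1 if K is axial.  The inverse function theorem
   shows that the image is open in that hypersurface. *)
Require Import Defs.
From mathcomp Require Import all_boot all_order all_algebra.
From mathcomp Require Import all_classical all_reals all_analysis.
From mathcomp Require Import fingroup perm ring lra.

Set Implicit Arguments.
Unset Strict Implicit.
Unset Printing Implicit Defensive.

Import Order.TTheory GRing.Theory Num.Theory.
Import numFieldNormedType.Exports.

Local Open Scope classical_set_scope.
Local Open Scope ring_scope.

(** * Smooth functions and matrix calculus *)

(** The obstacle is the axial case: there the linear equations tr (S_da K_b) = 0 have nonzero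
    solutions, so algebra at a single point cannot give S = 0. But nonvanishing of S is an open
    condition. If S were nonzero at a point, K would be axial on a ball, of constant size because
    |K|^2 is constant; then K is determined by a parallel unit field and S vanishes after all.
    Maximality of K at e_1 is used beyond its first and second order conditions. The equations for S
    and the Ricci identity are also satisfied by the axial form seen from a critical vector that is
    not its axis, with eigenvalues in the ratio 2 : 1 : -3, and only the global bound K(v,v,v)^2 <=
    K(e_1,e_1,e_1)^2 |v|^6 excludes that description. For nonzero K the Ricci identity also fixes H
    = -(3/4) K(e_1,e_1,e_1)^2, so there is a center f + xi / H, about which the quartic and the
    axial first integral are written. The alternative must be the same at all points and the quadric
    a single one. Both follow by comparing frames on chart overlaps, where |K|^2 and the equation of
    the quadric agree, and from connectedness. *)

Lemma near_eq_differentiable (R : realType) (V W : normedModType R)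
    (f g : V -> W) (x : V) :
  (\near x, f x = g x) -> differentiable f x -> differentiable g x.
Proof.
move=> fg df.
have gx : g x = f x by rewrite (nbhs_singleton fg).
have gE : g \o shift x = cst (g x) + 'd f x +o_ 0 id.
  apply/eqaddoP => e e0.
  have /eqaddoP /(_ e e0) := diff_locally df.
  apply: filter_app.
  have : \forall h \near (0 : V), f (h + x) = g (h + x).
    move: fg; rewrite (near_shift (0 : V)) subr0; exact: filterS.
  apply: filter_app; near=> h => /= fgh.
  by rewrite -![(_ + _ : _ -> _) _]/(_ + _) -![(- _ : _ -> _) _]/(- _) /= gx fgh.
apply/diff_locallyP.
have dgE := diff_unique (diff_continuous df) gE.
by rewrite dgE; split => //; exact: (diff_continuous df).
Unshelve. all: by end_near. Qed.

Section SmoothScalar.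
Context {R : realType} {n : nat}.
Implicit Types (U : set 'rV[R]_n) (f g : 'rV[R]_n -> R).

Lemma open_near U (P : 'rV[R]_n -> Prop) u :
  open U -> U u -> (forall v, U v -> P v) -> \forall v \near u, P v.
Proof.
move=> Uo Uu UP; apply: (filterS UP); exact: open_nbhs_nbhs.
Qed.

Lemma partial_eq U f g i u : open U -> (forall v, U v -> f v = g v) -> U u ->
  partial i f u = partial i g u.
Proof.
move=> Uo fg Uu; apply: near_eq_derive.
exact: (open_near Uo Uu).
Qed.

(** The product rule does not induct on the words of derivatives in [smooth_on], but it does on the
    order of differentiability. The recursion strips the innermost derivative, hence the [rcons] in
    [smooth_Ck]. *)
Fixpoint Ck (k : nat) U f : Prop :=
  if k is k'.+1 then (forall u, U u -> differentiable f u) /\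
                     (forall i, Ck k' U (partial i f))
  else True.

Lemma smooth_Ck U f : smooth_on U f <-> forall k, Ck k U f.
Proof.
split=> [sf k|cf s u Uu].
  elim: k f sf => [|k IH] f sf //=; split.
    by move=> u Uu; exact: (sf [::]).
  move=> i; apply: IH => s u Uu.
  by have := sf (rcons s i) u Uu; rewrite /partials foldr_rcons.
elim/last_ind: s f cf => [|s i IH] f cf.
  by have [h _] := cf 1%N; exact: h.
rewrite /partials foldr_rcons; apply: IH => k.
by have [_ h] := cf k.+1; exact: h.
Qed.

Lemma Ck_eq k U f g : open U -> (forall v, U v -> f v = g v) ->
  Ck k U f -> Ck k U g.
Proof.
move=> Uo; elim: k f g => [|k IH] f g fg //= [df cf]; split.
  move=> u Uu; apply: near_eq_differentiable (df u Uu); exact: open_near Uo Uu fg.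
by move=> i; apply: IH (cf i) => v; exact: partial_eq.
Qed.

Lemma CkW k U f : Ck k.+1 U f -> Ck k U f.
Proof.
elim: k f => [|k IH] f //= [df cf]; split=> // i; apply: IH; exact: cf.
Qed.

Lemma partialE f u i : differentiable f u -> partial i f u = 'd f u (delta_mx 0 i).
Proof. by move=> df; rewrite /partial deriveE. Qed.

Lemma partial_cst (a : R) i : partial i (cst a : 'rV[R]_n -> R) = cst 0.
Proof. by apply/funext => u; rewrite /partial derive_cst. Qed.

Lemma partialD f g i u : differentiable f u -> differentiable g u ->
  partial i (fun v => f v + g v) u = partial i f u + partial i g u.
Proof. by move=> df dg; rewrite /partial deriveD//; exact: diff_derivable. Qed.

Lemma partialM f g i u : differentiable f u -> differentiable g u ->
  partial i (fun v => f v * g v) u = partial i f u * g u + f u * partial i g u.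
Proof.
move=> df dg; rewrite /partial deriveM; [|exact: diff_derivable..].
by rewrite /GRing.scale /= addrC mulrC [X in _ + X]mulrC mulrC.
Qed.

Lemma partialN f i u : differentiable f u ->
  partial i (fun v => - f v) u = - partial i f u.
Proof. by move=> df; rewrite /partial deriveN//; exact: diff_derivable. Qed.

Lemma Ck_cst k U (a : R) : Ck k U (cst a).
Proof.
elim: k a => [|k IH] a //=; split=> [u _|i]; first exact: differentiable_cst.
by rewrite partial_cst.
Qed.

Lemma CkD k U f g : open U -> Ck k U f -> Ck k U g -> Ck k U (fun v => f v + g v).
Proof.
move=> Uo; elim: k f g => [|k IH] f g //= [df cf] [dg cg]; split.
  by move=> u Uu; apply: differentiableD; [exact: df|exact: dg].
move=> i; apply: (@Ck_eq _ _ (fun v => partial i f v + partial i g v)) => //.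
  by move=> v Uv; rewrite partialD; [|exact: df|exact: dg].
exact: IH.
Qed.

Lemma CkM k U f g : open U -> Ck k U f -> Ck k U g -> Ck k U (fun v => f v * g v).
Proof.
move=> Uo; elim: k f g => [|k IH] f g //= [df cf] [dg cg]; split.
  by move=> u Uu; apply: differentiableM; [exact: df|exact: dg].
move=> i; apply: (@Ck_eq _ _
  (fun v => partial i f v * g v + f v * partial i g v)) => //.
  by move=> v Uv; rewrite partialM; [|exact: df|exact: dg].
apply: CkD => //; apply: IH => //.
  by apply: CkW; split.
by apply: CkW; split.
Qed.

Lemma Ck_inv k U f : open U -> (forall u, U u -> f u != 0) -> Ck k U f ->
  Ck k U (fun v => (f v)^-1).
Proof.
move=> Uo f0; elim: k => [|k IH] //= [df cf].
have cV : Ck k U (fun v => (f v)^-1) by apply: IH; apply: CkW; split.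
split=> [u Uu|i]; first by apply: differentiableV; [exact: df|exact: f0].
apply: (@Ck_eq _ _ (fun v => (- 1) * (partial i f v * ((f v)^-1 * (f v)^-1)))) => //.
  move=> v Uv; rewrite /partial deriveV ?f0//; last exact/diff_derivable/df.
  by rewrite /GRing.scale /= expr2 invfM; ring.
apply: CkM => //; first exact: Ck_cst.
by do 2 (apply: CkM => //).
Qed.

Lemma partial_comp (s : R -> R) (ds : R) f u : differentiable f u ->
  is_derive (f u) 1 s ds ->
  differentiable (fun v => s (f v)) u /\
  forall i, partial i (fun v => s (f v)) u = ds * partial i f u.
Proof.
move=> df [dds dsE].
have {}dds : differentiable s (f u) by apply/derivable1_diffP.
have dc : differentiable (fun v => s (f v)) u by exact: (differentiable_comp df dds).
split=> // i.
have cE : 'd (fun v => s (f v)) u (delta_mx 0 i) = 'd s (f u) ('d f u (delta_mx 0 i)).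
  exact: (congr1 (fun h => h (delta_mx 0 i)) (diff_comp df dds)).
rewrite partialE// cE -partialE//.
move: dsE; rewrite deriveE// => <-.
have <- : partial i f u *: (1 : R) = partial i f u by rewrite /GRing.scale /= mulr1.
by rewrite linearZ/= /GRing.scale/= mulr1 mulrC.
Qed.

Lemma is_derive_sqrt (t : R) : 0 < t ->
  is_derive t 1 (fun r : R => Num.sqrt r) (2^-1 * (Num.sqrt t)^-1).
Proof. by rewrite -invfM => t0; exact: is_derive1_sqrt. Qed.

Lemma differentiable_sqrt f u : differentiable f u -> 0 < f u ->
  differentiable (fun v => Num.sqrt (f v)) u /\
  forall i, partial i (fun v => Num.sqrt (f v)) u =
     2^-1 * (partial i f u * (Num.sqrt (f u))^-1).
Proof.
move=> df f0; have [d1 d2] := partial_comp df (is_derive_sqrt f0).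
by split=> // i; rewrite d2 mulrAC mulrA.
Qed.

Lemma Ck_sqrt k U f : open U -> (forall u, U u -> 0 < f u) -> Ck k U f ->
  Ck k U (fun v => Num.sqrt (f v)).
Proof.
move=> Uo f0; elim: k => [|k IH] //= [df cf].
have cS : Ck k U (fun v => Num.sqrt (f v)) by apply: IH; apply: CkW; split.
split=> [u Uu|i]; first by apply differentiable_sqrt; [exact: df|exact: f0].
apply: (@Ck_eq _ _ (fun v => 2^-1 * (partial i f v * (Num.sqrt (f v))^-1))) => //.
  move=> v Uv; have [_ ->//] := differentiable_sqrt (df v Uv) (f0 v Uv).
apply: CkM => //; first exact: Ck_cst.
apply: CkM => //; apply: Ck_inv => //.
by move=> u Uu; rewrite gt_eqF// sqrtr_gt0 f0.
Qed.

Lemma sm_diff U f u : smooth_on U f -> U u -> differentiable f u.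
Proof. by move=> sf; exact: (sf [::]). Qed.

Lemma sm_partial U f i : smooth_on U f -> smooth_on U (partial i f).
Proof. by move=> /smooth_Ck sf; apply/smooth_Ck => k; have [_ h] := sf k.+1; exact: h. Qed.

Lemma sm_eq U f g : open U -> (forall v, U v -> f v = g v) ->
  smooth_on U f -> smooth_on U g.
Proof.
by move=> Uo fg /smooth_Ck sf; apply/smooth_Ck => k; exact: Ck_eq (sf k).
Qed.

Lemma sm_cst U (a : R) : smooth_on U (fun=> a).
Proof. by apply/smooth_Ck => k; exact: Ck_cst. Qed.

Lemma smD U f g : open U -> smooth_on U f -> smooth_on U g ->
  smooth_on U (fun v => f v + g v).
Proof.
move=> Uo /smooth_Ck sf /smooth_Ck sg; apply/smooth_Ck => k; exact: CkD.
Qed.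

Lemma smM U f g : open U -> smooth_on U f -> smooth_on U g ->
  smooth_on U (fun v => f v * g v).
Proof.
move=> Uo /smooth_Ck sf /smooth_Ck sg; apply/smooth_Ck => k; exact: CkM.
Qed.

Lemma smN U f : open U -> smooth_on U f -> smooth_on U (fun v => - f v).
Proof.
move=> Uo sf; apply: (@sm_eq _ (fun v => (-1) * f v)) => //.
  by move=> v _; rewrite mulN1r.
by apply: smM => //; exact: sm_cst.
Qed.

Lemma smV U f : open U -> (forall u, U u -> f u != 0) -> smooth_on U f ->
  smooth_on U (fun v => (f v)^-1).
Proof.
move=> Uo f0 /smooth_Ck sf; apply/smooth_Ck => k; exact: Ck_inv.
Qed.

Lemma sm_sqrt U f : open U -> (forall u, U u -> 0 < f u) -> smooth_on U f ->
  smooth_on U (fun v => Num.sqrt (f v)).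
Proof.
move=> Uo f0 /smooth_Ck sf; apply/smooth_Ck => k; exact: Ck_sqrt.
Qed.

Lemma sm_sum U (I : Type) (r : seq I) (P : pred I) (F : I -> 'rV[R]_n -> R) :
  open U -> (forall i, smooth_on U (F i)) ->
  smooth_on U (fun v => \sum_(i <- r | P i) F i v).
Proof.
move=> Uo sF; elim: r => [|a r IH].
  apply: (@sm_eq _ (fun=> 0)) => //; first by move=> v _; rewrite big_nil.
  exact: sm_cst.
apply: (@sm_eq _ (fun v => (if P a then F a v else 0) + \sum_(i <- r | P i) F i v)) => //.
  by move=> v _; rewrite big_cons; case: ifP => // _; rewrite add0r.
by apply: smD => //; case: (P a) => //; exact: sm_cst.
Qed.

Lemma sm_prod U (I : Type) (r : seq I) (P : pred I) (F : I -> 'rV[R]_n -> R) :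
  open U -> (forall i, smooth_on U (F i)) ->
  smooth_on U (fun v => \prod_(i <- r | P i) F i v).
Proof.
move=> Uo sF; elim: r => [|a r IH].
  apply: (@sm_eq _ (fun=> 1)) => //; first by move=> v _; rewrite big_nil.
  exact: sm_cst.
apply: (@sm_eq _ (fun v => (if P a then F a v else 1) * \prod_(i <- r | P i) F i v)) => //.
  by move=> v _; rewrite big_cons; case: ifP => // _; rewrite mul1r.
by apply: smM => //; case: (P a) => //; exact: sm_cst.
Qed.

Lemma partial_sum (I : Type) (r : seq I) (P : pred I) (F : I -> 'rV[R]_n -> R) u :
  (forall j, differentiable (F j) u) ->
  differentiable (fun v => \sum_(j <- r | P j) F j v) u /\
  forall i, partial i (fun v => \sum_(j <- r | P j) F j v) u =
  \sum_(j <- r | P j) partial i (F j) u.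
Proof.
move=> dF; elim: r => [|a r [IHd IH]].
  have -> : (fun v => \sum_(j <- [::] | P j) F j v) = cst 0.
    by apply/funext => v; rewrite big_nil.
  split=> [|i]; first exact: differentiable_cst.
  by rewrite partial_cst big_nil.
have -> : (fun v => \sum_(j <- a :: r | P j) F j v) =
   (fun v => (if P a then F a v else cst 0 v) + \sum_(j <- r | P j) F j v).
  by apply/funext => v; rewrite big_cons; case: ifP => // _; rewrite add0r.
have d0 : differentiable (cst 0 : 'rV[R]_n -> R) u by exact: differentiable_cst.
split=> [|i].
  by case: (P a); [exact: differentiableD|exact: (differentiableD d0 IHd)].
rewrite big_cons; case: (P a); first by rewrite partialD// IH.
rewrite (partialD _ d0 IHd) IH.
by rewrite -[X in partial _ X]/(cst 0) partial_cst add0r.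
Qed.

End SmoothScalar.

(** * Mean value estimates and the inverse function theorem *)

Section Calculus.
Context {R : realType} {n : nat}.
Implicit Types (U : set 'rV[R]_n) (f g : 'rV[R]_n -> R).

Lemma is_derive_line f (a w : 'rV[R]_n) (s : R) :
  differentiable f (s *: a + w) ->
  is_derive s 1 (fun t : R => f (t *: a + w)) ('d f (s *: a + w) a).
Proof.
move=> df.
have E : (fun h : R => h^-1 *: (((fun t : R => f (t *: a + w)) \o shift s) (h *: 1) -
            f (s *: a + w))) =
         (fun h : R => h^-1 *: ((f \o shift (s *: a + w)) (h *: a) - f (s *: a + w))).
  apply/funext => h /=; congr (_ *: (f _ - _)).
  by rewrite /GRing.scale /= mulr1 -/(GRing.scale _ _) scalerDl addrA.
have da : derivable f (s *: a + w) a by exact: diff_derivable.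
split; first by rewrite /derivable E.
by rewrite -deriveE// /derive E.
Qed.

Lemma diff_sum f u (v : 'rV[R]_n) : differentiable f u ->
  'd f u v = \sum_i v 0 i * partial i f u.
Proof.
move=> df; rewrite {1}(row_sum_delta v) linear_sum; apply: eq_bigr => i _.
by rewrite linearZ partialE.
Qed.

Lemma norm_delta (i : 'I_n) : `|delta_mx 0 i : 'rV[R]_n| <= 1.
Proof.
rewrite /Num.Def.normr /= mx_normrE; apply: bigmax_le => // -[k j] _ /=.
by rewrite mxE; case: (_ && _); rewrite ?normr1 ?normr0.
Qed.

(** The mean value theorem in direction [i] turns the second difference over a square of side [t]
    into a difference of values of [partial i f], and differentiability of that function at [u]
    gives the estimate. The second difference is symmetric in [i] and [j], whence the symmetry of
    second derivatives in [partialC]. *)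
Lemma mixed_difference U f i j u e : open U -> smooth_on U f -> U u -> 0 < e ->
  exists2 d, 0 < d & forall t, 0 < t < d ->
   `|f (t *: delta_mx 0 i + (t *: delta_mx 0 j + u)) - f (t *: delta_mx 0 i + u)
     - f (t *: delta_mx 0 j + u) + f u - t ^+ 2 * partial j (partial i f) u|
   <= e * 3 * t ^+ 2.
Proof.
move=> Uo sf Uu e0.
set a := delta_mx 0 i; set b := delta_mx 0 j; set g := partial i f.
have dg : differentiable g u by apply: sm_diff Uu; exact: sm_partial.
have /eqaddoP/(_ e e0) := diff_locally dg.
move=> /nbhs_ballP[d1 /= d10 H1].
have /nbhs_ballP[d2 /= d20 H2] : \forall h \near u, U h.
  exact: open_nbhs_nbhs.
have Hg h : `|h| < d1 -> `|g (h + u) - (g u + 'd g u h)| <= e * `|h|.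
  by move=> hd; apply: H1; rewrite -ball_normE /= sub0r normrN.
have HU h : `|h| < d2 -> U (h + u).
  by move=> hd; apply: H2; rewrite -ball_normE /= opprD addrCA subrr addr0 normrN.
exists (Num.min d1 d2 / 2); first by rewrite divr_gt0// lt_min d10 d20.
move=> t /andP[t0 td].
have na s : 0 <= s -> s <= t -> `|s *: a| <= t.
  move=> s0 st; rewrite normrZ ger0_norm//.
  by apply: le_trans st; rewrite ler_piMr// norm_delta.
have nb : `|t *: b| <= t.
  by rewrite normrZ gtr0_norm// ler_piMr ?norm_delta// ltW.
have td1 : t + t < d1.
  have hm : Num.min d1 d2 <= d1 by rewrite ge_min lexx.
  by move: td hm; rewrite ltr_pdivlMr//; lra.
have td2 : t + t < d2.
  have hm : Num.min d1 d2 <= d2 by rewrite ge_min lexx orbT.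
  by move: td hm; rewrite ltr_pdivlMr//; lra.
have n2 s : 0 <= s -> s <= t -> `|s *: a + t *: b| <= t + t.
  by move=> s0 st; apply: le_trans (ler_normD _ _) _; rewrite lerD// na.
have df h : `|h| < d2 -> differentiable f (h + u).
  by move=> hd; exact: sm_diff sf (HU _ hd).
pose psi (s : R) := f (s *: a + (t *: b + u)) - f (s *: a + u).
pose dpsi (s : R) := g (s *: a + (t *: b + u)) - g (s *: a + u).
have dps s : 0 <= s -> s <= t -> is_derive s 1 psi (dpsi s).
  move=> s0 st; rewrite /dpsi /g !partialE.
  - apply: is_deriveB; apply: is_derive_line.
      by rewrite addrA; apply: df; apply: le_lt_trans td2; exact: n2.
    apply: df; apply: le_lt_trans (na _ s0 st) _; apply: lt_trans td2; lra.
  - apply: df; apply: le_lt_trans (na _ s0 st) _; apply: lt_trans td2; lra.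
  - by rewrite addrA; apply: df; apply: le_lt_trans td2; exact: n2.
have [||c cI E] := @MVT R psi dpsi 0 t t0.
- by move=> s; rewrite in_itv /= => /andP[s0 st]; apply: dps; exact: ltW.
- apply: derivable_within_continuous => s; rewrite in_itv /= => /andP[s0 st].
  by have [] := dps s s0 st.
move: cI; rewrite in_itv /= => /andP[/ltW c0 /ltW ct].
have -> : f (t *: a + (t *: b + u)) - f (t *: a + u) - f (t *: b + u) + f u
   = dpsi c * t.
  by move: E; rewrite subr0 /psi !scale0r !add0r => <-; ring.
have G1 := Hg (c *: a + t *: b) (le_lt_trans (n2 _ c0 ct) td1).
have G2 : `|g (c *: a + u) - (g u + 'd g u (c *: a))| <= e * `|c *: a|.
  by apply: Hg; apply: le_lt_trans (na _ c0 ct) _; apply: lt_trans td1; lra.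
have L : 'd g u (c *: a + t *: b) = 'd g u (c *: a) + t * partial j g u.
  by rewrite linearD [in X in _ + X]linearZ partialE.
rewrite L in G1; rewrite -addrA in G1.
have -> : dpsi c * t - t ^+ 2 * partial j g u =
   t * ((g (c *: a + (t *: b + u)) - (g u + ('d g u (c *: a) + t * partial j g u))) -
        (g (c *: a + u) - (g u + 'd g u (c *: a)))).
  by rewrite /dpsi; ring.
rewrite normrM gtr0_norm//.
have {}G1 := le_trans G1 (ler_wpM2l (ltW e0) (n2 _ c0 ct)).
have {}G2 := le_trans G2 (ler_wpM2l (ltW e0) (na _ c0 ct)).
have G := le_trans (ler_normB _ _) (lerD G1 G2).
apply: le_trans (ler_wpM2l (ltW t0) G) _.
by rewrite le_eqVlt; apply/orP; left; apply/eqP; ring.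
Qed.

Lemma partialC U f i j u : open U -> smooth_on U f -> U u ->
  partial i (partial j f) u = partial j (partial i f) u.
Proof.
move=> Uo sf Uu; apply/eqP; rewrite -subr_eq0; apply/eqP.
apply/normr0_eq0/eqP; rewrite eq_le normr_ge0 andbT.
apply/ler_addgt0Pl => e e0; rewrite addr0.
have e60 : 0 < e / 6 by rewrite divr_gt0.
have [d1 d10 H1] := mixed_difference i j Uo sf Uu e60.
have [d2 d20 H2] := mixed_difference j i Uo sf Uu e60.
pose t := Num.min d1 d2 / 2.
have m0 : 0 < Num.min d1 d2 by rewrite lt_min d10 d20.
have t0 : 0 < t by rewrite divr_gt0.
have tm : t < Num.min d1 d2 by rewrite /t; lra.
have /H1 {}H1 : 0 < t < d1 by rewrite t0 (lt_le_trans tm)// ge_min lexx.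
have /H2 {}H2 : 0 < t < d2 by rewrite t0 (lt_le_trans tm)// ge_min lexx orbT.
have t20 : 0 < t ^+ 2 by rewrite exprn_gt0.
rewrite -(ler_pM2l t20).
have -> : t ^+ 2 * `|partial i (partial j f) u - partial j (partial i f) u| =
   `|t ^+ 2 * (partial i (partial j f) u - partial j (partial i f) u)|.
  by rewrite normrM (gtr0_norm t20).
have -> : t ^+ 2 * e = (e / 6 * 3 * t ^+ 2) + (e / 6 * 3 * t ^+ 2) by field.
apply: le_trans (lerD H1 H2); apply: le_trans (ler_normB _ _).
rewrite le_eqVlt; apply/orP; left; apply/eqP; congr (`|_|).
rewrite [t *: delta_mx 0 j + (t *: delta_mx 0 i + u)]addrCA.
move: (partial i (partial j f) u) (partial j (partial i f) u) (f u) => A B C.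
move: (f (_ + (_ + _))) (f (t *: delta_mx 0 i + u)) (f (t *: delta_mx 0 j + u)).
by move=> D E F; ring.
Qed.

Lemma constant_on_ball f (u : 'rV[R]_n) r :
  (forall v, ball u r v -> differentiable f v) ->
  (forall v i, ball u r v -> partial i f v = 0) ->
  forall v, ball u r v -> f v = f u.
Proof.
move=> df f0 v uv.
have B (s : R) : 0 <= s -> s <= 1 -> ball u r (s *: (v - u) + u).
  move=> s0 s1; move: uv; rewrite -ball_normE /= => uv.
  rewrite opprD addrCA subrr addr0 normrN normrZ ger0_norm//.
  by apply: le_lt_trans uv; rewrite distrC ler_piMl.
have D (s : R) : 0 <= s -> s <= 1 ->
    is_derive s 1 (fun t : R => f (t *: (v - u) + u)) (cst 0 s).
  move=> s0 s1; have dd := df _ (B s s0 s1).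
  have := is_derive_line dd; rewrite diff_sum// big1// => i _.
  by rewrite f0 ?mulr0//; exact: B.
have [||c cI] := @MVT R (fun t : R => f (t *: (v - u) + u)) (cst 0) 0 1 ltr01.
- by move=> s; rewrite in_itv /= => /andP[/ltW s0 /ltW st]; exact: D.
- apply: derivable_within_continuous => s; rewrite in_itv /= => /andP[s0 st].
  by have [] := D s s0 st.
rewrite scale1r subrK scale0r add0r /cst mul0r => /eqP.
by rewrite subr_eq0 => /eqP.
Qed.


Lemma partial_local_min f (v : 'rV[R]_n) r i : 0 < r ->
  (forall w, ball v r w -> differentiable f w) ->
  (forall w, ball v r w -> f v <= f w) -> partial i f v = 0.
Proof.
move=> r0 df fm.
have B (t : R) : t \in `]-r, r[%R -> ball v r (t *: delta_mx 0 i + v).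
  rewrite in_itv /= => /andP[t1 t2].
  rewrite -ball_normE /= opprD addrCA subrr addr0 normrN normrZ.
  apply: (@le_lt_trans _ _ `|t|); first by rewrite ler_piMr// norm_delta.
  by rewrite ltr_norml t1.
have t0 : 0 \in `](- r), r[%R by rewrite in_itv /= oppr_lt0 r0.
have D t : t \in `](- r), r[%R -> is_derive t 1
    (fun t : R => f (t *: delta_mx 0 i + v)) ('d f (t *: delta_mx 0 i + v) (delta_mx 0 i)).
  by move=> tI; apply: is_derive_line; apply: df; exact: B.
have [_ E] : is_derive (0 : R) 1 (fun t : R => f (t *: delta_mx 0 i + v)) 0.
  apply: (@derive1_at_min _ _ (- r) r) => //.
  - by rewrite ge0_cp// ltW.
  - by move=> t tI; have [] := D t tI.
  - by move=> t tI; rewrite scale0r add0r; apply: fm; exact: B.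
have [_ E'] := D 0 t0.
have B0 : ball v r v by exact: ballxx.
rewrite [in RHS]scale0r add0r in E'.
rewrite partialE; last exact: df.
exact: etrans (esym E') E.
Qed.

Definition jac {m} (g : 'rV[R]_n -> 'rV[R]_m) (u : 'rV[R]_n) : 'M[R]_(n, m) :=
  \matrix_(i, k) partial i (fun v => g v 0 k) u.

Lemma norm_mulmx_le m (N : 'M[R]_(n, m)) :
  exists2 C : R, 0 < C & forall w : 'rV[R]_n, `|w *m N| <= C * `|w|.
Proof.
exists (1 + \sum_i \sum_k `|N i k|).
  by rewrite ltr_wpDr// sumr_ge0// => i _; rewrite sumr_ge0.
move=> w; rewrite {1}/Num.Def.normr /= mx_normrE; apply: bigmax_le.
  rewrite mulr_ge0// addr_ge0//.
  by rewrite sumr_ge0// => i _; rewrite sumr_ge0.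
move=> [k j] _ /=; rewrite mxE.
apply: le_trans (ler_norm_sum _ _ _) _.
apply: (@le_trans _ _ (\sum_i \sum_k0 `|N i k0| * `|w|)).
  apply: ler_sum => i _; rewrite (bigD1 j)//= -[leLHS]addr0 lerD//.
    rewrite normrM mulrC ler_wpM2l// [leRHS]/Num.Def.normr/= mx_normrE.
    exact: (le_bigmax _ _ (k, i)).
  by rewrite sumr_ge0// => l _; rewrite mulr_ge0.
rewrite mulrDl mul1r -[leLHS]add0r lerD//.
by rewrite mulr_suml; apply: ler_sum => i _; rewrite mulr_suml.
Qed.

Lemma norm_coord m (w : 'rV[R]_m) k : `|w 0 k| <= `|w|.
Proof. by rewrite [leRHS]/Num.Def.normr/= mx_normrE; exact: (le_bigmax _ _ (0, k)). Qed.

Lemma norm_le_coord m (w : 'rV[R]_m) (c : R) : 0 <= c ->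
  (forall k, `|w 0 k| <= c) -> `|w| <= c.
Proof.
move=> c0 H; rewrite [leLHS]/Num.Def.normr/= mx_normrE.
by apply: bigmax_le => // -[k j] _ /=; rewrite ord1.
Qed.

Lemma norm_lt_coord m (w : 'rV[R]_m) (c : R) : 0 < c ->
  (forall k, `|w 0 k| < c) -> `|w| < c.
Proof.
move=> c0 H; rewrite [ltLHS]/Num.Def.normr/= mx_normrE.
by apply: bigmax_lt => // -[k j] _ /=; rewrite ord1.
Qed.

Lemma sm_det U m (F : 'rV[R]_n -> 'M[R]_m) : open U ->
  (forall i j, smooth_on U (fun v => F v i j)) -> smooth_on U (fun v => \det (F v)).
Proof.
move=> Uo sF; rewrite /determinant; apply: sm_sum => // s.
apply: smM => //; first exact: sm_cst.
exact: sm_prod.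
Qed.

Lemma near_ball (u : 'rV[R]_n) (P : set 'rV[R]_n) : (\forall v \near u, P v) ->
  exists2 r, 0 < r & forall w, `|w| < r -> P (w + u).
Proof.
move=> /nbhs_ballP[r /= r0 H]; exists r => // w wr; apply: H.
by rewrite -ball_normE /= opprD addrCA subrr addr0 normrN.
Qed.

Lemma differentiable_bound f u e : differentiable f u -> 0 < e ->
  exists2 d, 0 < d & forall h, `|h| < d -> `|f (h + u) - f u - 'd f u h| <= e * `|h|.
Proof.
move=> df e0; have /eqaddoP/(_ e e0) := diff_locally df.
move=> /nbhs_ballP[d /= d0 H]; exists d => // h hd.
have := H h; rewrite -ball_normE /= sub0r normrN => /(_ hd).
by rewrite -![(_ + _ : _ -> _) _]/(_ + _) -![(- _ : _ -> _) _]/(- _) /= opprD addrA.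
Qed.

(** A minimum of |g v - y|^2 on a closed ball around [u] exists by compactness. Invertibility of the
    Jacobian at [u] keeps [g] away from [g u] on the boundary, so for [y] near [g u] the minimum is
    interior; there the gradient 2 (g - y) J^T vanishes, and J is still invertible. *)
Theorem locally_surjective U (g : 'rV[R]_n -> 'rV[R]_n) u : open U ->
  (forall k, smooth_on U (fun v => g v 0 k)) -> U u -> jac g u \in unitmx ->
  exists2 e, 0 < e & forall y, `|y - g u| < e -> exists2 v, U v & g v = y.
Proof.
move=> Uo sg Uu Ju.
have sdet : smooth_on U (fun v => \det (jac g v)).
  apply: sm_det => // i k; under [fun v => _]eq_fun do rewrite mxE.
  exact: sm_partial.
have [r1 r10 H1] : exists2 r, 0 < r & forall w, `|w| < r ->
    U (w + u) /\ \det (jac g (w + u)) != 0.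
  apply: (@near_ball u (fun v => U v /\ \det (jac g v) != 0)).
  near=> v; split; first by near: v; exact: open_nbhs_nbhs.
  near: v.
  have cdet : {for u, continuous (fun v => \det (jac g v))}.
    by apply: differentiable_continuous; exact: sm_diff sdet Uu.
  have : \forall t \near \det (jac g u), t != 0.
    by apply: (open_nbhs_nbhs (conj (@open_neq _ 0) _)); rewrite /= -unitfE -unitmxE.
  exact: cdet.
have [C C0 HC] := norm_mulmx_le (invmx (jac g u)).
have C20 : 0 < (2 * C)^-1 by rewrite invr_gt0 mulr_gt0.
have [r2 r20 H2] : exists2 d, 0 < d & forall h, `|h| < d ->
    forall k, `|g (h + u) 0 k - g u 0 k - (h *m jac g u) 0 k| <= (2 * C)^-1 * `|h|.
  have H k : exists d, 0 < d /\ forall h, `|h| < d ->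
     `|g (h + u) 0 k - g u 0 k - (h *m jac g u) 0 k| <= (2 * C)^-1 * `|h|.
    have [d d0 Hd] := differentiable_bound (sm_diff (sg k) Uu) C20.
    exists d; split => // h hd; have := Hd h hd.
    rewrite diff_sum; last exact: sm_diff (sg k) Uu.
    by rewrite mxE; under [in X in _ -> X]eq_bigr do rewrite mxE.
  have /choice[d Hd] := H.
  exists (\big[Num.min/1]_k d k).
    by apply: lt_bigmin => // k _; have [] := Hd k.
  move=> h hd k; have [_ ->//] := Hd k.
  by apply: lt_le_trans hd _; exact: bigmin_le_cond.
(* The linear part has norm at least |h| / C, the remainder at most |h| / (2 C). *)
have lower h : `|h| < r2 -> (2 * C)^-1 * `|h| <= `|g (h + u) - g u|.
  move=> hr; set X := `|g (h + u) - g u|.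
  have h1 : `|h| <= C * `|h *m jac g u|.
    by rewrite -{1}(mulmxK Ju h) HC.
  have h2 : `|h *m jac g u| <= X + (2 * C)^-1 * `|h|.
    rewrite -[h *m jac g u](subrK (g (h + u) - g u)) addrC.
    apply: le_trans (ler_normD _ _) _; rewrite lerD2l.
    apply: norm_le_coord => [|k]; first by rewrite mulr_ge0// ltW.
    have -> : (h *m jac g u - (g (h + u) - g u)) 0 k =
        - (g (h + u) 0 k - g u 0 k - (h *m jac g u) 0 k).
      rewrite !mxE; move: (\sum_j _) (g (h + u) 0 k) (g u 0 k) => a b c; ring.
    by rewrite normrN; exact: H2.
  have {h1} h1 := le_trans h1 (ler_wpM2l (ltW C0) h2).
  rewrite -(ler_pM2l (mulr_gt0 (@ltr0n R 2) C0)).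
  rewrite mulrA mulfV ?mul1r; last by rewrite gt_eqF// mulr_gt0.
  have e1 : C * ((2 * C)^-1 * `|h|) = `|h| / 2 by field; rewrite gt_eqF.
  by move: h1; rewrite mulrDr e1; lra.
pose r := Num.min r1 r2 / 2.
have m0 : 0 < Num.min r1 r2 by rewrite lt_min r10 r20.
have r0 : 0 < r by rewrite divr_gt0.
have rm : r < Num.min r1 r2 by rewrite /r; lra.
have rr1 : r < r1 by rewrite (lt_le_trans rm)// ge_min lexx.
have rr2 : r < r2 by rewrite (lt_le_trans rm)// ge_min lexx orbT.
(* On the sphere of radius [r] the image is at distance at least (n + 2) e from [g u], so at least
   (n + 1) e from [y], while [phi u] is at most n e^2; the factor n comes from comparing the sup
   norm with the sum of squares in [phi]. *)
pose e := (2 * C)^-1 * r / n.+2%:R.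
have e0 : 0 < e by rewrite divr_gt0// mulr_gt0.
exists e => // y ye.
pose phi v := \sum_k (g v 0 k - y 0 k) * (g v 0 k - y 0 k).
have dk v : U v -> forall k, differentiable (fun v => g v 0 k - y 0 k) v.
  move=> Uv k; apply: differentiableB; first exact: sm_diff (sg k) Uv.
  exact: differentiable_cst.
have dphi v : U v -> differentiable phi v /\
    forall i, partial i phi v = 2 * ((g v - y) *m (jac g v)^T) 0 i.
  move=> Uv.
  have dkk k : differentiable (fun v => (g v 0 k - y 0 k) * (g v 0 k - y 0 k)) v.
    by apply: differentiableM; exact: dk.
  have [ds ps] := partial_sum (index_enum 'I_n) predT dkk.
  split=> [//|i]; rewrite /phi ps mxE mulr_sumr; apply: eq_bigr => k _.
  have p1 : partial i (fun v => g v 0 k - y 0 k) v = partial i (fun v => g v 0 k) v.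
    rewrite partialD; [|exact: sm_diff (sg k) Uv|exact: differentiable_cst].
    by rewrite -[X in _ + partial _ X _]/(cst (- y 0 k)) partial_cst addr0.
  by rewrite partialM; [|exact: dk..]; rewrite p1 !mxE; ring.
have ballU v : `|v - u| <= r -> U v /\ \det (jac g v) != 0.
  by move=> vr; rewrite -[v](subrK u); apply: H1; apply: le_lt_trans vr rr1.
have [] := @EVT_min_rV R n phi (closed_ball u r).
- by exists u; exact: closed_ballxx.
- apply: bounded_closed_compact; last exact: closed_ball_closed.
  exists (`|u| + r); split; first exact: num_real.
  move=> M hM v; rewrite closed_ballE//= /closed_ball_ /= => vr.
  apply: le_trans (ltW hM); rewrite -[v](subrK u) addrC.
  by apply: le_trans (ler_normD _ _) _; rewrite lerD2l distrC.
- apply: continuous_in_subspaceT => v /set_mem.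
  rewrite closed_ballE//= /closed_ball_ /= distrC => /ballU[Uv _].
  by apply: differentiable_continuous; have [] := dphi v Uv.
move=> c /set_mem; rewrite closed_ballE//= /closed_ball_ /= distrC => cr cmin.
have phiu : phi u < (n.+1%:R * e) ^+ 2.
  apply: (@le_lt_trans _ _ (\sum_(k < n) e ^+ 2)).
    apply: ler_sum => k _; rewrite -expr2 -real_normK ?num_real//.
    rewrite lerXn2r ?nnegrE// 1?ltW//.
    apply: le_lt_trans ye; rewrite [leRHS]distrC.
    by have := norm_coord (g u - y) k; rewrite !mxE.
  have -> : \sum_(k < n) e ^+ 2 = n%:R * e ^+ 2.
    by rewrite sumr_const card_ord mulr_natl.
  rewrite [ltRHS]exprMn -subr_gt0 -mulrBl mulr_gt0 ?exprn_gt0// subr_gt0.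
  by rewrite -natrX ltr_nat -mulnn mulSn ltn_addr.
have {}cr : `|c - u| < r.
  rewrite lt_neqAle cr andbT; apply/eqP => cE.
  have l1 := lower (c - u); rewrite cE subrK in l1.
  have {l1}l1 : n.+1%:R * e <= `|g c - y|.
    have h1 := ler_normD (g c - y) (y - g u); rewrite subrKA in h1.
    have {}h1 := le_trans (l1 rr2) h1.
    have E : (2 * C)^-1 * r = n.+2%:R * e by rewrite /e [RHS]mulrC divfK// pnatr_eq0.
    by move: h1 ye; rewrite E -(natr1 n.+1) mulrDl mul1r; lra.
  have l2 : (n.+1%:R * e) ^+ 2 <= phi c.
    have ne0 : 0 <= n.+1%:R * e by rewrite mulr_ge0// ltW.
    have [k kE] : exists k, n.+1%:R * e <= `|g c 0 k - y 0 k|.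
      apply/existsP; apply: contraT; rewrite negb_exists => /forallP H.
      move: l1; rewrite leNgt => /negP; case.
      apply: norm_lt_coord => [|k].
        by rewrite mulr_gt0.
      by move: (H k); rewrite -ltNge !mxE.
    rewrite /phi (bigD1 k)//= -[leLHS]addr0 lerD//; last first.
      by rewrite sumr_ge0// => i _; rewrite -expr2 sqr_ge0.
    by rewrite -expr2 -(real_normK (num_real (g c 0 k - y 0 k))) lerXn2r// nnegrE.
  have cu : phi c <= phi u.
    by apply: cmin; apply/mem_set; rewrite /closed_ball_ /= subrr normr0 ltW.
  by have := le_lt_trans (le_trans l2 cu) phiu; rewrite ltxx.
have [Uc Jc] := ballU c (ltW cr).
exists c => //; apply/eqP; rewrite -subr_eq0; apply/eqP.
have r'0 : 0 < r - `|c - u| by rewrite subr_gt0.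
have Bc w : ball c (r - `|c - u|) w -> `|w - u| <= r.
  rewrite -ball_normE /= distrC => wc.
  rewrite -(subrKA c); apply: le_trans (ler_normD _ _) _.
  by move: wc; lra.
have grad : (g c - y) *m (jac g c)^T = 0.
  apply/rowP => i; rewrite [RHS]mxE.
  have : partial i phi c = 0.
    apply: (@partial_local_min phi c (r - `|c - u|) i r'0) => w wB.
      by have [Uw _] := ballU w (Bc w wB); have [] := dphi w Uw.
    apply: cmin; apply/mem_set; rewrite /closed_ball_ /= distrC.
    exact: Bc.
  have [_ ->] := dphi c Uc; move/eqP; rewrite mulf_eq0 pnatr_eq0 /=.
  by move/eqP.
have Jt : (jac g c)^T \in unitmx by rewrite unitmx_tr unitmxE unitfE.
by rewrite -(mulmxK Jt (g c - y)) grad mul0mx.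
Unshelve. all: by end_near. Qed.
End Calculus.

(** * Matrix-valued functions and the derivative of a determinant *)

Section MatrixCalculus.
Context {R : realType} {n : nat}.
Implicit Types U : set 'rV[R]_n.

Definition smx {p q} U (F : 'rV[R]_n -> 'M[R]_(p, q)) : Prop :=
  forall a b, smooth_on U (fun v => F v a b).

Definition dm {p q} (i : 'I_n) (F : 'rV[R]_n -> 'M[R]_(p, q)) u : 'M[R]_(p, q) :=
  \matrix_(a, b) partial i (fun v => F v a b) u.

Lemma dmE p q (F : 'rV[R]_n -> 'M[R]_(p, q)) i u a b :
  dm i F u a b = partial i (fun v => F v a b) u.
Proof. by rewrite mxE. Qed.

Lemma smx_eq p q U (F G : 'rV[R]_n -> 'M[R]_(p, q)) : open U ->
  (forall v, U v -> F v = G v) -> smx U F -> smx U G.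
Proof. by move=> Uo FG sF a b; apply: sm_eq (sF a b) => // v /FG ->. Qed.

Lemma smx_cst p q U (C : 'M[R]_(p, q)) : smx U (fun=> C).
Proof. by move=> a b; exact: sm_cst. Qed.

Lemma smxD p q U (F G : 'rV[R]_n -> 'M[R]_(p, q)) : open U ->
  smx U F -> smx U G -> smx U (fun v => F v + G v).
Proof.
move=> Uo sF sG a b; apply: (@sm_eq _ _ _ (fun v => F v a b + G v a b)) => //.
  by move=> v _; rewrite mxE.
exact: smD.
Qed.

Lemma smxZ p q U (f : 'rV[R]_n -> R) (F : 'rV[R]_n -> 'M[R]_(p, q)) : open U ->
  smooth_on U f -> smx U F -> smx U (fun v => f v *: F v).
Proof.
move=> Uo sf sF a b; apply: (@sm_eq _ _ _ (fun v => f v * F v a b)) => //.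
  by move=> v _; rewrite mxE.
exact: smM.
Qed.

Lemma smxN p q U (F : 'rV[R]_n -> 'M[R]_(p, q)) : open U ->
  smx U F -> smx U (fun v => - F v).
Proof.
move=> Uo sF a b; apply: (@sm_eq _ _ _ (fun v => - F v a b)) => //.
  by move=> v _; rewrite mxE.
exact: smN.
Qed.

Lemma smxB p q U (F G : 'rV[R]_n -> 'M[R]_(p, q)) : open U ->
  smx U F -> smx U G -> smx U (fun v => F v - G v).
Proof. by move=> Uo sF sG; apply: smxD => //; exact: smxN. Qed.

Lemma smxM p q r U (F : 'rV[R]_n -> 'M[R]_(p, q)) (G : 'rV[R]_n -> 'M[R]_(q, r)) :
  open U -> smx U F -> smx U G -> smx U (fun v => F v *m G v).
Proof.
move=> Uo sF sG a b; apply: (@sm_eq _ _ _ (fun v => \sum_j F v a j * G v j b)) => //.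
  by move=> v _; rewrite mxE.
by apply: sm_sum => // j; exact: smM.
Qed.

Lemma smxT p q U (F : 'rV[R]_n -> 'M[R]_(p, q)) : open U ->
  smx U F -> smx U (fun v => (F v)^T).
Proof.
move=> Uo sF a b; apply: (@sm_eq _ _ _ (fun v => F v b a)) => //.
by move=> v _; rewrite mxE.
Qed.

Lemma smx_sum p q U (I : Type) (r : seq I) (P : pred I)
    (F : I -> 'rV[R]_n -> 'M[R]_(p, q)) : open U ->
  (forall i, smx U (F i)) -> smx U (fun v => \sum_(i <- r | P i) F i v).
Proof.
move=> Uo sF a b.
apply: (@sm_eq _ _ _ (fun v => \sum_(i <- r | P i) F i v a b)) => //.
  by move=> v _; rewrite summxE.
by apply: sm_sum => // i; exact: sF.
Qed.

Lemma smx_row p q U (F : 'rV[R]_n -> 'M[R]_(p, q)) k : open U ->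
  smx U F -> smx U (fun v => row k (F v)).
Proof.
move=> Uo sF a b; apply: (@sm_eq _ _ _ (fun v => F v k b)) => //.
by move=> v _; rewrite mxE.
Qed.

Lemma smx_dm p q U (F : 'rV[R]_n -> 'M[R]_(p, q)) i : open U ->
  smx U F -> smx U (dm i F).
Proof.
move=> Uo sF a b.
apply: (@sm_eq _ _ _ (partial i (fun v => F v a b))) => //.
  by move=> v _; rewrite mxE.
exact: sm_partial.
Qed.

Lemma smx_det p U (F : 'rV[R]_n -> 'M[R]_p) : open U -> smx U F ->
  smooth_on U (fun v => \det (F v)).
Proof. by move=> Uo sF; exact: sm_det. Qed.

Lemma smx_inv p U (F : 'rV[R]_n -> 'M[R]_p) : open U ->
  (forall v, U v -> F v \in unitmx) -> smx U F -> smx U (fun v => invmx (F v)).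
Proof.
move=> Uo uF sF.
apply: (@smx_eq _ _ _ (fun v => (\det (F v))^-1 *: \adj (F v))) => //.
  by move=> v Uv; rewrite /invmx (uF v Uv).
apply: smxZ => //.
  by apply: smV => //; [move=> v /uF; rewrite unitmxE unitfE|exact: smx_det].
move=> a b; apply: (@sm_eq _ _ _ (fun v => cofactor (F v) b a)) => //.
  by move=> v _; rewrite mxE.
rewrite /cofactor; apply: smM => //; first exact: sm_cst.
apply: smx_det => // c d.
apply: (@sm_eq _ _ _ (fun v => F v (lift b c) (lift a d))) => //.
by move=> v _; rewrite !mxE.
Qed.

Lemma dm_eq p q U (F G : 'rV[R]_n -> 'M[R]_(p, q)) i u : open U ->
  (forall v, U v -> F v = G v) -> U u -> dm i F u = dm i G u.
Proof.
move=> Uo FG Uu; apply/matrixP => a b; rewrite !mxE.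
by apply: (partial_eq (U := U)) => // v /FG ->.
Qed.

Lemma dm_cst p q (C : 'M[R]_(p, q)) i u : dm i (fun=> C) u = 0.
Proof.
apply/matrixP => a b; rewrite !mxE.
by rewrite -[X in partial _ X]/(cst (C a b)) partial_cst.
Qed.

Lemma dmD p q U (F G : 'rV[R]_n -> 'M[R]_(p, q)) i u :
  smx U F -> smx U G -> U u -> dm i (fun v => F v + G v) u = dm i F u + dm i G u.
Proof.
move=> sF sG Uu; apply/matrixP => a b; rewrite !mxE.
under [X in partial _ X]eq_fun do rewrite mxE.
by rewrite partialD//; apply: (sm_diff _ Uu).
Qed.

Lemma dmN p q U (F : 'rV[R]_n -> 'M[R]_(p, q)) i u :
  smx U F -> U u -> dm i (fun v => - F v) u = - dm i F u.
Proof.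
move=> sF Uu; apply/matrixP => a b; rewrite !mxE.
under [X in partial _ X]eq_fun do rewrite mxE.
by rewrite partialN//; apply: (sm_diff _ Uu).
Qed.

Lemma dmB p q U (F G : 'rV[R]_n -> 'M[R]_(p, q)) i u : open U ->
  smx U F -> smx U G -> U u -> dm i (fun v => F v - G v) u = dm i F u - dm i G u.
Proof.
by move=> Uo sF sG Uu; rewrite (dmD i sF (smxN Uo sG) Uu) (dmN i sG Uu).
Qed.

Lemma dmZ p q U (f : 'rV[R]_n -> R) (F : 'rV[R]_n -> 'M[R]_(p, q)) i u :
  smooth_on U f -> smx U F -> U u ->
  dm i (fun v => f v *: F v) u = partial i f u *: F u + f u *: dm i F u.
Proof.
move=> sf sF Uu; apply/matrixP => a b; rewrite !mxE.
under [X in partial _ X]eq_fun do rewrite mxE.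
by rewrite partialM//; apply: (sm_diff _ Uu).
Qed.

Lemma dmM p q r U (F : 'rV[R]_n -> 'M[R]_(p, q)) (G : 'rV[R]_n -> 'M[R]_(q, r)) i u :
  open U -> smx U F -> smx U G -> U u ->
  dm i (fun v => F v *m G v) u = dm i F u *m G u + F u *m dm i G u.
Proof.
move=> Uo sF sG Uu; apply/matrixP => a b; rewrite !mxE.
under [X in partial _ X]eq_fun do rewrite mxE.
have dFG j : differentiable (fun v => F v a j * G v j b) u.
  by apply: differentiableM; apply: (sm_diff _ Uu).
have [_ ->] := partial_sum (index_enum 'I_q) predT dFG.
rewrite -big_split; apply: eq_bigr => j _; rewrite !mxE.
by rewrite partialM//; apply: (sm_diff _ Uu).
Qed.

Lemma dmT p q (F : 'rV[R]_n -> 'M[R]_(p, q)) i u :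
  dm i (fun v => (F v)^T) u = (dm i F u)^T.
Proof.
apply/matrixP => a b; rewrite !mxE.
by under [X in partial _ X]eq_fun do rewrite mxE.
Qed.

Lemma dm_row p q (F : 'rV[R]_n -> 'M[R]_(p, q)) k i u :
  dm i (fun v => row k (F v)) u = row k (dm i F u).
Proof.
apply/matrixP => a b; rewrite !mxE.
by under [X in partial _ X]eq_fun do rewrite mxE.
Qed.

Lemma dm_sum p q U (I : Type) (r : seq I) (P : pred I)
    (F : I -> 'rV[R]_n -> 'M[R]_(p, q)) i u : open U ->
  (forall j, smx U (F j)) -> U u ->
  dm i (fun v => \sum_(j <- r | P j) F j v) u = \sum_(j <- r | P j) dm i (F j) u.
Proof.
move=> Uo sF Uu; apply/matrixP => a b; rewrite mxE summxE.
under [X in partial _ X]eq_fun do rewrite summxE.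
have dF j : differentiable (fun v => F j v a b) u by exact: (sm_diff (sF j a b) Uu).
have [_ ->] := partial_sum r P dF.
by apply: eq_bigr => j _; rewrite mxE.
Qed.

Lemma dmC p q U (F : 'rV[R]_n -> 'M[R]_(p, q)) i j u : open U -> smx U F -> U u ->
  dm i (dm j F) u = dm j (dm i F) u.
Proof.
move=> Uo sF Uu; apply/matrixP => a b.
have E k : (fun v => dm k F v a b) = partial k (fun v => F v a b).
  by apply/funext => v; rewrite dmE.
have E2 k l : dm k (dm l F) u a b = partial k (partial l (fun v => F v a b)) u.
  exact: etrans (dmE _ _ _ _ _) (congr1 (fun h => partial k h u) (E l)).
exact: etrans (E2 i j) (etrans (partialC i j Uo (sF a b) Uu) (esym (E2 j i))).
Qed.

Lemma dm_constant_on_ball p q (F : 'rV[R]_n -> 'M[R]_(p, q)) u r :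
  smx (ball u r) F -> (forall v i, ball u r v -> dm i F v = 0) ->
  forall v, ball u r v -> F v = F u.
Proof.
move=> sF F0 v uv; apply/matrixP => a b.
apply: (@constant_on_ball _ _ (fun v => F v a b) u r) => //.
  by move=> w uw; exact: sm_diff (sF a b) uw.
by move=> w i uw; have /matrixP/(_ a b) := F0 w i uw; rewrite !mxE.
Qed.

Section VectorValued.
Context {m : nat}.
Implicit Types f : 'rV[R]_n -> 'rV[R]_m.

Lemma differentiable_coordinate f u k : differentiable f u ->
  differentiable (fun v => f v 0 k) u.
Proof.
move=> df; apply: (@differentiable_comp _ _ _ _ f (fun w : 'rV[R]_m => w 0 k)) => //.
exact: differentiable_coord.
Qed.

Lemma partial_coordinate f u i k : differentiable f u ->
  partial i f u 0 k = partial i (fun v => f v 0 k) u.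
Proof. by move=> df; rewrite /partial derive_mx ?mxE//; exact: diff_derivable. Qed.

Lemma smooth_coordinate U f : open U -> smooth_on U f -> smx U f.
Proof.
move=> Uo sf a k; rewrite ord1.
have P s : forall v, U v -> partials s (fun v => f v 0 k) v = partials s f v 0 k.
  elim: s => [//|i s IH] v Uv /=.
  rewrite (partial_eq i Uo IH Uv) partial_coordinate//.
  exact: sf.
move=> s u Uu; apply: near_eq_differentiable (differentiable_coordinate k (sf s u Uu)).
by apply: open_near Uo Uu _ => v Uv; rewrite P.
Qed.

Lemma jacobianE U f u : open U -> smooth_on U f -> U u -> 'J f u = jac f u.
Proof.
move=> Uo sf Uu; have df : differentiable f u by exact: (sf [::]).
apply/matrixP => i k; rewrite /jacobian /lin1_mx !mxE -partial_coordinate//.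
by rewrite /partial deriveE.
Qed.

Lemma partial2_coordinate U f u i j : open U -> smooth_on U f -> U u ->
  partial i (partial j f) u = row j (dm i (jac f) u).
Proof.
move=> Uo sf Uu; apply/rowP => k; rewrite !mxE.
rewrite partial_coordinate; last exact: (sf [:: j]).
apply: (partial_eq (U := U)) => // v Uv; rewrite mxE partial_coordinate//.
exact: (sf [::]).
Qed.

Lemma smx_jac U f : open U -> smx U f -> smx U (jac f).
Proof.
move=> Uo sf a b; apply: (@sm_eq _ _ _ (partial a (fun v => f v 0 b))) => //.
  by move=> v _; rewrite mxE.
exact: sm_partial.
Qed.

Lemma row_jac f i u : row i (jac f u) = dm i f u.
Proof. by apply/matrixP => a b; rewrite !mxE ord1. Qed.

Lemma jac_sym U f i j u : open U -> smx U f -> U u ->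
  row j (dm i (jac f) u) = row i (dm j (jac f) u).
Proof.
move=> Uo sf Uu; apply/rowP => k.
have E l a : row a (dm l (jac f) u) 0 k = partial l (partial a (fun v => f v 0 k)) u.
  rewrite mxE; apply: etrans (dmE _ _ _ _ _) (congr1 (fun h => partial l h u) _).
  by apply/funext => v; rewrite mxE.
exact: etrans (E i j) (etrans (partialC i j Uo (sf 0 k) Uu) (esym (E j i))).
Qed.

End VectorValued.

Lemma partial_prod1 (I : Type) (r : seq I) (F : I -> 'rV[R]_n -> R) i u :
  (forall k, differentiable (F k) u) -> (forall k, F k u = 1) ->
  differentiable (fun v => \prod_(k <- r) F k v) u /\
  partial i (fun v => \prod_(k <- r) F k v) u = \sum_(k <- r) partial i (F k) u.
Proof.
move=> dF F1; elim: r => [|a r [dr IH]].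
  have -> : (fun v => \prod_(k <- [::]) F k v) = cst 1.
    by apply/funext => v; rewrite big_nil.
  by rewrite big_nil partial_cst; split=> //; exact: differentiable_cst.
have -> : (fun v => \prod_(k <- a :: r) F k v) =
    (fun v => F a v * \prod_(k <- r) F k v).
  by apply/funext => v; rewrite big_cons.
split; first exact: differentiableM.
by rewrite partialM// IH F1 big1 ?mul1r ?mulr1 ?big_cons.
Qed.

(** A permutation [s] that moves [k] also moves [s k], so its product contains two factors that
    vanish at [u], and the product rule leaves nothing of it. *)
Lemma partial_det1 p U (N : 'rV[R]_n -> 'M[R]_p) i u : open U -> smx U N -> U u ->
  N u = 1%:M -> partial i (fun v => \det (N v)) u = \tr (dm i N u).
Proof.
move=> Uo sN Uu N1; rewrite /determinant.
have sp (s : 'S_p) : smooth_on U (fun v => \prod_k N v k (s k)).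
  by apply: sm_prod => // k; exact: sN.
have ds (s : 'S_p) : differentiable (fun v => (-1) ^+ s * \prod_k N v k (s k)) u.
  apply: (@sm_diff _ _ U) => //; apply: smM => //; exact: sm_cst.
have [_ ->] := partial_sum (index_enum _) predT ds.
have pc (a : R) (g : 'rV[R]_n -> R) : differentiable g u ->
    partial i (fun v => a * g v) u = a * partial i g u.
  move=> dg; have dc : differentiable (cst a : 'rV[R]_n -> R) u.
    exact: differentiable_cst.
  by rewrite (partialM i dc dg) partial_cst mul0r add0r.
rewrite (bigD1 1%g)//= big1 ?addr0.
  rewrite pc; last exact: sm_diff (sp _) Uu.
  rewrite odd_perm1 expr0 mul1r.
  have [||_ ->] := @partial_prod1 _ (index_enum 'I_p) (fun k v => N v k ((1%g : 'S_p) k)) i u.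
  - by move=> k; exact: (sm_diff (sN _ _) Uu).
  - by move=> k; rewrite perm1 N1 mxE eqxx.
  by rewrite /mxtrace; apply: eq_bigr => k _; rewrite perm1 mxE.
move=> s s1; rewrite pc; last exact: sm_diff (sp _) Uu.
have [k sk] : exists k, s k != k.
  apply/existsP; apply: contraR s1; rewrite negb_exists => /forallP H.
  by apply/eqP/permP => k; rewrite perm1; apply/eqP; rewrite -[_ == _]negbK.
have ssk : s (s k) != s k by rewrite (inj_eq perm_inj).
have -> : (fun v => \prod_k N v k (s k)) = (fun v => N v k (s k) *
     (N v (s k) (s (s k)) * \prod_(j | (j != k) && (j != s k)) N v j (s j))).
  by apply/funext => v; rewrite (bigD1 k)//= (bigD1 (s k))//=.
have dN a b : differentiable (fun v => N v a b) u by exact: sm_diff (sN a b) Uu.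
have dR : differentiable (fun v => \prod_(j | (j != k) && (j != s k)) N v j (s j)) u.
  by apply: (@sm_diff _ _ U) => //; apply: sm_prod => // j; exact: sN.
rewrite partialM//; last exact: differentiableM.
have N0 : N u k (s k) = 0 by rewrite N1 mxE eq_sym (negbTE sk).
have N0' : N u (s k) (s (s k)) = 0 by rewrite N1 mxE eq_sym (negbTE ssk).
by rewrite /= N0 N0' !mul0r mulr0 addr0 mulr0.
Qed.

(* Multiplying by [invmx (G u)] reduces to the case [G u = 1], where only the
   identity permutation contributes to the derivative of the determinant. *)
Lemma partial_det p U (G : 'rV[R]_n -> 'M[R]_p) i u : open U -> smx U G -> U u ->
  G u \in unitmx ->
  partial i (fun v => \det (G v)) u = \tr (dm i G u *m invmx (G u)) * \det (G u).
Proof.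
move=> Uo sG Uu uG.
pose N v := G v *m invmx (G u).
have sC : smx U (fun=> invmx (G u)) by exact: smx_cst.
have sN : smx U N by exact: smxM.
have N1 : N u = 1%:M by rewrite /N mulmxV.
have dN : dm i N u = dm i G u *m invmx (G u).
  by rewrite (dmM i Uo sG sC Uu) dm_cst mulmx0 addr0.
have E : (fun v => \det (G v)) = (fun v => \det (N v) * \det (G u)).
  by apply/funext => v; rewrite -det_mulmx /N mulmxKV.
rewrite E.
have sd : smooth_on U (fun v => \det (N v)) by exact: smx_det.
have dc : differentiable (cst (\det (G u)) : 'rV[R]_n -> R) u.
  exact: differentiable_cst.
rewrite (partialM i (sm_diff sd Uu) dc) partial_cst mulr0 addr0.
by congr (_ * _); rewrite -dN; exact: partial_det1 Uo sN Uu N1.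
Qed.

End MatrixCalculus.

(** * Orthonormal frames along an affine hypersphere *)

Notation i0 := (@Ordinal 3 0 isT).
Notation i1 := (@Ordinal 3 1 isT).
Notation i2 := (@Ordinal 3 2 isT).

Lemma ord3P (P : 'I_3 -> Prop) : P i0 -> P i1 -> P i2 -> forall i, P i.
Proof.
move=> P0 P1 P2 [[|[|[|//]]] Hi].
- by rewrite (_ : Ordinal Hi = i0) //; apply: val_inj.
- by rewrite (_ : Ordinal Hi = i1) //; apply: val_inj.
- by rewrite (_ : Ordinal Hi = i2) //; apply: val_inj.
Qed.

Lemma sum3 (V : nmodType) (F : 'I_3 -> V) : \sum_i F i = F i0 + F i1 + F i2.
Proof.
rewrite big_ord_recl big_ord_recl big_ord_recl big_ord0 addr0 addrA.
by congr (F _ + F _ + F _); apply: val_inj.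
Qed.

Section Mx3.
Context {R : realType}.

Definition mx3 (a b c d e f g h k : R) : 'M[R]_3 :=
  \matrix_(i, j) nth 0 (nth [::] [:: [:: a; b; c]; [:: d; e; f]; [:: g; h; k]] i) j.

Definition rv3 (a b c : R) : 'rV[R]_3 := \row_j [:: a; b; c]`_j.

Lemma mx3P (A B : 'M[R]_3) :
  A i0 i0 = B i0 i0 -> A i0 i1 = B i0 i1 -> A i0 i2 = B i0 i2 ->
  A i1 i0 = B i1 i0 -> A i1 i1 = B i1 i1 -> A i1 i2 = B i1 i2 ->
  A i2 i0 = B i2 i0 -> A i2 i1 = B i2 i1 -> A i2 i2 = B i2 i2 -> A = B.
Proof.
move=> *; apply/matrixP => i j.
by elim/ord3P: i; elim/ord3P: j.
Qed.

Lemma rv3P (A B : 'rV[R]_3) :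
  A 0 i0 = B 0 i0 -> A 0 i1 = B 0 i1 -> A 0 i2 = B 0 i2 -> A = B.
Proof. by move=> *; apply/rowP => j; elim/ord3P: j. Qed.

Lemma mulmx3E m p (A : 'M[R]_(m, 3)) (B : 'M[R]_(3, p)) i j :
  (A *m B) i j = A i i0 * B i0 j + A i i1 * B i1 j + A i i2 * B i2 j.
Proof. by rewrite mxE sum3. Qed.

Lemma trace3 (A : 'M[R]_3) : \tr A = A i0 i0 + A i1 i1 + A i2 i2.
Proof. by rewrite /mxtrace sum3. Qed.

Lemma quad3 (A : 'M[R]_3) (a b c : R) : (rv3 a b c *m A *m (rv3 a b c)^T) 0 0 =
  (a * A i0 i0 + b * A i1 i0 + c * A i2 i0) * a +
  (a * A i0 i1 + b * A i1 i1 + c * A i2 i1) * b +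
  (a * A i0 i2 + b * A i1 i2 + c * A i2 i2) * c.
Proof. by rewrite !mulmx3E !mxE. Qed.

Lemma rv3_neq0 (a b c : R) : [|| a != 0, b != 0 | c != 0] -> rv3 a b c != 0.
Proof.
move=> H; apply: contraL H => /eqP/rowP E.
have := E i0; have := E i1; have := E i2; rewrite !mxE /= => -> -> ->.
by rewrite eqxx.
Qed.

(** The three quantities are the pivots [a], [D / a], [E / D] of Cholesky's algorithm, with [D] and
    [E] the leading minors of order two and three. They are written with the square roots under
    which they occur in [cholesky]. *)
Lemma posdef3 (h : 'M[R]_3) : h^T = h -> positive_definite h ->
  let a := h i0 i0 in let b := h i1 i0 in let c := h i2 i0 in
  let d := h i1 i1 in let e := h i2 i1 in let f := h i2 i2 in
  [/\ 0 < a, 0 < d - (b / Num.sqrt a) ^+ 2 &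
   0 < f - (c / Num.sqrt a) ^+ 2 -
     ((e - (c / Num.sqrt a) * (b / Num.sqrt a)) /
      Num.sqrt (d - (b / Num.sqrt a) ^+ 2)) ^+ 2].
Proof.
move=> /matrixP hs pd a b c d e f.
have s01 := hs i0 i1; have s02 := hs i0 i2; have s12 := hs i1 i2.
rewrite !mxE in s01 s02 s12.
have a0 : 0 < a.
  have := pd (rv3 1 0 0); rewrite quad3 rv3_neq0 ?oner_eq0// => /(_ isT).
  by rewrite -/a; lra.
have ane : a != 0 by rewrite gt_eqF.
pose D := a * d - b * b.
have D0 : 0 < D.
  have := pd (rv3 (- b) a 0); rewrite quad3 rv3_neq0 ?ane ?orbT// => /(_ isT).
  rewrite -s01 -s02 -s12 -/a -/b -/c -/d -/e -/f => H.
  by rewrite -(pmulr_rgt0 _ a0); move: H; congr (_ < _); rewrite /D; ring.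
have Dne : D != 0 by rewrite gt_eqF.
pose E := D * f - a * e ^+ 2 + 2 * b * c * e - d * c ^+ 2.
have E0 : 0 < E.
  (* Cofactors of the last row: [h] maps this vector to [E] times the third basis vector, so the
     quadratic form takes the value [D * E]. *)
  have := pd (rv3 (b * e - c * d) (b * c - a * e) D).
  rewrite quad3 rv3_neq0 ?Dne ?orbT// => /(_ isT).
  rewrite -s01 -s02 -s12 -/a -/b -/c -/d -/e -/f => H.
  by rewrite -(pmulr_rgt0 _ D0); move: H; congr (_ < _); rewrite /E /D; ring.
have q x : (x / Num.sqrt a) ^+ 2 = x ^+ 2 / a by rewrite exprMn exprVn sqr_sqrtr// ltW.
have Da : d - (b / Num.sqrt a) ^+ 2 = D / a by rewrite q /D; field.
have Da0 : 0 < D / a by rewrite divr_gt0.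
split=> //; first by rewrite Da.
rewrite Da q exprMn exprVn (sqr_sqrtr (ltW Da0)).
have -> : c / Num.sqrt a * (b / Num.sqrt a) = c * b / a.
  rewrite mulrACA -invfM -expr2 sqr_sqrtr//; exact: ltW.
have -> : f - c ^+ 2 / a - (e - c * b / a) ^+ 2 / (D / a) = E / D.
  by rewrite /E /D; field; rewrite ane /= Dne.
by rewrite divr_gt0.
Qed.

(** Gram-Schmidt applied to the coordinate fields: the lower triangular factor expresses them in a
    frame that is orthonormal for [h]. The explicit formulas in order three, with square roots of
    positive functions only, show that it is smooth. *)
Lemma cholesky (U : set 'rV[R]_3) (h : 'rV[R]_3 -> 'M[R]_3) : open U -> smx U h ->
  (forall u, U u -> (h u)^T = h u) -> (forall u, U u -> positive_definite (h u)) ->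
  exists th : 'rV[R]_3 -> 'M[R]_3, [/\ smx U th,
    forall u, U u -> th u *m (th u)^T = h u & forall u, U u -> th u \in unitmx].
Proof.
move=> Uo sh hs pd.
pose sa u := Num.sqrt (h u i0 i0).
pose b u := h u i1 i0 / sa u; pose c u := h u i2 i0 / sa u.
pose sd u := Num.sqrt (h u i1 i1 - b u ^+ 2).
pose e u := (h u i2 i1 - c u * b u) / sd u.
pose sf u := Num.sqrt (h u i2 i2 - c u ^+ 2 - e u ^+ 2).
have P u (Uu : U u) := posdef3 (hs u Uu) (pd u Uu).
have smB (f g : 'rV[R]_3 -> R) : smooth_on U f -> smooth_on U g -> smooth_on U (fun v => f v - g v).
  by move=> sf' sg; apply: smD => //; exact: smN.
have sX (f : 'rV[R]_3 -> R) : smooth_on U f -> smooth_on U (fun v => f v ^+ 2).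
  by move=> sf'; apply: smM.
have ssa : smooth_on U sa.
  by apply: (sm_sqrt Uo _ (sh i0 i0)) => u /P[].
have sa0 u : U u -> 0 < sa u by move=> /P[? _ _]; rewrite sqrtr_gt0.
have sVa : smooth_on U (fun u => (sa u)^-1).
  by apply: smV => // u /sa0; exact: lt0r_neq0.
have sb : smooth_on U b by apply: smM.
have sc : smooth_on U c by apply: smM.
have ssd : smooth_on U sd.
  by apply: (sm_sqrt Uo _ (smB _ _ (sh i1 i1) (sX _ sb))) => u /P[].
have sd0 u : U u -> 0 < sd u by move=> /P[_ ? _]; rewrite sqrtr_gt0.
have se : smooth_on U e.
  apply: smM => //; first by apply: smB => //; exact: smM.
  by apply: smV => // u /sd0; exact: lt0r_neq0.
have ssf : smooth_on U sf.
  by apply: (sm_sqrt Uo _ (smB _ _ (smB _ _ (sh i2 i2) (sX _ sc)) (sX _ se))) => u /P[].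
have sf0 u : U u -> 0 < sf u by move=> /P[_ _ ?]; rewrite sqrtr_gt0.
exists (fun u => mx3 (sa u) 0 0 (b u) (sd u) 0 (c u) (e u) (sf u)).
have thE u : U u -> let th := mx3 (sa u) 0 0 (b u) (sd u) 0 (c u) (e u) (sf u) in
    th *m th^T = h u.
  move=> Uu th; have /matrixP H := hs u Uu.
  have H1 := H i0 i1; have H2 := H i0 i2; have H3 := H i1 i2.
  rewrite !mxE in H1 H2 H3.
  have [p1 p2 p3] := P u Uu.
  have qa : sa u * sa u = h u i0 i0 by rewrite -expr2 sqr_sqrtr// ltW.
  have qd : sd u * sd u = h u i1 i1 - b u ^+ 2 by rewrite -expr2 sqr_sqrtr// ltW.
  have qf : sf u * sf u = h u i2 i2 - c u ^+ 2 - e u ^+ 2.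
    by rewrite -expr2 sqr_sqrtr// ltW.
  have ba : b u * sa u = h u i1 i0 by rewrite /b divfK// gt_eqF// sa0.
  have ca : c u * sa u = h u i2 i0 by rewrite /c divfK// gt_eqF// sa0.
  have ed : e u * sd u = h u i2 i1 - c u * b u by rewrite /e divfK// gt_eqF// sd0.
  apply: mx3P; rewrite mulmx3E !mxE /=.
  - by rewrite -qa; ring.
  - by rewrite -H1 -ba; ring.
  - by rewrite -H2 -ca; ring.
  - by rewrite -ba; ring.
  - by rewrite qd; ring.
  - by rewrite -H3 [sd u * _]mulrC ed; ring.
  - by rewrite -ca; ring.
  - by rewrite ed; ring.
  - by rewrite qf; ring.
split=> //.
  move=> i j; apply: (@sm_eq _ _ _ (fun v => nth 0 (nth [::] [:: [:: sa v; 0; 0];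
    [:: b v; sd v; 0]; [:: c v; e v; sf v]] i) j)) => //; first by move=> v _; rewrite mxE.
  by elim/ord3P: i; elim/ord3P: j => //=; exact: sm_cst.
move=> u Uu; rewrite unitmxE unitfE det_trig; last first.
  apply/is_trig_mxP => i j; rewrite mxE.
  by elim/ord3P: i; elim/ord3P: j.
rewrite big_ord_recl big_ord_recl big_ord_recl big_ord0 mulr1 !mxE /=.
by rewrite !mulf_neq0// gt_eqF// ?sa0 ?sd0 ?sf0.
Qed.

End Mx3.

(** With each connection matrix split as [o + k] into skew and symmetric part, the equation is the
    curvature equation of the induced connection. Its difference with its transpose is the Gauss
    equation for [o], its sum with it the Codazzi equation for [k]. *)
Lemma skew_symmetric_parts (R : realType) n (X Y o o' k k' a a' : 'M[R]_n) (H : R) :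
  o^T = - o -> o'^T = - o' -> k^T = k -> k'^T = k' -> a^T = a' ->
  X + (o + k) *m (o' + k') - H *: a = Y + (o' + k') *m (o + k) - H *: a' ->
  2^-1 *: (X - X^T) - 2^-1 *: (Y - Y^T) + o *m o' - o' *m o =
    k' *m k - k *m k' + H *: (a - a') /\
  2^-1 *: (X + X^T) + o *m k' + k *m o' = 2^-1 *: (Y + Y^T) + o' *m k + k' *m o.
Proof.
move=> ho ho' hk hk' ha E; have ha' : a'^T = a by rewrite -ha trmxK.
have := congr1 trmx E.
rewrite [in LHS]linearB [in RHS]linearB [in LHS]linearD [in RHS]linearD /=.
rewrite [(H *: a)^T]linearZ [(H *: a')^T]linearZ /= !trmx_mul ha ha'.
have -> : (o + k)^T = k - o by rewrite linearD /= ho hk addrC.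
have -> : (o' + k')^T = k' - o' by rewrite linearD /= ho' hk' addrC.
move: E; rewrite !mulmxDl !mulmxDr !mulmxN !mulNmx.
move: (o *m o') (o' *m o) (k *m k') (k' *m k) (o *m k') (o' *m k) (k *m o') (k' *m o).
move: X^T Y^T => X' Y' b1 b2 b3 b4 b5 b6 b7 b8 E1 E2.
split; apply/matrixP => r c; move: E1 E2 => /matrixP/(_ r c) + /matrixP/(_ r c);
  by rewrite !mxE; lra.
Qed.

(** * The orthonormal frame of a chart *)

Section FrameExists.
Context {R : realType} (U : set 'rV[R]_3) (f xi : 'rV[R]_3 -> 'rV[R]_4) (H : R)
  (th : 'rV[R]_3 -> 'M[R]_3).
Hypotheses (Uo : open U) (sf : smx U f) (sxi : smx U xi).

Let Fr u : 'M[R]_(3 + 1, 4) := col_mx (jac f u) (xi u).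
Hypothesis uFr : forall u, U u -> (Fr u : 'M[R]_4) \in unitmx.
Hypothesis dxi : forall u, U u -> jac xi u = (- H) *: jac f u.

Definition second_form u : 'M[R]_3 :=
  \matrix_(i, j) (row j (dm i (jac f) u) *m
     invmx (col_mx (jac f u) (xi u) : 'M[R]_(3 + 1))) 0 (rshift 3 0).

Hypotheses (sth : smx U th) (thE : forall u, U u -> th u *m (th u)^T = second_form u)
  (uth : forall u, U u -> th u \in unitmx).

(** [frm] is the orthonormal frame; [cofr] and [conormal] come from the tangential and the normal
    columns of the inverse of [Fr], the former rescaled so as to be dual to [frm]. *)
Definition frm u : 'M[R]_(3, 4) := invmx (th u) *m jac f u.
Definition cofr u : 'M[R]_(4, 3) := lsubmx (invmx (Fr u) : 'M[R]_(4, 3 + 1)) *m th u.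
Definition conormal u : 'cV[R]_4 := rsubmx (invmx (Fr u) : 'M[R]_(4, 3 + 1)).

Lemma smx_Fr : smx U Fr.
Proof.
move=> a b; case: (splitP a) => k ak.
  apply: (@sm_eq _ _ _ (fun v => jac f v k b)) => //; last exact: smx_jac.
  by move=> v _; rewrite /Fr (_ : a = lshift 1 k) ?col_mxEu//; apply: val_inj.
apply: (@sm_eq _ _ _ (fun v => xi v k b)) => // v _.
by rewrite /Fr (_ : a = rshift 3 k) ?col_mxEd//; apply: val_inj.
Qed.

Lemma smx_invFr : smx U (fun v => invmx (Fr v : 'M[R]_4)).
Proof. by apply: smx_inv => //; exact: smx_Fr. Qed.

Lemma smx_invth : smx U (fun v => invmx (th v)).
Proof. exact: smx_inv. Qed.

Lemma smx_frm : smx U frm.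
Proof. by apply: smxM => //; [exact: smx_invth|exact: smx_jac]. Qed.

Lemma smx_conormal : smx U conormal.
Proof.
move=> a b; apply: (@sm_eq _ _ _ (fun v => invmx (Fr v : 'M[R]_4) a (rshift 3 b))) => //.
  by move=> v _; rewrite mxE.
exact: smx_invFr.
Qed.

Lemma smx_cofr : smx U cofr.
Proof.
apply: smxM => // a b.
apply: (@sm_eq _ _ _ (fun v => invmx (Fr v : 'M[R]_4) a (lshift 1 b))) => //.
  by move=> v _; rewrite mxE.
exact: smx_invFr.
Qed.

Lemma FrV u : U u -> [/\ jac f u *m lsubmx (invmx (Fr u) : 'M[R]_(4, 3 + 1)) = 1%:M,
  jac f u *m conormal u = 0, xi u *m lsubmx (invmx (Fr u) : 'M[R]_(4, 3 + 1)) = 0 &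
  xi u *m conormal u = 1%:M].
Proof.
move=> Uu; have := mulmxV (uFr Uu).
rewrite /conormal; set X := invmx _ => E.
have : Fr u *m (X : 'M[R]_(4, 3 + 1)) = (1%:M : 'M[R]_(3 + 1)) by exact: E.
rewrite -{1}(hsubmxK (X : 'M[R]_(4, 3 + 1))) /Fr mul_col_row (scalar_mx_block 3 1 1).
by move/eq_block_mx => [-> -> -> ->].
Qed.

Lemma jacE u : U u -> jac f u = th u *m frm u.
Proof. by move=> Uu; rewrite /frm mulKVmx// uth. Qed.

Lemma frm_cofr u : U u -> frm u *m cofr u = 1%:M.
Proof.
move=> Uu; have [E _ _ _] := FrV Uu.
by rewrite /frm /cofr mulmxA -[_ *m _ *m lsubmx _]mulmxA E mulmx1 mulVmx// uth.
Qed.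

Lemma frm_conormal u : U u -> frm u *m conormal u = 0.
Proof. by move=> Uu; have [_ E _ _] := FrV Uu; rewrite /frm -mulmxA E mulmx0. Qed.

Lemma xi_cofr u : U u -> xi u *m cofr u = 0.
Proof. by move=> Uu; have [_ _ E _] := FrV Uu; rewrite /cofr mulmxA E mul0mx. Qed.

Lemma xi_conormal u : U u -> xi u *m conormal u = 1%:M.
Proof. by move=> Uu; have [_ _ _ ->] := FrV Uu. Qed.

Lemma cofr_frm u : U u -> cofr u *m frm u + conormal u *m xi u = 1%:M.
Proof.
move=> Uu; rewrite /cofr /frm -!mulmxA (mulKVmx (uth Uu)) /conormal.
rewrite -mul_row_col hsubmxK.
have : invmx (Fr u : 'M[R]_4) *m Fr u = 1%:M by exact: mulVmx (uFr Uu).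
by [].
Qed.

Lemma second_formE u i : U u -> dm i (jac f) u *m conormal u = col i (second_form u).
Proof.
move=> Uu; apply/colP => j; rewrite [RHS]mxE [RHS]mxE.
rewrite (jac_sym j i Uo sf Uu) mxE [RHS]mxE.
by apply: eq_bigr => k _; rewrite !mxE.
Qed.

(** The normal component is [invmx (th u)] times column [i] of the affine metric; as that metric is
    [th u *m (th u)^T], it collapses to row [i] of [th u], transposed. *)
Lemma dm_frm i u : U u -> dm i frm u =
  (dm i frm u *m cofr u) *m frm u + (row i (th u))^T *m xi u.
Proof.
move=> Uu; rewrite -[LHS]mulmx1 -(cofr_frm Uu) mulmxDr !mulmxA; congr (_ + _ *m _).
rewrite (dmM i Uo smx_invth (smx_jac Uo sf) Uu) mulmxDl -!mulmxA.
have [_ -> _ _] := FrV Uu.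
by rewrite mulmx0 add0r second_formE// -thE// tr_row !colE -mulmxA mulKmx// uth.
Qed.

End FrameExists.

(* [th] is the matrix of [jac f] in an orthonormal frame [e], with dual frame
   [p] and conormal [nu]; [skew_part i] is the connection form and [sym_part i] the
   difference between the induced and the Levi-Civita connection. *)
Section Frame.
Context {R : realType} (U : set 'rV[R]_3) (f xi : 'rV[R]_3 -> 'rV[R]_4) (H : R)
  (th : 'rV[R]_3 -> 'M[R]_3) (e : 'rV[R]_3 -> 'M[R]_(3, 4))
  (p : 'rV[R]_3 -> 'M[R]_(4, 3)) (nu : 'rV[R]_3 -> 'cV[R]_4)
  (B : 'I_3 -> 'rV[R]_3 -> 'M[R]_3).
Hypotheses (Uo : open U) (sf : smx U f) (sxi : smx U xi) (sth : smx U th)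
  (se : smx U e) (sp : smx U p) (sB : forall i, smx U (B i)).
Hypothesis dxi : forall u, U u -> jac xi u = (- H) *: jac f u.
Hypotheses (ep : forall u, U u -> e u *m p u = 1%:M)
  (enu : forall u, U u -> e u *m nu u = 0)
  (xip : forall u, U u -> xi u *m p u = 0)
  (xinu : forall u, U u -> xi u *m nu u = 1%:M)
  (uth : forall u, U u -> th u \in unitmx)
  (jacE : forall u, U u -> jac f u = th u *m e u)
  (dm_e : forall u i, U u -> dm i e u = B i u *m e u + (row i (th u))^T *m xi u).

Lemma frame_decomp m u (X X' : 'M[R]_(m, 3)) (y y' : 'cV[R]_m) : U u ->
  X *m e u + y *m xi u = X' *m e u + y' *m xi u -> X = X' /\ y = y'.
Proof.
move=> Uu E; split.
  have := congr1 (mulmx ^~ (p u)) E; rewrite /= !mulmxDl -!mulmxA.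
  by rewrite ep// xip// !mulmx1 !mulmx0 !addr0.
have := congr1 (mulmx ^~ (nu u)) E; rewrite /= !mulmxDl -!mulmxA.
by rewrite enu// xinu// !mulmx1 !mulmx0 !add0r.
Qed.

(** The coordinate field of index [i], written in the orthonormal frame. *)
Definition tangent_row i u : 'rV[R]_3 := row i (th u).

Lemma smx_t i : smx U (tangent_row i). Proof. exact: smx_row. Qed.

Lemma dm_f i u : U u -> dm i f u = tangent_row i u *m e u.
Proof. by move=> Uu; rewrite -row_jac jacE// row_mul. Qed.

Lemma dm_xi i u : U u -> dm i xi u = (- H) *: (tangent_row i u *m e u).
Proof. by move=> Uu; rewrite -row_jac dxi// linearZ/= jacE// row_mul. Qed.

(** Tangential part of the symmetry of second derivatives of [f]: the induced connection has no
    torsion. *)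
Lemma dm_t_sym i j u : U u ->
  dm j (tangent_row i) u + tangent_row i u *m B j u = dm i (tangent_row j) u + tangent_row j u *m B i u.
Proof.
move=> Uu.
have E k l : dm l (dm k f) u =
   (dm l (tangent_row k) u + tangent_row k u *m B l u) *m e u + (tangent_row k u *m (tangent_row l u)^T) *m xi u.
  rewrite (dm_eq l Uo (dm_f k) Uu) (dmM l Uo (smx_t k) se Uu) dm_e//.
  by rewrite mulmxDr mulmxDl -!mulmxA addrA.
by have := dmC i j Uo sf Uu; rewrite !E => /(frame_decomp Uu)[].
Qed.

(** Symmetry of second derivatives of the frame [e]. Its tangential part is the curvature equation
    of the induced connection, with the term in [H] coming from the derivative of [xi]; its normal
    part is the Codazzi equation of the metric. *)
Lemma dm_B_sym i j u : U u ->
  dm j (B i) u + B i u *m B j u - H *: ((tangent_row i u)^T *m tangent_row j u) =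
  dm i (B j) u + B j u *m B i u - H *: ((tangent_row j u)^T *m tangent_row i u) /\
  dm j (tangent_row i) u + tangent_row j u *m (B i u)^T = dm i (tangent_row j) u + tangent_row i u *m (B j u)^T.
Proof.
move=> Uu.
have E k l : dm l (dm k e) u =
   (dm l (B k) u + B k u *m B l u - H *: ((tangent_row k u)^T *m tangent_row l u)) *m e u +
   (dm l (fun v => (tangent_row k v)^T) u + B k u *m (tangent_row l u)^T) *m xi u.
  rewrite (dm_eq l Uo (fun v => @dm_e v k) Uu).
  rewrite (dmD l (smxM Uo (sB k) se) (smxM Uo (smxT Uo (smx_t k)) sxi) Uu).
  rewrite (dmM l Uo (sB k) se Uu) (dmM l Uo (smxT Uo (smx_t k)) sxi Uu).
  rewrite dm_e// dm_xi// mulmxDr mulmxBl !mulmxDl -scalemxAr scaleNr -scalemxAl.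
  rewrite !mulmxA; move: (dm l (B k) u *m _) (B k u *m _ *m _) (_ *m xi u) (_ *m xi u).
  move=> x1 x2 x3 x4; move: (H *: _) => x5.
  by rewrite -!addrA; congr (_ + (_ + _)); rewrite [RHS]addrC addrA [x3 + x4]addrC.
have := dmC i j Uo se Uu; rewrite !E => /(frame_decomp Uu)[-> H2]; split=> //.
by have := congr1 trmx H2; rewrite !linearD /= !trmx_mul !dmT !trmxK.
Qed.

Definition skew_part i u : 'M[R]_3 := 2^-1 *: (B i u - (B i u)^T).
Definition sym_part i u : 'M[R]_3 := 2^-1 *: (B i u + (B i u)^T).

Lemma skew_sym_part i u : B i u = skew_part i u + sym_part i u.
Proof.
rewrite /skew_part /sym_part -scalerDr addrACA addNr addr0 -(mulr2n (B i u)) -(scaler_nat 2 (B i u)) scalerA.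
by rewrite mulVf ?pnatr_eq0// scale1r.
Qed.

Lemma om_skew i u : (skew_part i u)^T = - skew_part i u.
Proof. by rewrite /skew_part linearZ /= linearB /= trmxK -scalerN opprB. Qed.

Lemma K_sym i u : (sym_part i u)^T = sym_part i u.
Proof. by rewrite /sym_part linearZ /= linearD /= trmxK addrC. Qed.

Lemma smx_om i : smx U (skew_part i).
Proof.
apply: smxZ => //; first exact: sm_cst.
by apply: smxB => //; exact: smxT.
Qed.

Lemma smx_K i : smx U (sym_part i).
Proof.
apply: smxZ => //; first exact: sm_cst.
by apply: smxD => //; exact: smxT.
Qed.

(** Subtracting the second equation of [dm_B_sym] from [dm_t_sym] cancels the derivatives and leaves
    [B] plus its transpose: this is the total symmetry of the cubic form. *)
Lemma t_K i j u : U u -> tangent_row i u *m sym_part j u = tangent_row j u *m sym_part i u.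
Proof.
move=> Uu; have E1 := dm_t_sym i j Uu; have [_ E2] := dm_B_sym i j Uu.
rewrite /sym_part -!scalemxAr !mulmxDr; congr (_ *: _).
move: E1 E2; move: (dm j (tangent_row i) u) (dm i (tangent_row j) u) (tangent_row i u *m B j u) (tangent_row j u *m B i u).
move=> a b c d; move: (tangent_row j u *m _) (tangent_row i u *m _) => x y E1 E2.
apply/matrixP => k l; move: E1 E2 => /matrixP/(_ k l) + /matrixP/(_ k l).
by rewrite !mxE; lra.
Qed.

(** By [t_K] the symmetric parts drop out of [dm_t_sym]. A skew-symmetric connection form without
    torsion is that of Levi-Civita. *)
Lemma torsion_free i j u : U u ->
  dm j (tangent_row i) u + tangent_row i u *m skew_part j u = dm i (tangent_row j) u + tangent_row j u *m skew_part i u.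
Proof.
move=> Uu; have := dm_t_sym i j Uu; rewrite !skew_sym_part !mulmxDr (t_K i j Uu).
move: (dm j (tangent_row i) u) (dm i (tangent_row j) u) (tangent_row i u *m skew_part j u) (tangent_row j u *m skew_part i u) => a b c d.
move: (tangent_row j u *m _) => x E; apply/matrixP => k l; move: E => /matrixP/(_ k l).
by rewrite !mxE; lra.
Qed.

Lemma dm_skew i j u : U u -> dm j (skew_part i) u = 2^-1 *: (dm j (B i) u - (dm j (B i) u)^T).
Proof.
move=> Uu; have sBT := smxT Uo (sB i).
rewrite /skew_part (dmZ j (@sm_cst _ _ U 2^-1) (smxB Uo (sB i) sBT) Uu).
rewrite -[X in partial _ X _]/(cst 2^-1) partial_cst scale0r add0r.
by rewrite (dmB j Uo (sB i) sBT Uu) dmT.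
Qed.

Lemma dm_symm i j u : U u -> dm j (sym_part i) u = 2^-1 *: (dm j (B i) u + (dm j (B i) u)^T).
Proof.
move=> Uu; have sBT := smxT Uo (sB i).
rewrite /sym_part (dmZ j (@sm_cst _ _ U 2^-1) (smxD Uo (sB i) sBT) Uu).
rewrite -[X in partial _ X _]/(cst 2^-1) partial_cst scale0r add0r.
by rewrite (dmD j (sB i) sBT Uu) dmT.
Qed.

Lemma gauss i j u : U u ->
  dm j (skew_part i) u - dm i (skew_part j) u + skew_part i u *m skew_part j u - skew_part j u *m skew_part i u
  = sym_part j u *m sym_part i u - sym_part i u *m sym_part j u
    + H *: ((tangent_row i u)^T *m tangent_row j u - (tangent_row j u)^T *m tangent_row i u).
Proof.
move=> Uu; have [+ _] := dm_B_sym i j Uu; rewrite !dm_skew// !skew_sym_part.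
move/(skew_symmetric_parts (om_skew i u) (om_skew j u) (K_sym i u) (K_sym j u)).
by rewrite trmx_mul trmxK => /(_ erefl)[].
Qed.

Lemma codazzi i j u : U u ->
  dm j (sym_part i) u + skew_part i u *m sym_part j u + sym_part i u *m skew_part j u =
  dm i (sym_part j) u + skew_part j u *m sym_part i u + sym_part j u *m skew_part i u.
Proof.
move=> Uu; have [+ _] := dm_B_sym i j Uu; rewrite !dm_symm// !skew_sym_part.
move/(skew_symmetric_parts (om_skew i u) (om_skew j u) (K_sym i u) (K_sym j u)).
by rewrite trmx_mul trmxK => /(_ erefl)[].
Qed.

End Frame.

(** [Z] is the mixed second derivative of [T], computed in both orders from equations of the form dT
    = a T - T o. Eliminating it shows that [T] conjugates the curvatures of the two connection
    forms. *)
Lemma curvature_conjugation (R : realType) n (T Z a b o o' p p' x y Ga Gb : 'M[R]_n) :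
  x = a *m T - T *m o -> y = b *m T - T *m o' ->
  Gb *m T + b *m x = Z + (x *m o' + T *m p') ->
  Ga *m T + a *m y = Z + (y *m o + T *m p) ->
  (Gb - Ga + b *m a - a *m b) *m T = T *m (p' - p + o' *m o - o *m o').
Proof.
move=> xE yE E1 E2.
have E1' : Gb *m T = Z + (x *m o' + T *m p') - b *m x by rewrite -E1 addrK.
have E2' : Ga *m T = Z + (y *m o + T *m p) - a *m y by rewrite -E2 addrK.
rewrite !(mulmxDl, mulmxDr, mulNmx, mulmxN) E1' E2' xE yE.
rewrite !(mulmxDl, mulmxDr, mulNmx, mulmxN) !mulmxA.
move: (T *m p') (T *m p) (a *m T *m o') (T *m o *m o') (b *m a *m T) (b *m T *m o)
  (T *m o' *m o) (a *m b *m T) => x1 x2 x3 x4 x5 x6 x7 x8.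
by apply/matrixP => r c; rewrite !mxE; ring.
Qed.

Lemma mxtraceB (R : realType) n (X Y : 'M[R]_n) : \tr (X - Y) = \tr X - \tr Y.
Proof. exact: raddfB. Qed.

Section CurvatureAction.
Context {R : realType} (k : 'I_3 -> 'M[R]_3).

(** [ad] acts on the two matrix indices of [k] and [act] on the third one; together they are the
    derivation action on a tensor with three indices. *)
Let ad (X Y : 'M[R]_3) : 'M[R]_3 := X *m Y - Y *m X.
Let act (X : 'M[R]_3) c : 'M[R]_3 := \sum_d X c d *: k d.

Let ad_act (X Y : 'M[R]_3) c : ad X (act Y c) = \sum_d Y c d *: ad X (k d).
Proof.
rewrite /ad /act mulmx_sumr mulmx_suml -sumrB; apply: eq_bigr => d _.
by rewrite -scalemxAr -scalemxAl scalerBr.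
Qed.

Let act_act (X Y : 'M[R]_3) c : \sum_d X c d *: act Y d = act (X *m Y) c.
Proof.
rewrite /act; under eq_bigr do rewrite scaler_sumr.
rewrite exchange_big /=; apply: eq_bigr => b _; rewrite mxE scaler_suml.
by apply: eq_bigr => d _; rewrite scalerA.
Qed.

Let ad_ad (X Y Z : 'M[R]_3) : ad X (ad Y Z) - ad Y (ad X Z) = ad (X *m Y - Y *m X) Z.
Proof.
rewrite /ad !(mulmxDl, mulmxDr, mulNmx, mulmxN) !mulmxA.
move: (X *m Y *m Z) (X *m Z *m Y) (Y *m Z *m X) (Z *m Y *m X) (Y *m X *m Z) (Z *m X *m Y).
by move=> a b c d e f; apply/matrixP => i j; rewrite !mxE; ring.
Qed.

(** For a parallel [k] the derivatives [di] and [dj] are given by the action of the connection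
    forms. Equality of the mixed second derivatives then says that the curvature [F] annihilates
    [k], because the commutator of two actions is the action of a commutator. *)
Lemma curvature_action (A B o o' : 'M[R]_3) (di dj : 'I_3 -> 'M[R]_3) c :
  (forall d, di d = (o *m k d - k d *m o) + \sum_b o d b *: k b) ->
  (forall d, dj d = (o' *m k d - k d *m o') + \sum_b o' d b *: k b) ->
  A *m k c + o' *m di c - (di c *m o' + k c *m A)
    + \sum_d (A c d *: k d + o' c d *: di d) =
  B *m k c + o *m dj c - (dj c *m o + k c *m B)
    + \sum_d (B c d *: k d + o c d *: dj d) ->
  let F := A - B + o' *m o - o *m o' in
  F *m k c - k c *m F + \sum_d F c d *: k d = 0.
Proof.
move=> diE djE E F.
have SS (X Y Z : 'M[R]_3) D : (forall d, D d = ad Y (k d) + act Y d) ->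
    X *m k c + Z *m D c - (D c *m Z + k c *m X) + \sum_d (X c d *: k d + Z c d *: D d)
    = ad X (k c) + ad Z (ad Y (k c)) + ad Z (act Y c) + ad Y (act Z c) + act X c +
      act (Z *m Y) c.
  move=> DE.
  have -> : \sum_d (X c d *: k d + Z c d *: D d) =
      act X c + ad Y (act Z c) + act (Z *m Y) c.
    rewrite ad_act -act_act -!big_split /=; apply: eq_bigr => d _.
    by rewrite DE scalerDr addrA.
  rewrite DE; move: (act X c) (ad Y (act Z c)) (act (Z *m Y) c) => a1 a2 a3.
  move: (ad Y (k c)) (act Y c) => b1 b2; rewrite /ad mulmxDl mulmxDr.
  by apply/matrixP => i j; rewrite !mxE; ring.
move: E; rewrite (SS _ _ _ _ diE) (SS _ _ _ _ djE) => E.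
have actD X Y : act (X + Y) c = act X c + act Y c.
  by rewrite /act -big_split; apply: eq_bigr => d _; rewrite mxE scalerDl.
have actN X : act (- X) c = - act X c.
  by rewrite /act -sumrN; apply: eq_bigr => d _; rewrite mxE scaleNr.
have adD X Y : ad (X + Y) (k c) = ad X (k c) + ad Y (k c).
  rewrite /ad mulmxDl mulmxDr.
  by apply/matrixP => i j; rewrite !mxE; ring.
have adN X : ad (- X) (k c) = - ad X (k c).
  by rewrite /ad mulNmx mulmxN opprB opprK addrC.
rewrite -/(ad F (k c)) -/(act F c).
have -> : F = A + (- B) + (o' *m o - o *m o') by rewrite /F addrA.
rewrite adD (adD A) -ad_ad adN !actD !actN.
move: E; move: (ad A _) (ad B _) (ad o' (ad _ _)) (ad o (ad _ _)).
move: (ad o' (act o c)) (ad o (act o' c)) (act A c) (act B c) (act _ c) (act _ c).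
move=> x1 x2 x3 x4 x5 x6 x7 x8 x9 x10 E.
by apply/matrixP => i j; move: E => /matrixP/(_ i j); rewrite !mxE; lra.
Qed.

End CurvatureAction.

Lemma mulmx_sum2 (R : realType) m p q n1 n2 (x : 'I_n1 -> R) (y : 'I_n2 -> R)
    (X : 'I_n1 -> 'M[R]_(m, p)) (Y : 'I_n2 -> 'M[R]_(p, q)) :
  (\sum_a x a *: X a) *m (\sum_b y b *: Y b) =
  \sum_a \sum_b (x a * y b) *: (X a *m Y b).
Proof.
rewrite mulmx_suml; apply: eq_bigr => a _; rewrite mulmx_sumr; apply: eq_bigr => b _.
by rewrite -scalemxAl -scalemxAr scalerA.
Qed.

(* [Gam i] are the Christoffel symbols, [Fc] and [Ff] the curvature on coordinate
   and on frame vectors, [Kf] and [Tn] the frame components of [K] and of its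
   Gram matrix, [Sc] and [Sf] the covariant derivatives of [Kf] along coordinate
   and along frame vectors. *)
Section LeviCivita.
Context {R : realType} (U : set 'rV[R]_3) (H : R)
  (th : 'rV[R]_3 -> 'M[R]_3) (om K : 'I_3 -> 'rV[R]_3 -> 'M[R]_3)
  (h : 'rV[R]_3 -> 'M[R]_3).
Hypotheses (Uo : open U) (sth : smx U th) (som : forall i, smx U (om i))
  (sK : forall i, smx U (K i))
  (uth : forall u, U u -> th u \in unitmx)
  (hE : forall u, U u -> th u *m (th u)^T = h u).
Hypotheses (om_skew : forall i u, (om i u)^T = - om i u)
  (K_sym : forall i u, (K i u)^T = K i u)
  (trK : forall i u, U u -> \tr (K i u) = 0)
  (t_K : forall i j u, U u -> row i (th u) *m K j u = row j (th u) *m K i u)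
  (torsion : forall i j u, U u ->
     row i (dm j th u) + row i (th u) *m om j u =
     row j (dm i th u) + row j (th u) *m om i u)
  (gauss : forall i j u, U u ->
     dm j (om i) u - dm i (om j) u + om i u *m om j u - om j u *m om i u
     = K j u *m K i u - K i u *m K j u
     + H *: ((row i (th u))^T *m row j (th u) - (row j (th u))^T *m row i (th u)))
  (codazzi : forall i j u, U u ->
     dm j (K i) u + om i u *m K j u + K i u *m om j u =
     dm i (K j) u + om j u *m K i u + K j u *m om i u).

Let W u := invmx (th u).

Let smxW : smx U W. Proof. exact: smx_inv. Qed.

Definition Gam i u : 'M[R]_3 := (dm i th u + th u *m om i u) *m W u.

Lemma smx_Gam i : smx U (Gam i).
Proof.
apply: smxM => //; apply: smxD => //; first exact: smx_dm.
exact: smxM.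
Qed.

Lemma dm_th i u : U u -> dm i th u = Gam i u *m th u - th u *m om i u.
Proof. by move=> Uu; rewrite /Gam mulmxKV ?uth// addrK. Qed.

Lemma Gam_torsion i j u : U u -> row j (Gam i u) = row i (Gam j u).
Proof.
move=> Uu; rewrite /Gam !row_mul !linearD /= !row_mul.
by congr (_ *m _); exact: torsion.
Qed.

Lemma dm_h i u : U u -> dm i h u = Gam i u *m h u + (Gam i u *m h u)^T.
Proof.
move=> Uu; rewrite -(dm_eq i Uo hE Uu) (dmM i Uo sth (smxT Uo sth) Uu) dmT -hE//.
have -> : Gam i u *m (th u *m (th u)^T) =
   dm i th u *m (th u)^T + th u *m om i u *m (th u)^T.
  by rewrite /Gam mulmxA mulmxKV ?uth// mulmxDl.
rewrite linearD /= !trmx_mul !trmxK om_skew mulNmx mulmxN mulmxA.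
by rewrite addrACA subrr addr0.
Qed.

(** Uniqueness of the Levi-Civita connection: with [dm_h] and the symmetry [Gam_torsion], four of
    the six terms in the Christoffel formula cancel and the other two agree. *)
Lemma christoffelE k i j u : U u -> christoffel h k i j u = Gam i u j k.
Proof.
move=> Uu; rewrite /christoffel.
pose L i := Gam i u *m h u.
have Lt a b c : L a b c = L b a c.
  by have /rowP/(_ c) := congr1 (mulmx^~ (h u)) (Gam_torsion a b Uu); rewrite -!row_mul !mxE.
have dE a b c : partial a (metric_comp h b c) u = L a b c + L a c b.
  by have /matrixP/(_ b c) := dm_h a Uu; rewrite !mxE => <-.
have hs : (h u)^T = h u by rewrite -hE// trmx_mul trmxK.
have uh : h u \in unitmx by rewrite -hE// unitmx_mul unitmx_tr uth.
have -> : Gam i u j k = \sum_l invmx (h u) k l * L i j l.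
  have -> : Gam i u = L i *m (invmx (h u))^T by rewrite trmx_inv hs /L mulmxK.
  by rewrite mxE; apply: eq_bigr => l _; rewrite [_^T _ _]mxE mulrC.
rewrite mulr_sumr; apply: eq_bigr => l _.
rewrite !dE (Lt j i) (Lt l i) (Lt l j) mulrCA; congr (_ * _).
by field.
Qed.

(** Connection matrices act on row vectors from the right, so products occur in the order opposite
    to that in [riemann]. *)
Definition Fc i j u : 'M[R]_3 :=
  dm i (om j) u - dm j (om i) u + om j u *m om i u - om i u *m om j u.

Definition Riem i j u : 'M[R]_3 :=
  dm i (Gam j) u - dm j (Gam i) u + Gam j u *m Gam i u - Gam i u *m Gam j u.

Lemma riemannE l k i j u : U u -> riemann h l k i j u = Riem i j u k l.
Proof.
move=> Uu; rewrite /riemann /Riem.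
have E a b : partial a (christoffel h l b k) u = dm a (Gam b) u k l.
  by rewrite mxE; apply: (partial_eq (U := U)) => // v Uv; rewrite christoffelE.
rewrite !E sumrB.
have S a b : \sum_(m < 3) christoffel h l a m u * christoffel h m b k u =
   (Gam b u *m Gam a u) k l.
  by rewrite mxE; apply: eq_bigr => m _; rewrite !christoffelE// mulrC.
by rewrite !S !mxE; ring.
Qed.

Lemma Riem_Fc i j u : U u -> Riem i j u = th u *m Fc i j u *m W u.
Proof.
move=> Uu; rewrite -[LHS](mulmxK (uth Uu)); congr (_ *m _).
have E a b : dm a (dm b th) u = dm a (Gam b) u *m th u + Gam b u *m dm a th u -
    (dm a th u *m om b u + th u *m dm a (om b) u).
  rewrite (dm_eq a Uo (fun v => @dm_th b v) Uu).
  rewrite (dmB a Uo (smxM Uo (smx_Gam b) sth) (smxM Uo sth (som b)) Uu).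
  by rewrite (dmM a Uo (smx_Gam b) sth Uu) (dmM a Uo sth (som b) Uu).
apply: (@curvature_conjugation _ _ _ (dm i (dm j th) u) _ _ _ _ _ _ (dm i th u) (dm j th u)).
- exact: dm_th.
- exact: dm_th.
- by rewrite E subrK.
- by rewrite (dmC i j Uo sth Uu) E subrK.
Qed.

Lemma FcE i j u : U u -> Fc i j u = K i u *m K j u - K j u *m K i u
  - H *: ((row i (th u))^T *m row j (th u) - (row j (th u))^T *m row i (th u)).
Proof.
move=> Uu; have := gauss i j Uu; rewrite /Fc.
move: (K i u *m K j u) (K j u *m K i u) (om i u *m om j u) (om j u *m om i u).
move: (_^T *m _) (_^T *m _) (dm j _ u) (dm i _ u) => a b c d x y z w E.
apply/matrixP => k l; move: E => /matrixP/(_ k l).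
by rewrite !mxE; lra.
Qed.

Definition Kf c u : 'M[R]_3 := \sum_i W u c i *: K i u.
Definition Tn u : 'M[R]_3 := \matrix_(a, b) \tr (Kf a u *m Kf b u).

Lemma smx_Kf c : smx U (Kf c).
Proof.
apply: smx_sum => // i; apply: smxZ => //; exact: smxW.
Qed.

Lemma KE i u : U u -> K i u = \sum_c th u i c *: Kf c u.
Proof.
move=> Uu; have WV := mulmxV (uth Uu).
rewrite /Kf; under eq_bigr do rewrite scaler_sumr.
rewrite exchange_big /=.
have E j : \sum_c th u i c *: (W u c j *: K j u) = (i == j)%:R *: K j u.
  under eq_bigr do rewrite scalerA.
  by rewrite -scaler_suml; have /matrixP/(_ i j) := WV; rewrite !mxE => <-.
under eq_bigr do rewrite E.
rewrite (bigD1 i)//= eqxx scale1r big1 ?addr0// => j ij.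
by rewrite eq_sym (negbTE ij) scale0r.
Qed.

Lemma Kf_sym c u : (Kf c u)^T = Kf c u.
Proof.
by rewrite /Kf linear_sum /=; apply: eq_bigr => i _; rewrite linearZ /= K_sym.
Qed.

Lemma tr_Kf c u : U u -> \tr (Kf c u) = 0.
Proof.
move=> Uu; rewrite /Kf linear_sum /= big1// => i _.
by rewrite linearZ /= trK// mulr0.
Qed.

Lemma Kf_swap c d b u : U u -> Kf c u d b = Kf d u c b.
Proof.
move=> Uu; have WV := mulVmx (uth Uu).
have E j a : K j u a b = \sum_i W u a i * (th u *m K j u) i b.
  have := mulKmx (uth Uu) (K j u) => /matrixP/(_ a b) <-.
  by rewrite mxE.
have Et i j : (th u *m K j u) i b = (th u *m K i u) j b.
  by have /rowP/(_ b) := t_K i j Uu; rewrite -!row_mul !mxE.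
have L a a' : Kf a u a' b = \sum_j \sum_i W u a j * (W u a' i * (th u *m K j u) i b).
  rewrite /Kf summxE; apply: eq_bigr => j _.
  by rewrite mxE E mulr_sumr.
rewrite !L exchange_big /=; apply: eq_bigr => i _; apply: eq_bigr => j _.
by rewrite Et mulrCA.
Qed.

(** A trace does not depend on the basis: contracting a coordinate index with its dual amounts to
    contracting the frame index. *)
Lemma contract_th (X Y : 'I_3 -> 'M[R]_3) u k : U u ->
  (forall i, X i = \sum_c th u i c *: Y c) ->
  \sum_i (X i *m W u) k i = \sum_c Y c k c.
Proof.
move=> Uu XE.
have WV a b : \sum_i W u a i * th u i b = (a == b)%:R.
  by have /matrixP/(_ a b) := mulVmx (uth Uu); rewrite !mxE.
have -> : \sum_i (X i *m W u) k i = \sum_c \sum_m Y c k m * \sum_i W u m i * th u i c.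
  transitivity (\sum_i \sum_c \sum_m Y c k m * (W u m i * th u i c)).
    apply: eq_bigr => i _; rewrite mxE exchange_big /=; apply: eq_bigr => m _.
    rewrite XE summxE mulr_suml; apply: eq_bigr => c _.
    by rewrite mxE; ring.
  rewrite exchange_big /=; apply: eq_bigr => c _; rewrite exchange_big /=.
  by apply: eq_bigr => m _; rewrite mulr_sumr.
apply: eq_bigr => c _; rewrite (bigD1 c)//= WV eqxx mulr1 big1 ?addr0//.
by move=> m mc; rewrite WV (negbTE mc) mulr0.
Qed.

(** Trace of the Gauss equation. Of the two products of [K], total symmetry turns one into the Gram
    matrix and the vanishing trace kills the other; the term in [H] contributes the factor n - 1 =
    2. *)
Lemma ricciE j k u : U u ->
  ricci h j k u = (th u *m ((2 * H)%:M + Tn u) *m (th u)^T) j k.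
Proof.
move=> Uu; rewrite /ricci.
under eq_bigr do rewrite (riemannE _ _ _ _ Uu) (Riem_Fc _ _ Uu).
pose eps c : 'rV[R]_3 := delta_mx 0 c.
pose Z c := Kf c u *m K j u - K j u *m Kf c u
  - H *: ((eps c)^T *m row j (th u) - (row j (th u))^T *m eps c).
rewrite (@contract_th (fun i => th u *m Fc i j u) (fun c => th u *m Z c))//; last first.
  move=> i; rewrite FcE// KE// (row_sum_delta (row i (th u))).
  rewrite [(\sum_(l < 3) _ *: delta_mx _ _)^T]linear_sum /= !mulmx_suml !mulmx_sumr.
  rewrite -!sumrB scaler_sumr -sumrB mulmx_sumr; apply: eq_bigr => c _.
  rewrite mxE [(_ *: _)^T]linearZ /= -!scalemxAl -!scalemxAr -!scalerBr.
  by rewrite [H *: (_ *: _)]scalerA [H * _]mulrC -scalerA -scalerBr -scalemxAr.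
have ZE m : \sum_c Z c m c = 2 * H * th u j m + \sum_b th u j b * Tn u m b.
  have K1 : \sum_c (Kf c u *m K j u) m c = \sum_b th u j b * Tn u m b.
    transitivity (\tr (Kf m u *m K j u)).
      rewrite /mxtrace; apply: eq_bigr => c _; rewrite !mxE; apply: eq_bigr => l _.
      by rewrite (Kf_swap c m)//.
    rewrite KE// mulmx_sumr linear_sum /=; apply: eq_bigr => b _.
    by rewrite -scalemxAr linearZ /= mxE.
  have K2 : \sum_c (K j u *m Kf c u) m c = 0.
    transitivity (\sum_l K j u m l * \tr (Kf l u)).
      under eq_bigr do rewrite mxE; rewrite exchange_big /=; apply: eq_bigr => l _.
      by rewrite /mxtrace mulr_sumr; apply: eq_bigr => c _; rewrite (Kf_swap c l).
    by rewrite big1// => l _; rewrite tr_Kf// mulr0.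
  have K3 : \sum_c ((eps c)^T *m row j (th u) - (row j (th u))^T *m eps c) m c =
      - (2 * th u j m).
    rewrite sum3 !mxE !big_ord1 !mxE.
    by elim/ord3P: m {K1 K2} => /=; ring.
  transitivity (\sum_c (Kf c u *m K j u) m c - \sum_c (K j u *m Kf c u) m c - H *
     \sum_c ((eps c)^T *m row j (th u) - (row j (th u))^T *m eps c) m c).
    rewrite mulr_sumr -!sumrB; apply: eq_bigr => c _.
    by rewrite /Z [LHS]mxE [X in X + _ = _]mxE; congr (_ + _ + _); rewrite mxE // mxE.
  by rewrite K1 K2 K3; ring.
transitivity (\sum_m th u k m * \sum_c Z c m c).
  under eq_bigr do rewrite mxE; rewrite exchange_big /=; apply: eq_bigr => m _.
  by rewrite mulr_sumr.
under eq_bigr do rewrite ZE.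
rewrite -mulmxA mulmxDl mulmxDr [RHS]mxE mul_scalar_mx -scalemxAr.
have -> : ((2 * H) *: (th u *m (th u)^T)) j k = \sum_m th u k m * (2 * H * th u j m).
  by rewrite !mxE mulr_sumr; apply: eq_bigr => m _; rewrite mxE; ring.
have -> : (th u *m (Tn u *m (th u)^T)) j k =
    \sum_m th u k m * \sum_b th u j b * Tn u m b.
  rewrite mulmxA mxE; apply: eq_bigr => m _; rewrite mxE [(_^T) _ _]mxE mulrC.
  by congr (_ * _); apply: eq_bigr => b _; rewrite !mxE mxtrace_mulC.
by rewrite -big_split /=; apply: eq_bigr => m _; exact: mulrDr.
Qed.

Lemma smx_Tn : smx U Tn.
Proof.
move=> a b.
apply: (@sm_eq _ _ _ (fun v => \sum_k (Kf a v *m Kf b v) k k)) => //.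
  by move=> v _; rewrite mxE.
apply: sm_sum => // k; apply: smxM => //; exact: smx_Kf.
Qed.

Hypothesis ricci_parallel : forall l i j u, U u ->
  covariant_derivative h (ricci h) l i j u = 0.

(** Parallelism in coordinates reads d Ric = Gam Ric + Ric Gam^T. Passing to the frame by [th]
    replaces [Gam] by [om], and the multiple 2 H of the identity commutes with [om]. *)
Lemma dm_Tn l u : U u -> dm l Tn u = om l u *m Tn u - Tn u *m om l u.
Proof.
move=> Uu; pose C : 'M[R]_3 := (2 * H)%:M; pose Q v := C + Tn v.
have sQ : smx U Q by apply: smxD => //; [exact: smx_cst|exact: smx_Tn].
pose Ric v := th v *m Q v *m (th v)^T.
have sT := smxT Uo sth.
have E : dm l Ric u = Gam l u *m Ric u + Ric u *m (Gam l u)^T.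
  apply/matrixP => i j; have := ricci_parallel l i j Uu.
  rewrite /covariant_derivative.
  rewrite (@partial_eq _ _ U _ (fun v => Ric v i j))//; last first.
    by move=> v Uv; rewrite ricciE.
  rewrite (eq_bigr (fun m => Gam l u i m * Ric u m j)); last first.
    by move=> m _; rewrite christoffelE// ricciE.
  rewrite [X in _ - X](eq_bigr (fun m => Ric u i m * (Gam l u)^T m j)); last first.
    by move=> m _; rewrite christoffelE// ricciE// [_^T _ _]mxE mulrC.
  by rewrite !mxE; move: (partial _ _ _) (\sum_m _) (\sum_m _) => a b c; lra.
have dQ : dm l Q u = dm l Tn u.
  by rewrite /Q (dmD l (smx_cst (U := U) C) smx_Tn Uu) dm_cst add0r.
have {E} E : th u *m (dm l Tn u - (om l u *m Q u - Q u *m om l u)) *m (th u)^T = 0.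
  move: E; rewrite /Ric (dmM l Uo (smxM Uo sth sQ) sT Uu) (dmM l Uo sth sQ Uu) dmT dQ.
  rewrite dm_th// linearB /= !trmx_mul om_skew mulNmx opprK.
  rewrite !(mulmxDl, mulmxDr, mulNmx, mulmxN) !mulmxA.
  move: (Gam l u *m th u *m Q u *m (th u)^T) (th u *m Q u *m (th u)^T *m (Gam l u)^T).
  move: (th u *m om l u *m Q u *m (th u)^T) (th u *m Q u *m om l u *m (th u)^T).
  move: (th u *m dm l Tn u *m (th u)^T) => a b c d e E.
  by apply/matrixP => i j; move: E => /matrixP/(_ i j); rewrite !mxE; lra.
have uT : (th u)^T \in unitmx by rewrite unitmx_tr uth.
have := congr1 (fun X => W u *m (X *m invmx (th u)^T)) E.
rewrite mul0mx mulmx0 mulmxK// mulKmx ?uth// => /eqP; rewrite subr_eq0 => /eqP ->.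
rewrite /Q /C mulmxDl mulmxDr mul_scalar_mx mul_mx_scalar opprD addrACA.
by rewrite subrr add0r.
Qed.

Definition Sc j c u : 'M[R]_3 := dm j (Kf c) u
  - (om j u *m Kf c u - Kf c u *m om j u) - \sum_d om j u c d *: Kf d u.

Definition Sf d c u : 'M[R]_3 := \sum_j W u d j *: Sc j c u.

Lemma smx_Sc j c : smx U (Sc j c).
Proof.
have sKf d := @smx_Kf d; have sX := smx_dm j Uo (sKf c).
have sY := smxB Uo (smxM Uo (som j) (sKf c)) (smxM Uo (sKf c) (som j)).
apply: (smxB Uo (smxB Uo sX sY)); apply: smx_sum => // d; apply: smxZ => //.
exact: som.
Qed.

Lemma smx_Sf d c : smx U (Sf d c).
Proof.
apply: smx_sum => // j; apply: smxZ => //; exact: smx_Sc.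
Qed.

Lemma dm_Kf j c u : dm j (Kf c) u = Sc j c u
  + (om j u *m Kf c u - Kf c u *m om j u) + \sum_d om j u c d *: Kf d u.
Proof.
rewrite /Sc; move: (dm j _ u) (om j u *m _ - _) (\sum_d _) => x y z.
by apply/matrixP => a b; rewrite !mxE; ring.
Qed.

Lemma ScE j c u : U u -> Sc j c u = \sum_d th u j d *: Sf d c u.
Proof.
move=> Uu; rewrite /Sf; under eq_bigr do rewrite scaler_sumr.
rewrite exchange_big /= (bigD1 j)//= [X in _ = _ + X]big1 ?addr0 => [|k kj].
  under eq_bigr do rewrite scalerA; rewrite -scaler_suml.
  by have /matrixP/(_ j j) := mulmxV (uth Uu); rewrite !mxE eqxx => ->; rewrite scale1r.
under eq_bigr do rewrite scalerA; rewrite -scaler_suml.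
have /matrixP/(_ j k) := mulmxV (uth Uu); rewrite !mxE eq_sym (negbTE kj) => ->.
by rewrite scale0r.
Qed.

(** The Codazzi equation for [K], rewritten through [KE]; the derivatives of [th] enter only in the
    combination of [torsion], which is symmetric in [i] and [j]. *)
Lemma th_Sc i j u : U u -> \sum_c th u i c *: Sc j c u = \sum_c th u j c *: Sc i c u.
Proof.
move=> Uu.
have E i' j' : dm j' (K i') u - (om j' u *m K i' u - K i' u *m om j' u) =
    \sum_c th u i' c *: Sc j' c u + \sum_c (dm j' th u + th u *m om j' u) i' c *: Kf c u.
  rewrite (dm_eq j' Uo (fun v => @KE i' v) Uu).
  rewrite (dm_sum _ _ j' Uo _ Uu); last first.
    by move=> c; apply: smxZ => //; exact: smx_Kf.
  under eq_bigr do rewrite (dmZ j' (sth _ _) (smx_Kf _) Uu) dm_Kf.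
  have -> : om j' u *m K i' u - K i' u *m om j' u =
      \sum_c th u i' c *: (om j' u *m Kf c u - Kf c u *m om j' u).
    rewrite KE// mulmx_sumr mulmx_suml -sumrB; apply: eq_bigr => c _.
    by rewrite -scalemxAl -scalemxAr scalerBr.
  have XE : \sum_c (th u *m om j' u) i' c *: Kf c u =
      \sum_c th u i' c *: (\sum_d om j' u c d *: Kf d u).
    under [RHS]eq_bigr do rewrite scaler_sumr.
    rewrite exchange_big /=; apply: eq_bigr => d _.
    by rewrite mxE scaler_suml; apply: eq_bigr => c _; rewrite scalerA.
  have -> : \sum_c (dm j' th u + th u *m om j' u) i' c *: Kf c u =
      \sum_c dm j' th u i' c *: Kf c u + \sum_c (th u *m om j' u) i' c *: Kf c u.
    by rewrite -big_split /=; apply: eq_bigr => c _; rewrite mxE scalerDl.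
  rewrite XE -sumrB -!big_split /=; apply: eq_bigr => c _.
  rewrite dmE; move: (Sc j' c u) (partial _ _ _) (\sum_d _) (om j' u *m Kf c u) (Kf c u *m om j' u).
  move=> x1 x2 x3 x4 x5.
  by apply/matrixP => a b; rewrite !mxE; ring.
have tor : \sum_c (dm j th u + th u *m om j u) i c *: Kf c u =
    \sum_c (dm i th u + th u *m om i u) j c *: Kf c u.
  apply: eq_bigr => c _; congr (_ *: _).
  by have /rowP/(_ c) := torsion i j Uu; rewrite -!row_mul -!linearD !mxE.
have := codazzi i j Uu.
have := E i j; have := E j i; rewrite tor.
move: (\sum_c (dm i th u + th u *m om i u) j c *: Kf c u) => x.
move: (\sum_c _) (\sum_c _) => y z.
move: (om j u *m K i u) (om i u *m K j u) (K i u *m om j u) (K j u *m om i u).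
move: (dm j _ u) (dm i _ u) => a b c d e f E1 E2 E3.
apply/matrixP => k l; move: E1 E2 E3 => /matrixP/(_ k l) + /matrixP/(_ k l) + /matrixP/(_ k l).
by rewrite !mxE; lra.
Qed.

Lemma Sf_comm d c u : U u -> Sf d c u = Sf c d u.
Proof.
move=> Uu; apply/matrixP => a b.
pose M : 'M[R]_3 := \matrix_(d, c) Sf d c u a b.
have ME i j : (th u *m M^T *m (th u)^T) i j = (\sum_c th u i c *: Sc j c u) a b.
  rewrite mulmx3E !mulmx3E sum3 !ScE// !sum3 !mxE.
  by ring.
have E : th u *m M^T *m (th u)^T = th u *m M *m (th u)^T.
  have <- : (th u *m M^T *m (th u)^T)^T = th u *m M *m (th u)^T.
    by rewrite !trmx_mul !trmxK mulmxA.
  by apply/matrixP => i j; rewrite [RHS]mxE !ME th_Sc.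
have uT : (th u)^T \in unitmx by rewrite unitmx_tr uth.
move/(congr1 (mulmx^~ (invmx (th u)^T))): E; rewrite /= !mulmxK//.
move/(congr1 (mulmx (W u))); rewrite !mulKmx ?uth// => /matrixP/(_ c d).
by rewrite !mxE.
Qed.

Lemma Sf_sym d c u : U u -> (Sf d c u)^T = Sf d c u.
Proof.
move=> Uu; rewrite /Sf linear_sum /=; apply: eq_bigr => j _; rewrite linearZ /=.
congr (_ *: _); rewrite /Sc 2!linearB /= -dmT.
rewrite (@dm_eq _ _ _ _ U _ (Kf c))//; last by move=> v _; exact: Kf_sym.
congr (_ - _ - _); last first.
  by rewrite linear_sum /=; apply: eq_bigr => b _; rewrite linearZ /= Kf_sym.
by rewrite linearB /= !trmx_mul Kf_sym om_skew mulNmx mulmxN opprK addrC.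
Qed.

Lemma Sf_trace d c u : U u -> \tr (Sf d c u) = 0.
Proof.
move=> Uu; rewrite /Sf linear_sum /= big1// => j _; rewrite linearZ /=.
have C0 : \tr (om j u *m Kf c u - Kf c u *m om j u) = 0.
  by rewrite linearB /= mxtrace_mulC subrr.
have D0 : \tr (\sum_d om j u c d *: Kf d u) = 0.
  by rewrite linear_sum /= big1// => b _; rewrite linearZ /= tr_Kf// mulr0.
rewrite /Sc 2!linearB /= C0 D0 !subr0.
have -> : \tr (dm j (Kf c) u) = partial j (fun v => \tr (Kf c v)) u.
  have dk k : differentiable (fun v => Kf c v k k) u by exact: (sm_diff (@smx_Kf c k k) Uu).
  have [_ ->] := partial_sum (index_enum 'I_3) predT dk.
  by rewrite /mxtrace; apply: eq_bigr => k _; rewrite mxE.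
rewrite (@partial_eq _ _ U _ (cst 0))//; first by rewrite partial_cst /= mulr0.
by move=> v Uv; rewrite tr_Kf.
Qed.

Lemma Sf_swap d c a b u : U u -> Sf d c u a b = Sf d a u c b.
Proof.
move=> Uu; rewrite /Sf !summxE; apply: eq_bigr => j _; rewrite mxE [RHS]mxE.
congr (_ * _); rewrite /Sc.
have E : dm j (Kf c) u a b = dm j (Kf a) u c b.
  by rewrite !dmE; apply: (partial_eq (U := U)) => // v Uv; exact: Kf_swap.
have S c' a' : (om j u *m Kf c' u - Kf c' u *m om j u) a' b + (\sum_d om j u c' d *: Kf d u) a' b
    = \sum_d (om j u a' d * Kf c' u d b - Kf c' u a' d * om j u d b + om j u c' d * Kf d u a' b).
  rewrite !mxE summxE -sumrB -big_split /=; apply: eq_bigr => k _.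
  by rewrite mxE.
have F c' a' : (dm j (Kf c') u - (om j u *m Kf c' u - Kf c' u *m om j u) -
     \sum_d0 om j u c' d0 *: Kf d0 u) a' b = dm j (Kf c') u a' b -
   \sum_d (om j u a' d * Kf c' u d b - Kf c' u a' d * om j u d b + om j u c' d * Kf d u a' b).
  rewrite -S; move: (dm _ _ _) (om j u *m Kf c' u - Kf c' u *m om j u) (\sum_d _).
  move=> x y z.
  by rewrite !mxE; ring.
rewrite !F E; congr (_ - _); apply: eq_bigr => k _.
rewrite (Kf_swap c a k Uu) (Kf_swap c k b Uu) (Kf_swap k a b Uu).
by ring.
Qed.

Lemma tr_Sf_Kf d a b u : U u -> \tr (Sf d a u *m Kf b u) = 0.
Proof.
move=> Uu.
have anti j a' b' : \tr (Sc j a' u *m Kf b' u) + \tr (Sc j b' u *m Kf a' u) = 0.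
  have dT : dm j Tn u a' b' = \tr (dm j (Kf a') u *m Kf b' u + Kf a' u *m dm j (Kf b') u).
    rewrite dmE -(dmM j Uo (smx_Kf a') (smx_Kf b') Uu).
    rewrite (@partial_eq _ _ U _ (fun v => \tr (Kf a' v *m Kf b' v)))//; last first.
      by move=> v _; rewrite mxE.
    have dk k : differentiable (fun v => (Kf a' v *m Kf b' v) k k) u.
      exact: (sm_diff (smxM Uo (smx_Kf a') (smx_Kf b') k k) Uu).
    have [_ ->] := partial_sum (index_enum 'I_3) predT dk.
    by rewrite /mxtrace; apply: eq_bigr => k _; rewrite mxE.
  have T1 : \tr ((\sum_d om j u a' d *: Kf d u) *m Kf b' u) = (om j u *m Tn u) a' b'.
    rewrite mulmx_suml linear_sum /= mxE; apply: eq_bigr => k _.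
    by rewrite -scalemxAl linearZ /= mxE.
  have T2 : \tr (Kf a' u *m (\sum_d om j u b' d *: Kf d u)) = - (Tn u *m om j u) a' b'.
    rewrite mulmx_sumr linear_sum /= mxE -sumrN; apply: eq_bigr => k _.
    rewrite -scalemxAr linearZ /= mxE.
    by have /matrixP/(_ k b') := om_skew j u; rewrite !mxE => ->; rewrite mulNr mulrC.
  have T3 : \tr ((om j u *m Kf a' u - Kf a' u *m om j u) *m Kf b' u) +
            \tr (Kf a' u *m (om j u *m Kf b' u - Kf b' u *m om j u)) = 0.
    rewrite mulmxBl mulmxBr !mxtraceB !mulmxA.
    by rewrite (mxtrace_mulC (Kf a' u *m Kf b' u)) mulmxA subrKA subrr.
  move: dT; rewrite dm_Tn// !dm_Kf; move: T1 T2 T3.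
  move: (Sc j a' u) (Sc j b' u) (\sum_d om j u a' d *: _) (\sum_d om j u b' d *: _).
  move: (om j u *m Kf a' u - Kf a' u *m om j u) (om j u *m Kf b' u - Kf b' u *m om j u).
  move=> c1 c2 s1 s2 d1 d2 T1 T2 T3; rewrite !mulmxDl !mulmxDr !mxtraceD T1 T2.
  rewrite (mxtrace_mulC (Kf a' u) s2).
  have -> (X Y : 'M[R]_3) : (X - Y) a' b' = X a' b' - Y a' b' by rewrite !mxE.
  by move: T3; lra.
have anti' d' a' b' : \tr (Sf d' a' u *m Kf b' u) = - \tr (Sf d' b' u *m Kf a' u).
  have L a1 b1 : \tr (Sf d' a1 u *m Kf b1 u) = \sum_j W u d' j * \tr (Sc j a1 u *m Kf b1 u).
    rewrite /Sf mulmx_suml linear_sum /=; apply: eq_bigr => j _.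
    by rewrite -scalemxAl linearZ.
  rewrite !L -sumrN; apply: eq_bigr => j _; rewrite -mulrN; congr (_ * _).
  by apply/eqP; rewrite -addr_eq0 anti.
have sy d' a' b' : \tr (Sf d' a' u *m Kf b' u) = \tr (Sf a' d' u *m Kf b' u).
  by rewrite Sf_comm.
(* Six swaps, alternately exchanging the last two indices with a sign and the first two without,
   bring the triple back with the opposite sign. *)
have : \tr (Sf d a u *m Kf b u) = - \tr (Sf d a u *m Kf b u).
  by rewrite {1}anti' sy anti' opprK sy anti' sy.
by lra.
Qed.

Hypothesis S0 : forall d c u, U u -> Sf d c u = 0.

Lemma Sc0 j c u : U u -> Sc j c u = 0.
Proof. by move=> Uu; rewrite ScE// big1// => d _; rewrite S0// scaler0. Qed.

Lemma dm_Kf0 j c u : U u -> dm j (Kf c) u =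
  (om j u *m Kf c u - Kf c u *m om j u) + \sum_d om j u c d *: Kf d u.
Proof. by move=> Uu; rewrite dm_Kf Sc0// add0r. Qed.

Lemma ricci_identity i j c u : U u ->
  Fc i j u *m Kf c u - Kf c u *m Fc i j u + \sum_d Fc i j u c d *: Kf d u = 0.
Proof.
move=> Uu.
have sKf d := @smx_Kf d.
have sC b c' := smxB Uo (smxM Uo (som b) (sKf c')) (smxM Uo (sKf c') (som b)).
have E a b : dm a (dm b (Kf c)) u =
   dm a (om b) u *m Kf c u + om b u *m dm a (Kf c) u -
   (dm a (Kf c) u *m om b u + Kf c u *m dm a (om b) u) +
   \sum_d (dm a (om b) u c d *: Kf d u + om b u c d *: dm a (Kf d) u).
  have sD d : smx U (fun v => om b v c d *: Kf d v) by apply: smxZ => //; exact: som.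
  rewrite (dm_eq a Uo (fun v => @dm_Kf0 b c v) Uu).
  rewrite (dmD a (sC b c) (smx_sum _ _ Uo sD) Uu) (dm_sum _ _ a Uo sD Uu).
  rewrite (dmB a Uo (smxM Uo (som b) (sKf c)) (smxM Uo (sKf c) (som b)) Uu).
  rewrite (dmM a Uo (som b) (sKf c) Uu) (dmM a Uo (sKf c) (som b) Uu).
  congr (_ + _); apply: eq_bigr => d _.
  by rewrite (dmZ a (som b c d) (sKf d) Uu) dmE.
apply: (curvature_action (di := fun d => dm i (Kf d) u) (dj := fun d => dm j (Kf d) u)).
- by move=> d; exact: dm_Kf0.
- by move=> d; exact: dm_Kf0.
- exact: etrans (esym (E i j)) (etrans (dmC i j Uo (sKf c) Uu) (E j i)).
Qed.

Definition Ff a b u : 'M[R]_3 := Kf a u *m Kf b u - Kf b u *m Kf a u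
  - H *: ((delta_mx 0 a : 'rV[R]_3)^T *m (delta_mx 0 b : 'rV_3) -
          (delta_mx 0 b : 'rV[R]_3)^T *m (delta_mx 0 a : 'rV_3)).

(** The expression is linear in the curvature matrix. The identity for the coordinate matrices [Fc]
    therefore says that a 3 by 3 matrix of its values becomes zero when multiplied by [th u] and its
    transpose, which are invertible. *)
Lemma ricci_identity_frame a b c u : U u ->
  Ff a b u *m Kf c u - Kf c u *m Ff a b u + \sum_d Ff a b u c d *: Kf d u = 0.
Proof.
move=> Uu.
pose Q (X : 'M[R]_3) : 'M[R]_3 :=
  X *m Kf c u - Kf c u *m X + \sum_d X c d *: Kf d u.
have QD X Y : Q (X + Y) = Q X + Q Y.
  rewrite /Q mulmxDl mulmxDr.
  under eq_bigr do rewrite mxE scalerDl.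
  rewrite big_split /=; move: (\sum_d _) (\sum_d _) => x y.
  by apply/matrixP => i j; rewrite !mxE; ring.
have QZ (r : R) X : Q (r *: X) = r *: Q X.
  rewrite /Q -scalemxAl -scalemxAr.
  under eq_bigr do rewrite mxE -scalerA.
  by rewrite -scaler_sumr scalerDr scalerBr.
have Qsum (F : 'I_3 -> 'M[R]_3) : Q (\sum_i F i) = \sum_i Q (F i).
  by rewrite !sum3 !QD.
have FfE i j : Fc i j u = \sum_a \sum_b (th u i a * th u j b) *: Ff a b u.
  have row_th k : row k (th u) = \sum_a th u k a *: delta_mx 0 a.
    by rewrite {1}[row k _]row_sum_delta; apply: eq_bigr => a' _; rewrite mxE.
  have row_thT k : (row k (th u))^T = \sum_a th u k a *: (delta_mx 0 a : 'rV_3)^T.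
    by rewrite row_th linear_sum; apply: eq_bigr => a' _; rewrite linearZ.
  have swap (F : 'I_3 -> 'I_3 -> 'M[R]_3) : \sum_b \sum_a (th u j b * th u i a) *: F b a =
     \sum_a \sum_b (th u i a * th u j b) *: F b a.
    rewrite exchange_big /=; apply: eq_bigr => a' _; apply: eq_bigr => b' _.
    by rewrite mulrC.
  rewrite FcE// !KE// !row_thT !row_th !mulmx_sum2 (swap (fun b a => Kf b u *m Kf a u)).
  rewrite (swap (fun b a => (delta_mx 0 b : 'rV_3)^T *m (delta_mx 0 a : 'rV_3))).
  rewrite -!sumrB scaler_sumr -sumrB; apply: eq_bigr => a' _.
  rewrite -!sumrB scaler_sumr -sumrB; apply: eq_bigr => b' _.
  rewrite /Ff; move: (Kf a' u *m _) (Kf b' u *m _) (_^T *m _) (_^T *m _) => x y z w.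
  by apply/matrixP => r s; rewrite !mxE; ring.
have Q0 i j : Q (Fc i j u) = 0 by exact: ricci_identity.
rewrite -[LHS]/(Q (Ff a b u)); clearbody Q.
apply/matrixP => r s; rewrite [RHS]mxE.
pose M : 'M[R]_3 := \matrix_(a, b) (Q (Ff a b u)) r s.
have Mq a' b' : Q (Ff a' b' u) r s = M a' b' by rewrite mxE.
clearbody M; suff M0 : M = 0 by rewrite Mq M0 mxE.
have ME : th u *m M *m (th u)^T = 0.
  apply/matrixP => i j.
  have : Q (Fc i j u) r s = 0 by rewrite Q0 mxE.
  rewrite FfE Qsum; under eq_bigr do (rewrite Qsum; under eq_bigr do rewrite QZ).
  rewrite summxE => E0; rewrite [RHS]mxE -{}E0 mxE.
  under eq_bigr do rewrite [_^T _ _]mxE mxE mulr_suml.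
  rewrite exchange_big /=; apply: eq_bigr => a' _; rewrite summxE.
  by apply: eq_bigr => b' _; rewrite [RHS]mxE Mq mulrAC.
have uT : (th u)^T \in unitmx by rewrite unitmx_tr uth.
by rewrite -(mulKmx (uth Uu) M) -(mulmxK uT (th u *m M)) ME mul0mx mulmx0.
Qed.

End LeviCivita.

(** * Cubic forms on a Euclidean 3-space *)

Section Cubic.
Context {R : realType}.
Implicit Types (K : 'I_3 -> 'M[R]_3) (u v w : 'rV[R]_3).

Definition cubic K := [/\ forall c, (K c)^T = K c, forall c a b, K c a b = K a c b
  & forall c, \tr (K c) = 0].

Definition contr K v : 'M[R]_3 := \sum_c v 0 c *: K c.

Definition dot v w : R := (v *m w^T) 0 0.

Definition tri K u v w : R := (v *m contr K u *m w^T) 0 0.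

(** Components of the cubic form with respect to the rows of [Q]. *)
Definition rot3 (Q : 'M[R]_3) K a : 'M[R]_3 := Q *m contr K (row a Q) *m Q^T.

Lemma dotE v w : dot v w = v 0 i0 * w 0 i0 + v 0 i1 * w 0 i1 + v 0 i2 * w 0 i2.
Proof. by rewrite /dot mulmx3E !mxE. Qed.

Lemma contrE K v a b : contr K v a b =
  v 0 i0 * K i0 a b + v 0 i1 * K i1 a b + v 0 i2 * K i2 a b.
Proof. by rewrite /contr summxE sum3 !mxE. Qed.

Lemma contrD K v w : contr K (v + w) = contr K v + contr K w.
Proof. by rewrite /contr -big_split; apply: eq_bigr => c _; rewrite mxE scalerDl. Qed.

Lemma contrZ K r v : contr K (r *: v) = r *: contr K v.
Proof. by rewrite /contr scaler_sumr; apply: eq_bigr => c _; rewrite mxE scalerA. Qed.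

Lemma contr_sum K (I : finType) (F : I -> 'rV[R]_3) :
  contr K (\sum_i F i) = \sum_i contr K (F i).
Proof.
apply: (big_morph _ (contrD K)).
by rewrite /contr big1// => c _; rewrite mxE scale0r.
Qed.

Lemma contr_delta K c : contr K (delta_mx 0 c) = K c.
Proof.
rewrite /contr (bigD1 c)//= mxE !eqxx scale1r big1 ?addr0// => d dc.
by rewrite mxE eqxx (negbTE dc) scale0r.
Qed.

Section Symmetries.
Variable K : 'I_3 -> 'M[R]_3.
Hypothesis cK : cubic K.

Lemma cubic_swap c a b : K c a b = K a c b. Proof. by have [_ ->] := cK. Qed.

Lemma cubic_sym c a b : K c a b = K c b a.
Proof. by have [/(_ c) /matrixP/(_ a b) + _ _] := cK; rewrite mxE. Qed.

(** Rewriting rules that sort the three indices, so that [ring] and [lra] meet only the ten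
    components of a symmetric cubic form. *)
Lemma cubic_sort : (forall b, K i1 i0 b = K i0 i1 b) * (forall b, K i2 i0 b = K i0 i2 b)
  * (forall b, K i2 i1 b = K i1 i2 b) * (forall c, K c i1 i0 = K c i0 i1)
  * (forall c, K c i2 i0 = K c i0 i2) * (forall c, K c i2 i1 = K c i1 i2).
Proof. by do !split=> *; rewrite ?(cubic_swap i1) ?(cubic_swap i2) // cubic_sym. Qed.

Lemma contr_sym v : (contr K v)^T = contr K v.
Proof.
have [sK _ _] := cK; rewrite /contr linear_sum.
by apply: eq_bigr => c _; rewrite linearZ /= sK.
Qed.

Lemma contr_tr v : \tr (contr K v) = 0.
Proof.
have [_ _ tK] := cK; rewrite /contr linear_sum big1// => c _.
by rewrite linearZ /= tK mulr0.
Qed.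

Lemma mul_contrC v w : v *m contr K w = w *m contr K v.
Proof.
by apply: rv3P; rewrite !mulmx3E !contrE !cubic_sort; ring.
Qed.

Lemma triC u v w : tri K u v w = tri K v u w.
Proof. by rewrite /tri mul_contrC. Qed.

End Symmetries.

Lemma mulmx_row_entry (Q X : 'M[R]_3) a b :
  (Q *m X *m Q^T) a b = (row a Q *m X *m (row b Q)^T) 0 0.
Proof. by rewrite !mulmx3E !mxE. Qed.

Lemma contr_rot Q K v : contr (rot3 Q K) v = Q *m contr K (v *m Q) *m Q^T.
Proof.
rewrite mulmx_sum_row contr_sum mulmx_sumr mulmx_suml; apply: eq_bigr => a _.
by rewrite contrZ -scalemxAr -scalemxAl.
Qed.

Lemma rot_tri Q K a b c : rot3 Q K c a b = tri K (row c Q) (row a Q) (row b Q).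
Proof. by rewrite /rot3 mulmx_row_entry. Qed.

Lemma rot_cubic Q K : Q *m Q^T = 1%:M -> cubic K -> cubic (rot3 Q K).
Proof.
move=> QQ cK; split=> [c|c a b|c].
- by rewrite /rot3 !trmx_mul trmxK contr_sym// mulmxA.
- by rewrite !rot_tri triC.
- by rewrite /rot3 mxtrace_mulC mulmxA (mulmx1C QQ) mul1mx contr_tr.
Qed.

Lemma tri_rot Q K u v w : tri (rot3 Q K) u v w = tri K (u *m Q) (v *m Q) (w *m Q).
Proof. by rewrite /tri contr_rot trmx_mul !mulmxA. Qed.

Lemma rot3K Q K : Q *m Q^T = 1%:M -> rot3 Q^T (rot3 Q K) = K.
Proof.
move=> QQ; have QtQ := mulmx1C QQ; apply/funext => a.
rewrite /rot3 contr_rot trmxK -row_mul QtQ row1 contr_delta !mulmxA QtQ mul1mx.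
by rewrite -mulmxA QtQ mulmx1.
Qed.

Lemma dot_rot Q v w : Q *m Q^T = 1%:M -> dot (v *m Q) (w *m Q) = dot v w.
Proof. by move=> QQ; rewrite /dot trmx_mul mulmxA -(mulmxA v) QQ mulmx1. Qed.

Lemma sqr_coord_le v k : v 0 k ^+ 2 <= dot v v.
Proof.
rewrite dotE -!expr2; have := sqr_ge0 (v 0 i0); have := sqr_ge0 (v 0 i1).
have := sqr_ge0 (v 0 i2); elim/ord3P: k; lra.
Qed.

Lemma smx_id : smx [set: 'rV[R]_3] (fun v : 'rV[R]_3 => v).
Proof.
move=> a k; rewrite ord1; apply/smooth_Ck => -[//|m] /=; split=> [u _|i].
  exact: differentiable_coord.
have -> : partial i (fun v : 'rV[R]_3 => v 0 k) = cst ((delta_mx 0 i : 'rV[R]_3) 0 k).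
  apply/funext => v; rewrite -(@partial_coordinate _ _ _ id)//.
  by rewrite /partial derive_id.
exact: Ck_cst.
Qed.

Lemma smx_contr K : smx [set: 'rV[R]_3] (contr K).
Proof.
apply: smx_sum => [|c]; first exact: openT.
by apply: smxZ; [exact: openT|exact: smx_id|exact: smx_cst].
Qed.

Lemma smooth_tri K : smooth_on [set: 'rV[R]_3] (fun v => tri K v v v).
Proof.
have oT := @openT 'rV[R]_3.
have := smxM oT (smxM oT smx_id (smx_contr K)) (smxT oT smx_id).
by move=> /(_ 0 0).
Qed.

Lemma smooth_quadratic (A : 'M[R]_3) :
  smooth_on [set: 'rV[R]_3] (fun v => (v *m A *m v^T) 0 0).
Proof.
have oT := @openT 'rV[R]_3.
have := smxM oT (smxM oT smx_id (smx_cst (U := [set: 'rV[R]_3]) A)) (smxT oT smx_id).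
by move=> /(_ 0 0).
Qed.

Lemma smooth_continuous (g : 'rV[R]_3 -> R) : smooth_on [set: 'rV[R]_3] g -> continuous g.
Proof. by move=> sg v; apply: differentiable_continuous; exact: sm_diff sg _. Qed.

(** One statement for two uses: [n = 0] gives the unit sphere, a nonzero [n] the great circle
    orthogonal to it. Both are compact. *)
Lemma max_on_sphere (g : 'rV[R]_3 -> R) (n : 'rV[R]_3) : smooth_on [set: 'rV[R]_3] g ->
  (exists2 v, dot v v = 1 & dot v n = 0) ->
  exists v, [/\ dot v v = 1, dot v n = 0 &
    forall w, dot w w = 1 -> dot w n = 0 -> g w <= g v].
Proof.
move=> sg [v0 v01 v0n].
pose A : set 'rV[R]_3 := [set v | dot v v = 1 /\ dot v n = 0].
have c1 : continuous (fun v : 'rV[R]_3 => dot v v).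
  have -> : (fun v => dot v v) = (fun v => (v *m 1%:M *m v^T) 0 0).
    by apply/funext => v; rewrite mulmx1.
  by apply: smooth_continuous; exact: smooth_quadratic.
have c2 : continuous (fun v : 'rV[R]_3 => dot v n).
  apply: smooth_continuous; have oT := @openT 'rV[R]_3.
  by have := smxM oT smx_id (smx_cst (U := [set: 'rV[R]_3]) n^T); move=> /(_ 0 0).
have A0 : A !=set0 by exists v0.
have cA : compact A.
  apply: bounded_closed_compact.
    exists 1; split; first exact: num_real.
    move=> M M1 v [vv _]; apply: le_trans (ltW M1).
    apply: norm_le_coord => // k.
    by rewrite -(@expr_le1 _ 2)// real_normK ?num_real// -vv sqr_coord_le.
  have e1 : closed ((fun v => dot v v) @^-1` [set 1]).
    by apply: closed_comp => [v _|]; [exact: c1|exact: closed_eq].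
  have e2 : closed ((fun v => dot v n) @^-1` [set 0]).
    by apply: closed_comp => [v _|]; [exact: c2|exact: closed_eq].
  exact: (closedI e1 e2).
have cg : {within A, continuous g}.
  by apply: continuous_subspaceT; exact: smooth_continuous.
have [c] := @EVT_max_rV R 3 g A A0 cA cg.
move=> /set_mem[d1 d2] H; exists c; split=> // w w1 w2.
by apply: H; apply/mem_set.
Qed.

(** First and second order conditions for a maximum at 0, for polynomials without constant term.
    Degree six is that of the square of a cubic form. *)
Lemma poly_nonpos (a b c d e f : R) :
  (forall t, a * t + b * t ^+ 2 + c * t ^+ 3 + d * t ^+ 4 + e * t ^+ 5 + f * t ^+ 6 <= 0) ->
  a = 0 /\ b <= 0.
Proof.
move=> H; pose M := 1 + (`|c| + `|d| + `|e| + `|f|).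
have M1 : 1 <= M by rewrite /M lerDl !addr_ge0.
have rest t : `|t| <= 1 -> `|c * t ^+ 3 + d * t ^+ 4 + e * t ^+ 5 + f * t ^+ 6| <= M * `|t| ^+ 3.
  move=> t1; have nt : 0 <= `|t| by [].
  have X (r : R) k : `|r * t ^+ (k + 3)| <= `|r| * `|t| ^+ 3.
    rewrite normrM normrX ler_wpM2l// exprD ler_piMl ?exprn_ge0//.
    exact: exprn_ile1.
  apply: le_trans (ler_normD _ _) _; apply: le_trans (lerD (ler_normD _ _) (lexx _)) _.
  apply: le_trans (lerD (lerD (ler_normD _ _) (lexx _)) (lexx _)) _.
  have := X c 0%N; have := X d 1%N; have := X e 2; have := X f 3.
  rewrite /= /M !mulrDl mul1r; have : 0 <= `|t| ^+ 3 by rewrite exprn_ge0.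
  by move=> *; lra.
have b0 : a = 0 -> b <= 0.
  move=> a0; rewrite leNgt; apply/negP => b0.
  (* For this [t] the terms of order three and more amount to at most half of b t^2. *)
  pose t := Num.min 1 (b / (2 * M)).
  have t0 : 0 < t by rewrite lt_min ltr01 divr_gt0// mulr_gt0//; lra.
  have t1 : t <= 1 by rewrite ge_min lexx.
  have tb : t * (2 * M) <= b.
    by rewrite -ler_pdivlMr ?ge_min ?lexx ?orbT// mulr_gt0//; lra.
  have := H t; have := rest t; rewrite gtr0_norm// a0 => /(_ t1).
  rewrite ler_norml => /andP[+ _].
  have t2 : 0 < t ^+ 2 by rewrite exprn_gt0.
  have : M * t ^+ 3 = t ^+ 2 * (t * M) by ring.
  have : t ^+ 2 * (t * (2 * M)) <= t ^+ 2 * b by rewrite ler_pM2l.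
  have : 0 < t ^+ 2 * b by rewrite mulr_gt0.
  have -> : t ^+ 2 * (t * (2 * M)) = 2 * (t ^+ 2 * (t * M)) by ring.
  by rewrite [b * _]mulrC; lra.
suff a0 : a = 0 by split=> //; exact: b0.
apply/eqP; apply: contraT => an0; exfalso.
have na : 0 < `|a| by rewrite normr_gt0.
pose M2 := M + `|b|.
have M20 : 0 < M2 by rewrite ltr_wpDr//; lra.
pose r := Num.min 1 (`|a| / (2 * M2)).
have r0 : 0 < r by rewrite lt_min ltr01 divr_gt0// mulr_gt0.
have r1 : r <= 1 by rewrite ge_min lexx.
have ra : r * (2 * M2) <= `|a|.
  by rewrite -ler_pdivlMr ?ge_min ?lexx ?orbT// mulr_gt0.
pose t := Num.sg a * r.
have tn : `|t| = r by rewrite normrM normr_sg an0 mul1r gtr0_norm.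
have at_ : a * t = `|a| * r by rewrite /t mulrA [a * _]mulrC -normrEsg.
have := H t; have := rest t; rewrite tn => /(_ r1).
rewrite ler_norml => /andP[+ _]; rewrite at_.
have bt : - (`|b| * r ^+ 2) <= b * t ^+ 2.
  have -> : r ^+ 2 = t ^+ 2 by rewrite -tn real_normK// num_real.
  by rewrite -mulNr ler_wpM2r ?sqr_ge0// lerNl; apply: le_trans (ler_norm _) _; rewrite normrN.
have r3 : M * r ^+ 3 <= M * r ^+ 2.
  rewrite ler_wpM2l//; first lra.
  by rewrite exprS ler_piMl// sqr_ge0.
have : r * (r * (2 * M2)) <= r * `|a| by rewrite ler_pM2l.
have -> : r * (r * (2 * M2)) = 2 * (M * r ^+ 2) + 2 * (`|b| * r ^+ 2).
  by rewrite /M2; ring.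
have : 0 < `|a| * r by rewrite mulr_gt0.
by rewrite [r * `|a|]mulrC; lra.
Qed.

(** A form whose contraction with the first basis vector is diagonal, as at a critical vector of
    K(v,v,v) completed by eigenvectors. [p] and [q] are K(e_2,e_2,e_2) and K(e_2,e_2,e_3); the other
    components in that plane are fixed by the trace condition. *)
Definition nf (l1 l2 l3 p q : R) : 'I_3 -> 'M[R]_3 := fun c =>
  nth 0 [:: mx3 l1 0 0 0 l2 0 0 0 l3; mx3 0 l2 0 l2 p q 0 q (- p);
            mx3 0 0 l3 0 q (- p) l3 (- p) (- q)] c.

Lemma tri3E K v : cubic K -> tri K v v v =
  v 0 i0 ^+ 3 * K i0 i0 i0 + v 0 i1 ^+ 3 * K i1 i1 i1 + v 0 i2 ^+ 3 * K i2 i2 i2 +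
  3 * (v 0 i0 ^+ 2 * v 0 i1 * K i0 i0 i1 + v 0 i0 ^+ 2 * v 0 i2 * K i0 i0 i2 +
       v 0 i0 * v 0 i1 ^+ 2 * K i0 i1 i1 + v 0 i0 * v 0 i2 ^+ 2 * K i0 i2 i2 +
       v 0 i1 ^+ 2 * v 0 i2 * K i1 i1 i2 + v 0 i1 * v 0 i2 ^+ 2 * K i1 i2 i2) +
  6 * (v 0 i0 * v 0 i1 * v 0 i2 * K i0 i1 i2).
Proof.
move=> cK; rewrite /tri !mulmx3E !contrE [v^T _ _]mxE [v^T i1 _]mxE [v^T i2 _]mxE.
by rewrite !(cubic_sort cK); ring.
Qed.

Lemma tri_eq0 K : cubic K -> (forall v, tri K v v v = 0) -> forall c, K c = 0.
Proof.
move=> cK H.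
have E a b c := H (rv3 a b c).
(* Ten vectors for the ten coefficients of a ternary cubic form. *)
have := E 1 0 0; have := E 0 1 0; have := E 0 0 1; have := E 1 1 0; have := E 1 (-1) 0.
have := E 1 0 1; have := E 1 0 (-1); have := E 0 1 1; have := E 0 1 (-1); have := E 1 1 1.
rewrite !tri3E// !mxE /=.
move=> h1 h2 h3 h4 h5 h6 h7 h8 h9 h10.
have e0 : K i0 i0 i0 = 0 by lra.
have e1 : K i1 i1 i1 = 0 by lra.
have e2 : K i2 i2 i2 = 0 by lra.
have e3 : K i0 i0 i1 = 0 by lra.
have e4 : K i0 i1 i1 = 0 by lra.
have e5 : K i0 i0 i2 = 0 by lra.
have e6 : K i0 i2 i2 = 0 by lra.
have e7 : K i1 i1 i2 = 0 by lra.
have e8 : K i1 i2 i2 = 0 by lra.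
have e9 : K i0 i1 i2 = 0 by lra.
by elim/ord3P; apply: mx3P; rewrite mxE ?(cubic_sort cK).
Qed.

Lemma nf_of_cubic K l1 l2 l3 p q : cubic K -> K i0 i0 i0 = l1 -> K i0 i0 i1 = 0 ->
  K i0 i0 i2 = 0 -> K i0 i1 i1 = l2 -> K i0 i2 i2 = l3 -> K i0 i1 i2 = 0 ->
  K i1 i1 i1 = p -> K i1 i1 i2 = q -> K = nf l1 l2 l3 p q.
Proof.
move=> cK k1 k2 k3 k4 k5 k6 k7 k8.
have [_ _ tK] := cK; have t1 := tK i1; have t2 := tK i2.
rewrite !trace3 !(cubic_sort cK) k2 k3 k7 k8 in t1 t2.
have k9 : K i1 i2 i2 = - p by lra.
have k10 : K i2 i2 i2 = - q by lra.
apply/funext; elim/ord3P; apply: mx3P; rewrite !mxE /= ?(cubic_sort cK) //.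
Qed.

Lemma cross_dot (a b : 'rV[R]_3) :
  let c := rv3 (a 0 i1 * b 0 i2 - a 0 i2 * b 0 i1) (a 0 i2 * b 0 i0 - a 0 i0 * b 0 i2)
               (a 0 i0 * b 0 i1 - a 0 i1 * b 0 i0) in
  [/\ dot c c = dot a a * dot b b - dot a b ^+ 2, dot a c = 0 & dot b c = 0].
Proof. by split; rewrite !dotE !mxE /=; ring. Qed.

Lemma dotC v w : dot v w = dot w v.
Proof. by rewrite !dotE; ring. Qed.

Lemma orthogonal_unit (a : 'rV[R]_3) : exists2 v, dot v v = 1 & dot v a = 0.
Proof.
have [a0|a0] := eqVneq (a 0 i0) 0.
  by exists (rv3 1 0 0); rewrite dotE !mxE /= ?a0; ring.
have n0 : 0 < a 0 i1 ^+ 2 + a 0 i0 ^+ 2 by rewrite ltr_wpDl ?sqr_ge0 ?exprn_even_gt0.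
have := sqr_sqrtr (ltW n0); set N := Num.sqrt _ => N2.
have N0 : N != 0 by rewrite gt_eqF// sqrtr_gt0.
exists (rv3 (- a 0 i1 / N) (a 0 i0 / N) 0); rewrite dotE !mxE /=; last by ring.
rewrite mul0r addr0 -!expr2 !exprMn sqrrN -mulrDl -N2 exprVn mulfV//.
by rewrite expf_neq0.
Qed.

Lemma orthonormal_frame (a b : 'rV[R]_3) : dot a a = 1 -> dot b b = 1 -> dot b a = 0 ->
  exists Q : 'M[R]_3, [/\ Q *m Q^T = 1%:M, row i0 Q = a & row i1 Q = b].
Proof.
move=> aa bb ba; have [] := cross_dot a b.
set c := rv3 _ _ _; rewrite aa bb (dotC a b) ba => cc ac bc.
pose Q : 'M[R]_3 := \matrix_i nth 0 [:: a; b; c] i.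
have r0 : row i0 Q = a by rewrite rowK.
have r1 : row i1 Q = b by rewrite rowK.
have r2 : row i2 Q = c by rewrite rowK.
exists Q; split=> //.
have E i j : (Q *m Q^T) i j = dot (row i Q) (row j Q).
  by rewrite dotE mulmx3E !mxE.
apply: mx3P; rewrite E ?r0 ?r1 ?r2 mxE /= ?aa ?bb ?cc ?ba ?ac ?bc //.
- by rewrite dotC ba.
- by rewrite dotC ac.
- by rewrite dotC bc.
- by ring.
Qed.

(** The first basis vector maximizes the cubic form on the sphere, the second maximizes the
    quadratic form [contr K a] on the circle orthogonal to it. First order conditions produce the
    zeros of [nf], second order conditions the inequalities. The bound is exported in homogeneous
    form, squared to avoid a square root. *)
Lemma normal_form K : cubic K -> (exists c, K c != 0) ->
  exists Q l1 l2 l3 p q, [/\ Q *m Q^T = 1%:M, 0 < l1, 2 * l2 <= l1, l3 <= l2 &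
    [/\ l1 + l2 + l3 = 0, rot3 Q K = nf l1 l2 l3 p q &
     forall v, tri (nf l1 l2 l3 p q) v v v ^+ 2 <= l1 ^+ 2 * dot v v ^+ 3]].
Proof.
move=> cK [c Kc].
have [a [aa _ amax]] := max_on_sphere (smooth_tri K) (orthogonal_unit 0).
set l1 := tri K a a a in amax.
have triZ r v : tri K (r *: v) (r *: v) (r *: v) = r ^+ 3 * tri K v v v.
  by rewrite !tri3E// !mxE; ring.
have abs w : dot w w = 1 -> `|tri K w w w| <= l1.
  have d0 v : dot v 0 = 0 by rewrite dotE !mxE; ring.
  move=> ww; rewrite ler_norml amax// andbT lerNl.
  have := amax (- w); rewrite -scaleN1r triZ => /(_ _ (d0 _)).
  have -> : dot (-1 *: w) (-1 *: w) = dot w w by rewrite !dotE !mxE; ring.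
  by move=> /(_ ww); lra.
have max v : tri K v v v ^+ 2 <= l1 ^+ 2 * dot v v ^+ 3.
  have dv : 0 <= dot v v by rewrite dotE -!expr2 !addr_ge0 ?sqr_ge0.
  have [v0|v0] := eqVneq (dot v v) 0.
    have z k : v 0 k = 0.
      by apply/eqP; rewrite -sqrf_eq0 eq_le sqr_ge0 andbT -v0 sqr_coord_le.
    by rewrite v0 tri3E// !z !expr0n /= !(mul0r, mulr0, addr0, expr0n).
  have N0 : 0 < Num.sqrt (dot v v) by rewrite sqrtr_gt0 lt0r v0.
  have N2 := sqr_sqrtr dv; set N := Num.sqrt _ in N0 N2; clearbody N.
  have vE : v = N *: (N^-1 *: v) by rewrite scalerA mulfV ?scale1r// gt_eqF.
  have ww : dot (N^-1 *: v) (N^-1 *: v) = 1.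
    have -> : dot (N^-1 *: v) (N^-1 *: v) = N^-1 ^+ 2 * dot v v.
      by rewrite !dotE !mxE; ring.
    by rewrite exprVn N2 mulVf.
  rewrite [in leLHS]vE triZ -N2 exprMn mulrC -!exprM ler_pM2r ?exprn_gt0//.
  by rewrite -real_normK ?num_real// lerXn2r ?nnegrE ?(le_trans _ (abs _ ww))// abs.
have l1_ge0 : 0 <= l1 := le_trans (normr_ge0 _) (abs a aa).
have l1_gt0 : 0 < l1.
  rewrite lt0r l1_ge0 andbT; apply/eqP => l10.
  move/eqP: Kc; apply; apply: tri_eq0 => // v; apply/eqP.
  by rewrite -sqrf_eq0 eq_le sqr_ge0 andbT; have := max v; rewrite l10 expr0n mul0r.
have [b [bb ba bmax]] := max_on_sphere (smooth_quadratic (contr K a)) (orthogonal_unit a).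
have [Q [QQ Q0 Q1]] := orthonormal_frame aa bb ba.
have cL := rot_cubic QQ cK; have [L LQ] : exists L, rot3 Q K = L by exists (rot3 Q K).
rewrite LQ in cL.
have Lmax v : tri L v v v ^+ 2 <= l1 ^+ 2 * dot v v ^+ 3.
  by rewrite -LQ tri_rot -(dot_rot v v QQ) max.
have L000 : L i0 i0 i0 = l1 by rewrite -LQ rot_tri Q0.
pose l2 := L i0 i1 i1; pose l3 := L i0 i2 i2.
have P w : tri L w w w ^+ 2 - l1 ^+ 2 * dot w w ^+ 3 <= 0 by rewrite subr_le0 Lmax.
(* The bound at (1, t, 0) is a polynomial of degree six in [t]; [poly_nonpos] reads off its
   coefficients of order one and two. *)
have [L001 bl2] : 6 * l1 * L i0 i0 i1 = 0 /\
    9 * L i0 i0 i1 ^+ 2 + 6 * l1 * l2 - 3 * l1 ^+ 2 <= 0.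
  pose ga := L i1 i1 i1; pose al := L i0 i0 i1; pose be := l2.
  apply: (@poly_nonpos _ _ (2 * l1 * ga + 18 * al * be)
    (9 * be ^+ 2 + 6 * al * ga - 3 * l1 ^+ 2) (6 * be * ga) (ga ^+ 2 - l1 ^+ 2)) => t.
  apply: (le_trans _ (P (rv3 1 t 0))); rewrite le_eqVlt; apply/orP; left; apply/eqP.
  by rewrite tri3E// dotE !mxE /= L000 /ga /al /be /l2; ring.
have [L002 _] : 6 * l1 * L i0 i0 i2 = 0 /\
    9 * L i0 i0 i2 ^+ 2 + 6 * l1 * l3 - 3 * l1 ^+ 2 <= 0.
  pose ga := L i2 i2 i2; pose al := L i0 i0 i2; pose be := l3.
  apply: (@poly_nonpos _ _ (2 * l1 * ga + 18 * al * be)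
    (9 * be ^+ 2 + 6 * al * ga - 3 * l1 ^+ 2) (6 * be * ga) (ga ^+ 2 - l1 ^+ 2)) => t.
  apply: (le_trans _ (P (rv3 1 0 t))); rewrite le_eqVlt; apply/orP; left; apply/eqP.
  by rewrite tri3E// dotE !mxE /= L000 /ga /al /be /l3; ring.
have six0 : 6 * l1 != 0 by rewrite mulf_neq0// gt_eqF.
have {}L001 : L i0 i0 i1 = 0 by move/eqP: L001; rewrite mulf_eq0 (negbTE six0) => /eqP.
have {}L002 : L i0 i0 i2 = 0 by move/eqP: L002; rewrite mulf_eq0 (negbTE six0) => /eqP.
have {}bl2 : 2 * l2 <= l1.
  rewrite -(ler_pM2l l1_gt0); move: bl2; rewrite L001 expr0n /=.
  by rewrite mulr0 add0r expr2; lra.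
have q3E v : (v *m Q *m contr K a *m (v *m Q)^T) 0 0 =
    v 0 i0 ^+ 2 * l1 + v 0 i1 ^+ 2 * l2 + v 0 i2 ^+ 2 * l3 + 2 * (v 0 i1 * v 0 i2 * L i0 i1 i2).
  have -> : (v *m Q *m contr K a *m (v *m Q)^T) 0 0 = (v *m L i0 *m v^T) 0 0.
    by rewrite -LQ /rot3 Q0 trmx_mul !mulmxA.
  rewrite !mulmx3E [v^T _ _]mxE [v^T i1 _]mxE [v^T i2 _]mxE.
  by rewrite !(cubic_sort cL) L000 L001 L002 /l2 /l3; ring.
have b1 : (b *m contr K a *m b^T) 0 0 = l2.
  have := q3E (delta_mx 0 i1); rewrite -rowE Q1 => ->.
  by rewrite !mxE /=; ring.
(* Maximality of the second vector, tested at the normalized vector (0, 1, t) and cleared of the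
   denominator 1 + t^2. *)
have [L012 l32] : 2 * L i0 i1 i2 = 0 /\ l3 - l2 <= 0.
  apply: (@poly_nonpos _ _ 0 0 0 0) => t.
  have n0 : 0 < 1 + t ^+ 2 by rewrite ltr_wpDr ?sqr_ge0.
  have N0 : 0 < Num.sqrt (1 + t ^+ 2) by rewrite sqrtr_gt0.
  have := sqr_sqrtr (ltW n0); set N := Num.sqrt _ in N0 * => N2.
  pose v := rv3 0 (N^-1) (t / N).
  have vv : dot (v *m Q) (v *m Q) = 1.
    rewrite dot_rot// dotE !mxE /=.
    have -> : 0 * 0 + N^-1 / N + t / N * (t / N) = (1 + t ^+ 2) * N^-1 ^+ 2 by ring.
    by rewrite exprVn N2 mulfV// gt_eqF.
  have va : dot (v *m Q) a = 0.
    rewrite -Q0 rowE dot_rot// dotE !mxE /=; ring.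
  have := bmax _ vv va; rewrite b1 q3E !mxE /= => H.
  have : N ^+ 2 * (l2 / N ^+ 2 + (t / N) ^+ 2 * l3 + 2 * (N^-1 * (t / N) * L i0 i1 i2)) <= N ^+ 2 * l2.
    rewrite ler_pM2l ?exprn_gt0//; apply: le_trans H.
    by rewrite le_eqVlt; apply/orP; left; apply/eqP; rewrite -exprVn; ring.
  have -> : N ^+ 2 * (l2 / N ^+ 2 + (t / N) ^+ 2 * l3 + 2 * (N^-1 * (t / N) * L i0 i1 i2)) =
     l2 + t ^+ 2 * l3 + 2 * (t * L i0 i1 i2) by field; rewrite gt_eqF.
  by rewrite N2; lra.
have {}L012 : L i0 i1 i2 = 0 by lra.
have tr0 : l1 + l2 + l3 = 0.
  by have [_ _ /(_ i0)] := cL; rewrite trace3 L000.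
have LE := nf_of_cubic cL L000 L001 L002 (erefl l2) (erefl l3) L012 erefl erefl.
exists Q, l1, l2, l3, (L i1 i1 i1), (L i1 i1 i2); split=> //; first by lra.
by rewrite LQ; split=> // v; rewrite -LE.
Qed.

End Cubic.

(** * The kernel of the trace pairing between quartic and cubic forms *)

Section NormalFormAlgebra.
Context {R : realType}.

(** The hypotheses are the real and imaginary parts of (b + i c) (u + i v) = 0. *)
Lemma rotation_kernel (b c u v : R) : b * u = c * v -> c * u = - b * v ->
  (u = 0 /\ v = 0) \/ (b = 0 /\ c = 0).
Proof.
move=> e1 e2; have n0 : 0 <= b ^+ 2 by rewrite sqr_ge0.
have n1 : 0 <= c ^+ 2 by rewrite sqr_ge0.
have hu : (b ^+ 2 + c ^+ 2) * u = 0.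
  by rewrite mulrDl !expr2 -!mulrA e1 e2; ring.
have hv : (b ^+ 2 + c ^+ 2) * v = 0.
  have -> : (b ^+ 2 + c ^+ 2) * v = c * (c * v) - b * (- b * v) by ring.
  by rewrite -e1 -e2; ring.
have [z|nz] := eqVneq (b ^+ 2 + c ^+ 2) 0.
  right; move/eqP: z; rewrite paddr_eq0// !sqrf_eq0 => /andP[/eqP-> /eqP->].
  by [].
left; move/eqP: hu; rewrite mulf_eq0 (negbTE nz) => /eqP->.
by move/eqP: hv; rewrite mulf_eq0 (negbTE nz) => /eqP->.
Qed.

(* After rescaling by [A = sqrt r] and [C = sqrt (r - 1)] the system decouples,
   with complex unknowns [(s + i X) + (Y + i Z)] and [(s + i X) - (Y + i Z)]. *)
Lemma quartic_system (r p q s x y z : R) : 1 < r ->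
  2 * (2 - r) * x - p * (2 * r - 1) * s + 2 * q * z = 0 ->
  - 2 * (2 - r) * r * s - p * (2 * r - 1) * x - 2 * q * r * y = 0 ->
  2 * (2 - r) * z - p * (2 * r - 1) * y + 2 * q * (r - 1) * x = 0 ->
  - 2 * (2 - r) * r * y - p * (2 * r - 1) * z - 2 * q * r * (r - 1) * s = 0 ->
  - 2 * (r + 1) * y - q * (2 * r - 1) * s - 2 * p * z = 0 ->
  - 2 * (r + 1) * z - q * (2 * r - 1) * x + 2 * p * r * y = 0 ->
  - 2 * (r + 1) * (r - 1) * s - q * (2 * r - 1) * y - 2 * p * (r - 1) * x = 0 ->
  - 2 * (r + 1) * (r - 1) * x - q * (2 * r - 1) * z + 2 * p * r * (r - 1) * s = 0 ->
  [/\ s = 0, x = 0, y = 0 & z = 0] \/ [/\ r = 5 / 4, p = 0 & q ^+ 2 = 9 / 4].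
Proof.
move=> r1 e1 e2 e3 e4 f1 f2 f3 f4.
have r0 : 0 < r by lra.
have s0 : 0 < r - 1 by lra.
have A0 : Num.sqrt r != 0 by rewrite gt_eqF// sqrtr_gt0.
have C0 : Num.sqrt (r - 1) != 0 by rewrite gt_eqF// sqrtr_gt0.
have := sqr_sqrtr (ltW r0); have := sqr_sqrtr (ltW s0).
move: (Num.sqrt r) (Num.sqrt (r - 1)) A0 C0 => A C A0 C0 C2 A2.
pose X := x / A; pose Y := y / C; pose Z := z / (A * C).
have xE : x = A * X by rewrite /X; field.
have yE : y = C * Y by rewrite /Y; field.
have zE : z = A * C * Z by rewrite /Z; field; rewrite A0 C0.
pose a := 2 * (2 - r) * A; pose b := p * (2 * r - 1); pose c := 2 * q * A * C.
pose d := 2 * (r + 1) * C; pose e := q * (2 * r - 1); pose g := 2 * p * A * C.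
have rE : r = A ^+ 2 by [].
have can (k t : R) : k != 0 -> k * t = 0 -> t = 0.
  by move=> k0 /eqP; rewrite mulf_eq0 (negbTE k0) => /eqP.
have AC0 : A * C != 0 by rewrite mulf_neq0.
have g1 : a * X - b * s + c * Z = 0.
  by rewrite -[RHS]e1 /a /b /c xE zE; ring.
have g2 : a * s + b * X + c * Y = 0.
  apply: (can _ _ A0); have -> : A * (a * s + b * X + c * Y) =
     2 * (2 - r) * A ^+ 2 * s + b * x + 2 * q * A ^+ 2 * y.
    by rewrite /a /c xE yE; ring.
  by rewrite A2 -[RHS]oppr0 -[in RHS]e2 /b; ring.
have g3 : a * Z - b * Y + c * X = 0.
  apply: (can _ _ C0); have -> : C * (a * Z - b * Y + c * X) =
     2 * (2 - r) * z - b * y + 2 * q * C ^+ 2 * x.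
    by rewrite /a /c xE yE zE; ring.
  by rewrite C2 -[RHS]e3 /b; ring.
have g4 : a * Y + b * Z + c * s = 0.
  apply: (can _ _ AC0); have -> : A * C * (a * Y + b * Z + c * s) =
     2 * (2 - r) * A ^+ 2 * y + b * z + 2 * q * A ^+ 2 * C ^+ 2 * s.
    by rewrite /a /c yE zE; ring.
  by rewrite A2 C2 -[RHS]oppr0 -[in RHS]e4 /b; ring.
have h1 : d * Y + e * s + g * Z = 0.
  by rewrite -[RHS]oppr0 -[in RHS]f1 /d /e /g yE zE; ring.
have h2 : d * Z + e * X - g * Y = 0.
  apply: (can _ _ A0); have -> : A * (d * Z + e * X - g * Y) =
     2 * (r + 1) * z + e * x - 2 * p * A ^+ 2 * y.
    by rewrite /d /g xE yE zE; ring.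
  by rewrite A2 -[RHS]oppr0 -[in RHS]f2 /e; ring.
have h3 : d * s + e * Y + g * X = 0.
  apply: (can _ _ C0); have -> : C * (d * s + e * Y + g * X) =
     2 * (r + 1) * C ^+ 2 * s + e * y + 2 * p * C ^+ 2 * x.
    by rewrite /d /g xE yE; ring.
  by rewrite C2 -[RHS]oppr0 -[in RHS]f3 /e; ring.
have h4 : d * X + e * Z - g * s = 0.
  apply: (can _ _ AC0); have -> : A * C * (d * X + e * Z - g * s) =
     2 * (r + 1) * C ^+ 2 * x + e * z - 2 * p * A ^+ 2 * C ^+ 2 * s.
    by rewrite /d /g xE zE; ring.
  by rewrite A2 C2 -[RHS]oppr0 -[in RHS]f4 /e; ring.
(* [t] is 1 or -1 according to which of the two complex unknowns survives. Eliminating [q] and [C]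
   from the two relations leaves r (4 r - 5) = 0. *)
have exceptional (t : R) : b = 0 -> a + t * c = 0 -> d + t * e = 0 -> t ^+ 2 = 1 ->
    [/\ r = 5 / 4, p = 0 & q ^+ 2 = 9 / 4].
  move=> b0 ac de t1.
  have m0 : 2 * r - 1 != 0 by rewrite gt_eqF//; lra.
  have p0 : p = 0.
    by move/eqP: b0; rewrite /b mulf_eq0 (negbTE m0) orbF => /eqP.
  have k1 : 2 - r = - (t * q * C).
    have : 2 * A * ((2 - r) + t * q * C) = 0 by rewrite -[RHS]ac /a /c; ring.
    move/(can _ _ (mulf_neq0 (lt0r_neq0 (@ltr0n R 2)) A0)); lra.
  have k2 : 2 * (r + 1) * C = - (t * q * (2 * r - 1)) by move: de; rewrite /d /e; lra.
  have k3 : (2 - r) * (2 * r - 1) = 2 * (r + 1) * (r - 1).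
    rewrite k1 -C2.
    have -> : - (t * q * C) * (2 * r - 1) = C * - (t * q * (2 * r - 1)) by ring.
    by rewrite -k2; ring.
  have k4 : r * (4 * r - 5) = 0.
    have -> : r * (4 * r - 5) = 2 * (r + 1) * (r - 1) - (2 - r) * (2 * r - 1) by ring.
    by rewrite k3 subrr.
  have r54 : r = 5 / 4.
    by have := can _ _ (lt0r_neq0 r0) k4; lra.
  split=> //.
  have k5 : (2 - r) ^+ 2 = t ^+ 2 * q ^+ 2 * C ^+ 2 by rewrite k1; ring.
  by move: k5; rewrite t1 C2 r54; lra.
have P1 : (s + Y = 0 /\ X + Z = 0) \/ (b = 0 /\ a + c = 0).
  by apply: rotation_kernel; lra.
have P2 : (s + Y = 0 /\ X + Z = 0) \/ (d + e = 0 /\ - g = 0).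
  by apply: rotation_kernel; lra.
have M1 : (s - Y = 0 /\ X - Z = 0) \/ (b = 0 /\ a - c = 0).
  by apply: rotation_kernel; lra.
have M2 : (s - Y = 0 /\ X - Z = 0) \/ (d - e = 0 /\ - g = 0).
  by apply: rotation_kernel; lra.
have [Pz|Pn] : (s + Y = 0 /\ X + Z = 0) \/ ((b = 0 /\ a + c = 0) /\ (d + e = 0 /\ - g = 0)).
  by case: P1 => ?; [left|case: P2 => ?; [left|right]].
- have [Mz|Mn] : (s - Y = 0 /\ X - Z = 0) \/ ((b = 0 /\ a - c = 0) /\ (d - e = 0 /\ - g = 0)).
    by case: M1 => ?; [left|case: M2 => ?; [left|right]].
  + left; have [m1 m2] := Mz; have [q1 q2] := Pz.
    have Xz : X = 0 by lra.
    have Yz : Y = 0 by lra.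
    have Zz : Z = 0 by lra.
    by rewrite xE yE zE Xz Yz Zz !mulr0; split=> //; lra.
  + right; have [[bz acz] [dez _]] := Mn.
    by apply: (exceptional (- 1)) => //; rewrite ?mulN1r ?sqrrN ?expr1n.
- right; have [[bz acz] [dez _]] := Pn.
  by apply: (exceptional 1) => //; rewrite ?mul1r ?expr1n.
Qed.

Definition quartic (S : 'I_3 -> 'I_3 -> 'M[R]_3) := [/\ forall m i, S m i = S i m,
  forall m i, (S m i)^T = S m i, forall m i a b, S m i a b = S m a i b &
  forall m i, \tr (S m i) = 0].

Section Quartic.
Variable S : 'I_3 -> 'I_3 -> 'M[R]_3.
Hypothesis qS : quartic S.

Lemma quartic_sort : ((S i1 i0 = S i0 i1) * (S i2 i0 = S i0 i2) * (S i2 i1 = S i1 i2)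
  * (forall m b, S m i1 i0 b = S m i0 i1 b) * (forall m b, S m i2 i0 b = S m i0 i2 b)
  * (forall m b, S m i2 i1 b = S m i1 i2 b)
  * (forall m i, S m i i1 i0 = S m i i0 i1) * (forall m i, S m i i2 i0 = S m i i0 i2)
  * (forall m i, S m i i2 i1 = S m i i1 i2))%type.
Proof.
have [c t w _] := qS.
have t' m i a b : S m i a b = S m i b a.
  by have /matrixP/(_ b a) := t m i; rewrite mxE.
do !split.
- exact: c.
- exact: c.
- exact: c.
- by move=> m b; exact: w.
- by move=> m b; exact: w.
- by move=> m b; exact: w.
- by move=> m i; exact: t'.
- by move=> m i; exact: t'.
- by move=> m i; exact: t'.
Qed.

(** Trace free quartic forms in three variables have dimension nine, and the listed components are
    coordinates: the six traces determine the other six of the fifteen components. *)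
Lemma quartic_eq0 : S i0 i0 i0 i0 = 0 -> S i0 i0 i0 i1 = 0 -> S i0 i0 i0 i2 = 0 ->
  S i0 i0 i1 i1 = 0 -> S i0 i0 i1 i2 = 0 -> S i0 i1 i1 i1 = 0 -> S i0 i1 i1 i2 = 0 ->
  S i1 i1 i1 i1 = 0 -> S i1 i1 i1 i2 = 0 -> forall m i, S m i = 0.
Proof.
have [_ _ _ tr] := qS; move=> z1 z2 z3 z4 z5 z6 z7 z8 z9.
have T m i := tr m i.
have := T i0 i0; have := T i0 i1; have := T i0 i2; have := T i1 i1; have := T i1 i2.
have := T i2 i2.
rewrite !trace3 !quartic_sort z1 z2 z3 z4 z5 z6 z7 z8 z9 => t1 t2 t3 t4 t5 t6.
have z10 : S i0 i0 i2 i2 = 0 by lra.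
have z11 : S i0 i1 i2 i2 = 0 by lra.
have z12 : S i0 i2 i2 i2 = 0 by lra.
have z13 : S i1 i1 i2 i2 = 0 by lra.
have z14 : S i1 i2 i2 i2 = 0 by lra.
have z15 : S i2 i2 i2 i2 = 0 by lra.
by elim/ord3P; elim/ord3P; apply: mx3P; rewrite mxE ?quartic_sort.
Qed.

(** If l2 = l3, [E0] and the trace condition force S_00 = 0, and the rest is a rotation system with
    coefficients [p] and [q], which degenerates only when both vanish. Otherwise they express S_11
    and S_22 through S_00; four unknowns are left, subject to the eight equations of
    [quartic_system], whose exceptional solution contradicts maximality. *)
Lemma quartic_kernel l1 l2 l3 p q : 0 < l1 -> 2 * l2 <= l1 -> l3 <= l2 ->
  l1 + l2 + l3 = 0 ->
  (forall v, tri (nf l1 l2 l3 p q) v v v ^+ 2 <= l1 ^+ 2 * dot v v ^+ 3) ->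
  cubic (nf l1 l2 l3 p q) ->
  (forall m i j, \tr (S m i *m nf l1 l2 l3 p q j) = 0) ->
  (forall m i, S m i = 0) \/ [/\ l2 = l3, p = 0 & q = 0].
Proof.
move=> l10 l21 l32 sum0 max cN SK; have [_ _ _ tr] := qS.
have E0 m i : l1 * S m i i0 i0 + l2 * S m i i1 i1 + l3 * S m i i2 i2 = 0.
  by have := SK m i i0; rewrite trace3 !mulmx3E !mxE /=; lra.
have E1 m i : 2 * l2 * S m i i0 i1 + p * (S m i i1 i1 - S m i i2 i2) + 2 * q * S m i i1 i2 = 0.
  by have := SK m i i1; rewrite trace3 !mulmx3E !mxE /= !quartic_sort; lra.
have E2 m i : 2 * l3 * S m i i0 i2 + q * (S m i i1 i1 - S m i i2 i2) - 2 * p * S m i i1 i2 = 0.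
  by have := SK m i i2; rewrite trace3 !mulmx3E !mxE /= !quartic_sort; lra.
have T m i : S m i i0 i0 + S m i i1 i1 + S m i i2 i2 = 0 by rewrite -trace3.
have can (k t : R) : k != 0 -> k * t = 0 -> t = 0.
  by move=> k0 /eqP; rewrite mulf_eq0 (negbTE k0) => /eqP.
have [l23|l23] := eqVneq l2 l3.
  have l20 : l2 < 0 by lra.
  have S00 m i : S m i i0 i0 = 0.
    apply: (can (l1 - l2)); first by rewrite gt_eqF//; lra.
    have := E0 m i; rewrite -l23.
    have -> : l1 * S m i i0 i0 + l2 * S m i i1 i1 + l2 * S m i i2 i2 = (l1 - l2) * S m i i0 i0 +
      l2 * (S m i i0 i0 + S m i i1 i1 + S m i i2 i2) by ring.
    by rewrite T mulr0 addr0.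
  have S22 m i : S m i i2 i2 = - S m i i1 i1 by have := T m i; rewrite S00; lra.
  have F1 m i : l2 * S m i i0 i1 + p * S m i i1 i1 + q * S m i i1 i2 = 0.
    by have := E1 m i; rewrite S22; lra.
  have F2 m i : l2 * S m i i0 i2 + q * S m i i1 i1 - p * S m i i1 i2 = 0.
    by have := E2 m i; rewrite S22 -l23; lra.
  have z1 := S00 i0 i0; have z2 := S00 i0 i1; have z3 := S00 i0 i2.
  have z4 := S00 i1 i1; have z5 := S00 i1 i2.
  rewrite !quartic_sort in z2 z3 z4 z5.
  have [pq0|pq0] := eqVneq (p ^+ 2 + q ^+ 2) 0.
    right; move/eqP: pq0; rewrite paddr_eq0 ?sqr_ge0// !sqrf_eq0.
    by move=> /andP[/eqP-> /eqP->].
  left.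
  have solve al be : p * al + q * be = 0 -> q * al - p * be = 0 -> al = 0 /\ be = 0.
    move=> g1 g2; split; apply: (can _ _ pq0).
      have -> : (p ^+ 2 + q ^+ 2) * al = p * (p * al + q * be) + q * (q * al - p * be) by ring.
      by rewrite g1 g2 !mulr0 addr0.
    have -> : (p ^+ 2 + q ^+ 2) * be = q * (p * al + q * be) - p * (q * al - p * be) by ring.
    by rewrite g1 g2 !mulr0 subr0.
  have [z6 z7] : S i0 i1 i1 i1 = 0 /\ S i0 i1 i1 i2 = 0.
    have := F1 i0 i1; have := F2 i0 i1; rewrite !quartic_sort z4 z5 => g1 g2.
    by apply: solve; lra.
  have [z8 z9] : S i1 i1 i1 i1 = 0 /\ S i1 i1 i1 i2 = 0.
    have := F1 i1 i1; have := F2 i1 i1; rewrite !quartic_sort z6 z7 => g1 g2.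
    by apply: solve; lra.
  exact: quartic_eq0.
have [D [DE D0]] : exists D, l2 - l3 = D /\ 0 < D.
  by exists (l2 - l3); split=> //; rewrite subr_gt0 lt_neqAle l32 eq_sym l23.
have Dn : D != 0 by rewrite gt_eqF.
(* Scale invariant parameters: since the eigenvalues sum to zero, l2 = (2 - r) D / 3 and l3 = - (r +
   1) D / 3, and D / 3 factors out of every equation. *)
pose r := (l1 - l3) / D; pose P := 3 * p / D; pose Q := 3 * q / D.
have rD : r * D = l1 - l3 by rewrite /r divfK.
have l2E : l2 = (2 - r) * (D / 3) by move: rD; rewrite !mulrBl; lra.
have l3E : l3 = - (r + 1) * (D / 3) by move: rD; lra.
have pE : p = P * (D / 3) by rewrite /P; field.
have qE : q = Q * (D / 3) by rewrite /Q; field.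
have r1 : 1 < r by rewrite /r ltr_pdivlMr// mul1r; lra.
have A1 m i : S m i i1 i1 = - r * S m i i0 i0.
  have -> : S m i i1 i1 = - ((l1 - l3) * S m i i0 i0) / D.
    apply: (mulIf Dn); rewrite divfK// -DE.
    have := E0 m i; have -> : S m i i2 i2 = - S m i i0 i0 - S m i i1 i1 by have := T m i; lra.
    by lra.
  by rewrite /r; field.
have A2 m i : S m i i2 i2 = (r - 1) * S m i i0 i0.
  by have := T m i; rewrite A1; lra.
have b1 := A1 i0 i0; have b2 := A1 i0 i1; have b3 := A1 i0 i2; have b4 := A1 i1 i2.
have b5 := A1 i1 i1; have c1 := A2 i0 i0; have c2 := A2 i0 i1; have c3 := A2 i0 i2.
have c4 := A2 i1 i2; have c5 := A2 i1 i1.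
rewrite !quartic_sort in b1 b2 b3 b4 b5 c1 c2 c3 c4 c5.
rewrite b1 in b5 c5.
have e1 := E1 i0 i0; have e2 := E1 i0 i1; have e3 := E1 i0 i2; have e4 := E1 i1 i2.
have f1 := E2 i0 i0; have f2 := E2 i0 i1; have f3 := E2 i0 i2; have f4 := E2 i1 i2.
rewrite !quartic_sort in e1 e2 e3 e4 f1 f2 f3 f4.
rewrite ?b1 ?b2 ?b3 ?b4 ?b5 ?c1 ?c2 ?c3 ?c4 ?c5 in e1 e2 e3 e4 f1 f2 f3 f4.
clear E0 E1 E2 A1 A2 T SK.
clearbody r P Q.
have D3 : D / 3 != 0 by rewrite mulf_neq0.
rewrite ?l2E ?l3E ?pE ?qE in e1 e2 e3 e4 f1 f2 f3 f4.
set s := S i0 i0 i0 i0 in b1 b5 c1 c5 e1 e2 e3 e4 f1 f2 f3 f4.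
set x := S i0 i0 i0 i1 in b2 c2 e1 e2 e3 e4 f1 f2 f3 f4.
set y := S i0 i0 i0 i2 in b3 c3 e1 e2 e3 e4 f1 f2 f3 f4.
set z := S i0 i0 i1 i2 in b4 c4 e1 e2 e3 e4 f1 f2 f3 f4.
have := @quartic_system r P Q s x y z r1.
case.
- by apply: (can _ _ D3); rewrite -[RHS]e1; ring.
- by apply: (can _ _ D3); rewrite -[RHS]e2; ring.
- by apply: (can _ _ D3); rewrite -[RHS]e3; ring.
- by apply: (can _ _ D3); rewrite -[RHS]e4; ring.
- by apply: (can _ _ D3); rewrite -[RHS]f1; ring.
- by apply: (can _ _ D3); rewrite -[RHS]f2; ring.
- by apply: (can _ _ D3); rewrite -[RHS]f3; ring.
- by apply: (can _ _ D3); rewrite -[RHS]f4; ring.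
- move=> [sz xz yz zz]; left; apply: quartic_eq0 => //.
  + by rewrite b1 sz mulr0.
  + by rewrite b2 xz mulr0.
  + by rewrite b3 yz mulr0.
  + by rewrite b5 sz !mulr0.
  + by rewrite b4 zz mulr0.
move=> [r54 P0 Q2]; exfalso.
have l1E : l1 = D / 2 by move: sum0; rewrite l2E l3E r54; lra.
have q2 : q ^+ 2 = l1 ^+ 2 by rewrite qE exprMn Q2 l1E; field.
have l3l : l3 = - (3 / 2) * l1 by rewrite l3E r54 l1E; field.
(* The exceptional solution is an axial form seen from a critical vector off its axis, and one of
   these two vectors, depending on the sign of [q], points along the axis. There the cubic form is
   25 l1, while its square may not exceed 125 l1^2. *)
have m1 := max (rv3 (-1) 0 2); have m2 := max (rv3 (-1) 0 (-2)).
rewrite !tri3E// !dotE !mxE /= l3l in m1 m2.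
have q20 : 0 < l1 ^+ 2 by rewrite exprn_gt0.
have : l1 ^+ 2 = q ^+ 2 by [].
by move: q2; rewrite !expr2; nra.
Qed.

End Quartic.
End NormalFormAlgebra.

(** * Pointwise alternatives for the cubic form *)

Section Pointwise.
Context {R : realType}.
Implicit Types (K : 'I_3 -> 'M[R]_3) (u v w : 'rV[R]_3) (Q : 'M[R]_3).

(** The curvature matrix prescribed by the Gauss equation, for a single cubic form instead of a
    field. *)
Definition gauss_curv (H : R) K a b : 'M[R]_3 := K a *m K b - K b *m K a
  - H *: ((delta_mx 0 a : 'rV[R]_3)^T *m (delta_mx 0 b : 'rV_3) -
          (delta_mx 0 b : 'rV[R]_3)^T *m (delta_mx 0 a : 'rV_3)).

Definition curvature_invariant (H : R) K := forall a b c,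
  gauss_curv H K a b *m K c - K c *m gauss_curv H K a b
  + \sum_d gauss_curv H K a b c d *: K d = 0.

Lemma gauss_curv_nf01 H l1 l2 l3 p q :
  gauss_curv H (nf l1 l2 l3 p q) i0 i1 = let m := l1 * l2 - l2 ^+ 2 - H in
    mx3 0 m 0 (- m) 0 (q * (l2 - l3)) 0 (- (q * (l2 - l3))) 0.
Proof. by apply: mx3P; rewrite /gauss_curv !mxE !sum3 !mxE !big_ord1 !mxE /=; ring. Qed.

Lemma gauss_curv_nf02 H l1 l2 l3 p q :
  gauss_curv H (nf l1 l2 l3 p q) i0 i2 = let m := l1 * l3 - l3 ^+ 2 - H in
    mx3 0 0 m 0 0 (- (p * (l2 - l3))) (- m) (p * (l2 - l3)) 0.
Proof. by apply: mx3P; rewrite /gauss_curv !mxE !sum3 !mxE !big_ord1 !mxE /=; ring. Qed.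

Lemma gauss_curv_nf12 H l1 l2 l3 p q :
  gauss_curv H (nf l1 l2 l3 p q) i1 i2 = let m := l2 * l3 - 2 * (p ^+ 2 + q ^+ 2) - H in
    mx3 0 (q * (l2 - l3)) (- (p * (l2 - l3))) (- (q * (l2 - l3))) 0 m
        (p * (l2 - l3)) (- m) 0.
Proof. by apply: mx3P; rewrite /gauss_curv !mxE !sum3 !mxE !big_ord1 !mxE /=; ring. Qed.

(* The case [2 * l2 = l1] is excluded by maximality, at the vectors
   [(-1, 0, 2)] and [(-1, 0, -2)]. *)
Lemma curvature_invariant_nf H l1 l2 l3 p q : 0 < l1 -> 2 * l2 <= l1 -> l3 <= l2 ->
  l1 + l2 + l3 = 0 ->
  (forall v, tri (nf l1 l2 l3 p q) v v v ^+ 2 <= l1 ^+ 2 * dot v v ^+ 3) ->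
  cubic (nf l1 l2 l3 p q) -> curvature_invariant H (nf l1 l2 l3 p q) ->
  [/\ l2 = - (l1 / 2), l3 = - (l1 / 2), H = - (3 / 4) * l1 ^+ 2 &
   (p = 0 /\ q = 0) \/ 2 * (p ^+ 2 + q ^+ 2) = l1 ^+ 2].
Proof.
move=> l10 l21 l32 sum0 max cN HB.
have can (k t : R) : k != 0 -> k * t = 0 -> t = 0.
  by move=> k0 /eqP; rewrite mulf_eq0 (negbTE k0) => /eqP.
have E01 c r s : (gauss_curv H (nf l1 l2 l3 p q) i0 i1 *m nf l1 l2 l3 p q c
   - nf l1 l2 l3 p q c *m gauss_curv H (nf l1 l2 l3 p q) i0 i1
   + \sum_d gauss_curv H (nf l1 l2 l3 p q) i0 i1 c d *: nf l1 l2 l3 p q d) r s = 0.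
  by rewrite HB mxE.
have E02 c r s : (gauss_curv H (nf l1 l2 l3 p q) i0 i2 *m nf l1 l2 l3 p q c
   - nf l1 l2 l3 p q c *m gauss_curv H (nf l1 l2 l3 p q) i0 i2
   + \sum_d gauss_curv H (nf l1 l2 l3 p q) i0 i2 c d *: nf l1 l2 l3 p q d) r s = 0.
  by rewrite HB mxE.
have E12 c r s : (gauss_curv H (nf l1 l2 l3 p q) i1 i2 *m nf l1 l2 l3 p q c
   - nf l1 l2 l3 p q c *m gauss_curv H (nf l1 l2 l3 p q) i1 i2
   + \sum_d gauss_curv H (nf l1 l2 l3 p q) i1 i2 c d *: nf l1 l2 l3 p q d) r s = 0.
  by rewrite HB mxE.
have R2 : (l1 * l2 - l2 ^+ 2 - H) * (2 * l2 - l1) = 0.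
  by rewrite -(E01 i0 i0 i1) gauss_curv_nf01 sum3 !mxE !sum3 !mxE /=; ring.
have R3 : (2 * l3 - l1) * (l1 * l3 - l3 ^+ 2 - H) = 0.
  by rewrite -(E02 i0 i0 i2) gauss_curv_nf02 sum3 !mxE !sum3 !mxE /=; ring.
have {}R3 : H = l1 * l3 - l3 ^+ 2.
  have n : 2 * l3 - l1 != 0 by rewrite lt_eqF//; lra.
  by have := can _ _ n R3; lra.
have S1 := E01 i0 i2 i2; have S2 := E01 i1 i1 i1.
rewrite gauss_curv_nf01 sum3 !mxE !sum3 !mxE /= in S1 S2.
have S3 := E12 i1 i1 i1; have S4 := E12 i1 i1 i2.
rewrite gauss_curv_nf12 sum3 !mxE !sum3 !mxE /= in S3 S4.
clear E01 E02 E12 HB.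
have [l2h|l2h] := eqVneq (2 * l2 - l1) 0.
  exfalso.
  have l2E : l2 = l1 / 2 by lra.
  have l3E : l3 = - (3 / 2) * l1 by lra.
  have HE : H = - (15 / 4) * l1 ^+ 2 by rewrite R3 l3E; field.
  have p0 : p = 0.
    apply: (can (l1 ^+ 2)); first by rewrite expf_neq0// gt_eqF.
    by move: S1; rewrite l2E l3E HE; lra.
  have q2 : q ^+ 2 = l1 ^+ 2.
    have n : l1 != 0 by rewrite gt_eqF.
    have : l1 * (q ^+ 2 - l1 ^+ 2) = 0 by move: S2; rewrite l2E l3E HE; lra.
    by move/(can _ _ n) => ?; lra.
  have m1 := max (rv3 (-1) 0 2); have m2 := max (rv3 (-1) 0 (-2)).
  rewrite !tri3E// !dotE !mxE /= l3E in m1 m2.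
  have q20 : 0 < l1 ^+ 2 by rewrite exprn_gt0.
  by move: q2; rewrite !expr2; nra.
have {}R2 : H = l1 * l2 - l2 ^+ 2.
  have R2' : (2 * l2 - l1) * (l1 * l2 - l2 ^+ 2 - H) = 0 by rewrite mulrC.
  by have := can _ _ l2h R2'; lra.
have l23 : l2 = l3.
  have n : l1 - l2 - l3 != 0 by rewrite gt_eqF//; lra.
  have : (l1 - l2 - l3) * (l2 - l3) = 0 by move: R2; rewrite R3; lra.
  by move/(can _ _ n); lra.
have l2E : l2 = - (l1 / 2) by lra.
have l3E : l3 = - (l1 / 2) by lra.
have HE : H = - (3 / 4) * l1 ^+ 2 by rewrite R3 l3E; field.
split=> //.
(* This is the curvature of the plane of the last two basis vectors, the only plane where it may
   still be nonzero. If it is, invariance under rotations of that plane kills [p] and [q]. *)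
have [m0|m0] := eqVneq (l1 ^+ 2 - 2 * (p ^+ 2 + q ^+ 2)) 0; first by right; lra.
left; split; apply: (can _ _ m0).
  by move: S4; rewrite l2E l3E HE; lra.
by move: S3; rewrite l2E l3E HE; lra.
Qed.

(** The curvature as an alternating function of two vectors, followed by the derivation through
    which a matrix acts on [K]. In these terms, invariance under a change of orthonormal basis is a
    computation without indices. *)
Let GV (H : R) K u v : 'M[R]_3 := contr K u *m contr K v - contr K v *m contr K u
  - H *: (u^T *m v - v^T *m u).

Let action K (X : 'M[R]_3) w : 'M[R]_3 :=
  X *m contr K w - contr K w *m X + contr K (w *m X).

Let action_sum K w (I : finType) (x : I -> R) (F : I -> 'M[R]_3) :
  action K (\sum_i x i *: F i) w = \sum_i x i *: action K (F i) w.
Proof.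
rewrite /action [w *m _]mulmx_sumr contr_sum.
have -> : \sum_i contr K (w *m (x i *: F i)) = \sum_i x i *: contr K (w *m F i).
  by apply: eq_bigr => i _; rewrite -scalemxAr contrZ.
move: (contr K w) (fun i => contr K (w *m F i)) => C D.
rewrite mulmx_suml mulmx_sumr -sumrB -big_split /=; apply: eq_bigr => i _.
by rewrite -scalemxAl -scalemxAr -scalerBr -scalerDr.
Qed.

Let action_sumr K X (I : finType) (x : I -> R) (F : I -> 'rV[R]_3) :
  action K X (\sum_i x i *: F i) = \sum_i x i *: action K X (F i).
Proof.
rewrite /action [_ *m X in X in _ + X]mulmx_suml !contr_sum.
have -> : \sum_i contr K (x i *: F i *m X) = \sum_i x i *: contr K (F i *m X).
  by apply: eq_bigr => i _; rewrite -scalemxAl contrZ.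
have -> : \sum_i contr K (x i *: F i) = \sum_i x i *: contr K (F i).
  by apply: eq_bigr => i _; rewrite contrZ.
move: (fun i => contr K (F i)) (fun i => contr K (F i *m X)) => C D.
rewrite mulmx_suml mulmx_sumr -sumrB -big_split /=; apply: eq_bigr => i _.
by rewrite -scalemxAl -scalemxAr -scalerBr -scalerDr.
Qed.

Let GV_sum H K u v : GV H K u v = \sum_a \sum_b (u 0 a * v 0 b) *: gauss_curv H K a b.
Proof.
have row_sum w : w = \sum_a w 0 a *: delta_mx 0 a by exact: row_sum_delta.
have rowT_sum w : w^T = \sum_a w 0 a *: (delta_mx 0 a : 'rV[R]_3)^T.
  by rewrite {1}(row_sum w) linear_sum; apply: eq_bigr => a _; rewrite linearZ.
have swap (F : 'I_3 -> 'I_3 -> 'M[R]_3) : \sum_b \sum_a (v 0 b * u 0 a) *: F b a =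
   \sum_a \sum_b (u 0 a * v 0 b) *: F b a.
  rewrite exchange_big /=; apply: eq_bigr => a' _; apply: eq_bigr => b' _.
  by rewrite mulrC.
have E1 w w' : w^T *m w' = \sum_a \sum_b (w 0 a * w' 0 b) *:
    ((delta_mx 0 a : 'rV[R]_3)^T *m (delta_mx 0 b : 'rV_3)).
  by rewrite {1}(rowT_sum w) {1}(row_sum w') mulmx_sum2.
rewrite /GV !E1 /contr !mulmx_sum2 (swap (fun b a => K b *m K a)).
rewrite (swap (fun b a => (delta_mx 0 b : 'rV_3)^T *m (delta_mx 0 a : 'rV_3))).
rewrite -!sumrB scaler_sumr -sumrB; apply: eq_bigr => a _.
rewrite -!sumrB scaler_sumr -sumrB; apply: eq_bigr => b _.
rewrite /gauss_curv; move: (K a *m _) (K b *m _) (_^T *m _) (_^T *m _) => x y z w.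
by apply/matrixP => r s; rewrite !mxE; ring.
Qed.

Let action_GV H K : curvature_invariant H K -> forall u v w, action K (GV H K u v) w = 0.
Proof.
move=> HK u v w; rewrite GV_sum.
have -> : \sum_a \sum_b (u 0 a * v 0 b) *: gauss_curv H K a b =
   \sum_a u 0 a *: \sum_b v 0 b *: gauss_curv H K a b.
  apply: eq_bigr => a _; rewrite scaler_sumr; apply: eq_bigr => b _.
  by rewrite scalerA.
rewrite action_sum big1// => a _; rewrite action_sum big1 ?scaler0// => b _.
rewrite {1}(row_sum_delta w) action_sumr big1 ?scaler0// => c _.
by rewrite /action contr_delta -rowE /contr; under eq_bigr do rewrite mxE; rewrite HK scaler0.
Qed.

Lemma rot_curvature_invariant H K Q : Q *m Q^T = 1%:M ->
  curvature_invariant H K -> curvature_invariant H (rot3 Q K).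
Proof.
move=> QQ HK a b c; have QtQ := mulmx1C QQ.
have G : gauss_curv H (rot3 Q K) a b = Q *m GV H K (row a Q) (row b Q) *m Q^T.
  rewrite /gauss_curv /GV /rot3 !rowE.
  rewrite mulmxBr mulmxBl -scalemxAr -scalemxAl !mulmxBr !mulmxBl !trmx_mul !mulmxA QQ !mul1mx.
  rewrite -!(mulmxA _ Q Q^T) QQ !mulmx1.
  have E X Y : Q *m X *m Q^T *m Q *m Y *m Q^T = Q *m X *m Y *m Q^T.
    by rewrite -(mulmxA (Q *m X)) QtQ mulmx1.
  by rewrite !E.
have := action_GV HK (row a Q) (row b Q) (row c Q).
move: (GV H K _ _) G => X G E; rewrite G.
have -> : \sum_d (Q *m X *m Q^T) c d *: rot3 Q K d = contr (rot3 Q K) (row c (Q *m X *m Q^T)).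
  by rewrite /contr; apply: eq_bigr => d _; rewrite [in RHS]mxE.
rewrite contr_rot !row_mul -(mulmxA _ Q^T Q) QtQ mulmx1 /rot3.
have E1 Y Z : Q *m Y *m Q^T *m (Q *m Z *m Q^T) = Q *m (Y *m Z) *m Q^T.
  by rewrite !mulmxA -(mulmxA (Q *m Y)) QtQ mulmx1.
rewrite !E1 -mulmxBl -mulmxDl -mulmxBr -mulmxDr.
by move: E; rewrite /action => ->; rewrite mulmx0 mul0mx.
Qed.

(** The cubic form obtained by inserting [u] into one argument of the quartic form; it reduces
    changes of basis for [S] to those for cubic forms. *)
Let slice (S : 'I_3 -> 'I_3 -> 'M[R]_3) u c : 'M[R]_3 := contr (S^~ c) u.

Let slice_cubic S u : quartic S -> cubic (slice S u).
Proof.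
move=> [_ tS wS trS].
have E c a b : slice S u c a b = u 0 i0 * S i0 c a b + u 0 i1 * S i1 c a b + u 0 i2 * S i2 c a b.
  exact: (contrE (S^~ c) u a b).
move: (slice S u) E => X E.
split=> [c|c a b|c].
- apply/matrixP => a b.
  have t m : S m c b a = S m c a b.
    by rewrite -[in LHS](tS m c) mxE.
  by rewrite mxE !E (t i0) (t i1) (t i2).
- by rewrite !E (wS i0) (wS i1) (wS i2).
- have t m : S m c i0 i0 + S m c i1 i1 + S m c i2 i2 = 0 by rewrite -trace3.
  rewrite trace3 !E.
  transitivity (u 0 i0 * (S i0 c i0 i0 + S i0 c i1 i1 + S i0 c i2 i2) +
    u 0 i1 * (S i1 c i0 i0 + S i1 c i1 i1 + S i1 c i2 i2) +
    u 0 i2 * (S i2 c i0 i0 + S i2 c i1 i1 + S i2 c i2 i2)); first by ring.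
  by rewrite !t !mulr0 !addr0.
Qed.

Let rotS Q (S : 'I_3 -> 'I_3 -> 'M[R]_3) a : 'I_3 -> 'M[R]_3 :=
  rot3 Q (slice S (row a Q)).

Let contr_slice S u v : contr (slice S u) v = \sum_i \sum_m (v 0 i * u 0 m) *: S m i.
Proof.
rewrite /slice /contr; apply: eq_bigr => i _; rewrite scaler_sumr.
by apply: eq_bigr => m _; rewrite scalerA.
Qed.

Let rotS_quartic Q S : Q *m Q^T = 1%:M -> quartic S -> quartic (rotS Q S).
Proof.
move=> QQ qS; have cS u := slice_cubic u qS.
have [c _ _ _] := qS.
split=> [a b|a b|a b r s|a b].
- rewrite /rotS /rot3; congr (_ *m _ *m _).
  rewrite !contr_slice exchange_big /=; apply: eq_bigr => i _; apply: eq_bigr => m _.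
  by rewrite c mulrC.
- by have [->] := rot_cubic QQ (cS (row a Q)).
- by have [_ ->] := rot_cubic QQ (cS (row a Q)).
- by have [_ _ ->] := rot_cubic QQ (cS (row a Q)).
Qed.

Let rotS_kernel Q S K : Q *m Q^T = 1%:M -> (forall m i j, \tr (S m i *m K j) = 0) ->
  forall m i j, \tr (rotS Q S m i *m rot3 Q K j) = 0.
Proof.
move=> QQ H a b c; have QtQ := mulmx1C QQ.
rewrite /rotS /rot3 !mulmxA -(mulmxA (_ *m contr (slice _ _) _)) QtQ mulmx1.
rewrite mxtrace_mulC !mulmxA QtQ mul1mx contr_slice /contr mulmx_suml linear_sum /=.
rewrite big1// => i _; rewrite mulmx_suml linear_sum /= big1// => m _.
rewrite mulmx_sumr linear_sum /= big1// => d _.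
by rewrite -scalemxAl -scalemxAr !linearZ /= H !mulr0.
Qed.

Let rotS_eq0 Q S : Q *m Q^T = 1%:M -> (forall m i, rotS Q S m i = 0) ->
  forall m i, S m i = 0.
Proof.
move=> QQ H m i; have QtQ := mulmx1C QQ.
have E a : slice S (row a Q) = fun=> 0.
  have <- : rot3 Q^T (rot3 Q (slice S (row a Q))) = slice S (row a Q) by exact: rot3K QQ.
  apply/funext => b.
  rewrite /rot3 -/(rotS Q S a).
  have -> : contr (rotS Q S a) (row b Q^T) = 0.
    by rewrite /contr big1// => d _; rewrite H scaler0.
  by rewrite mulmx0 mul0mx.
have F a : contr (S^~ i) (row a Q) = 0 by have := congr1 (fun f => f i) (E a).
rewrite -(contr_delta (S^~ i) m).
have -> : delta_mx 0 m = \sum_a Q a m *: row a Q.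
  have -> : \sum_a Q a m *: row a Q = row m (Q^T *m Q).
    rewrite row_mul mulmx_sum_row; apply: eq_bigr => a _.
    by rewrite !mxE.
  by rewrite QtQ row1.
by rewrite contr_sum big1// => a _; rewrite contrZ F scaler0.
Qed.

(** In the adapted basis the form is k (2 x^3 - 3 x (y^2 + z^2)), which is invariant under rotations
    about the first axis. *)
Definition axial (k : R) K := exists2 Q, Q *m Q^T = 1%:M &
  rot3 Q K = nf (2 * k) (- k) (- k) 0 0.

(** A multiple of the product of three orthonormal coordinates, seen from the direction (1, 1, 1);
    [p] and [q] record the angle of the basis about that axis. *)
Definition tetrahedral (l : R) K := exists Q p q, [/\ Q *m Q^T = 1%:M,
  rot3 Q K = nf l (- (l / 2)) (- (l / 2)) p q & 2 * (p ^+ 2 + q ^+ 2) = l ^+ 2].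

Theorem quartic_kernel_axial K S : cubic K -> (exists c, K c != 0) -> quartic S ->
  (forall m i j, \tr (S m i *m K j) = 0) ->
  (forall m i, S m i = 0) \/ exists2 k, 0 < k & axial k K.
Proof.
move=> cK K0 qS SK.
have [Q [l1 [l2 [l3 [p [q [QQ l10 l21 l32 [s0 E max]]]]]]]] := normal_form cK K0.
have cN := rot_cubic QQ cK; rewrite E in cN.
have SN := rotS_kernel QQ SK; rewrite E in SN.
have [H|[l23 p0 q0]] := quartic_kernel (rotS_quartic QQ qS) l10 l21 l32 s0 max cN SN.
  by left; exact: rotS_eq0 H.
right; exists (l1 / 2); first by rewrite divr_gt0.
exists Q => //; rewrite E p0 q0.
have -> : l1 = 2 * (l1 / 2) by field.
by congr nf; [field|lra|lra].
Qed.

Theorem curvature_invariant_cases H K : cubic K -> (exists c, K c != 0) ->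
  curvature_invariant H K ->
  exists2 l, 0 < l & H = - (3 / 4) * l ^+ 2 /\ (axial (l / 2) K \/ tetrahedral l K).
Proof.
move=> cK K0 HK.
have [Q [l1 [l2 [l3 [p [q [QQ l10 l21 l32 [s0 E max]]]]]]]] := normal_form cK K0.
have cN := rot_cubic QQ cK; rewrite E in cN.
have HN := rot_curvature_invariant QQ HK; rewrite E in HN.
have [l2E l3E HE pq] := curvature_invariant_nf l10 l21 l32 s0 max cN HN.
exists l1 => //; split=> //; case: pq => [[p0 q0]|pq]; [left|right].
  by exists Q => //; rewrite E p0 q0 l2E l3E; have -> : 2 * (l1 / 2) = l1 by field.
by exists Q, p, q; split=> //; rewrite E l2E l3E.
Qed.

End Pointwise.

(** * Parallelism of the cubic form *)

(** The form k (5 <e,v>^3 - 3 <e,v> <v,v>), a polynomial in the axis [e]. *)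
Definition axial_form (R : realType) (k : R) (e : 'rV[R]_3) c : 'M[R]_3 :=
  k *: ((5 * e 0 c) *: (e^T *m e) -
        ((e 0 c)%:M + (delta_mx 0 c : 'rV[R]_3)^T *m e + e^T *m (delta_mx 0 c : 'rV_3))).

Section AxialAlgebra.
Context {R : realType}.
Implicit Types (K : 'I_3 -> 'M[R]_3) (e : 'rV[R]_3).

Definition gram K : 'M[R]_3 := \matrix_(a, b) \tr (K a *m K b).

Lemma axialE k K : axial k K -> exists2 e, e *m e^T = 1%:M & K = axial_form k e.
Proof.
move=> [Q QQ E]; have QtQ := mulmx1C QQ; exists (row i0 Q).
  by rewrite !rowE trmx_mul mulmxA -(mulmxA _ Q) QQ mulmx1 trmx_delta mul_delta_mx
    [LHS]mx11_scalar mxE eqxx.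
rewrite -(rot3K K QQ) E; apply/funext => c; rewrite /rot3 trmxK.
pose d : 'rV[R]_3 := delta_mx 0 i0; pose w := row c Q^T.
have -> : contr (nf (2 * k) (- k) (- k) 0 0) w =
    k *: ((5 * w 0 i0) *: (d^T *m d) - ((w 0 i0)%:M + w^T *m d + d^T *m w)).
  by apply: mx3P; rewrite !contrE !mxE !big_ord1 !mxE /=; ring.
have wQ : w *m Q = delta_mx 0 c by rewrite /w -row_mul QtQ row1.
have wQT : Q^T *m w^T = (delta_mx 0 c : 'rV[R]_3)^T by rewrite -trmx_mul wQ.
have dQT : Q^T *m d^T = (row i0 Q)^T by rewrite -trmx_mul rowE.
have dQ : d *m Q = row i0 Q by rewrite rowE.
have -> : w 0 i0 = (row i0 Q) 0 c by rewrite !mxE.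
move: w d (row i0 Q) wQ wQT dQ dQT => w d e wQ wQT dQ dQT.
rewrite /axial_form -scalemxAr -scalemxAl; congr (k *: _).
rewrite mulmxBr mulmxBl -scalemxAr -scalemxAl !mulmxDr !mulmxDl mul_mx_scalar -scalemxAl.
by rewrite QtQ scalemx1 !mulmxA dQT wQT -!mulmxA dQ wQ.
Qed.

Lemma axial_formE k e c a b : axial_form k e c a b =
  k * (5 * e 0 c * e 0 a * e 0 b - (e 0 c * (a == b)%:R + (a == c)%:R * e 0 b
       + (b == c)%:R * e 0 a)).
Proof. by rewrite !mxE !big_ord1 !mxE !eqxx /= -mulr_natr; ring. Qed.

Lemma axial_form_sum k e (w : 'rV[R]_3) : \sum_d w 0 d *: axial_form k e d =
  k *: ((5 * (e *m w^T) 0 0) *: (e^T *m e) - ((e *m w^T) 0 0 *: 1%:M + w^T *m e + e^T *m w)).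
Proof.
apply/matrixP => r s.
have Z x (X : 'M[R]_3) : (x *: X) r s = x * X r s by rewrite mxE.
rewrite summxE sum3 (Z (w 0 i0)) (Z (w 0 i1)) (Z (w 0 i2)) !axial_formE.
rewrite !mxE sum3 !big_ord1 !mxE {Z}.
by elim/ord3P: r; elim/ord3P: s => /=; ring.
Qed.

Lemma trace_axial_form k e a X : \tr (axial_form k e a *m X) =
  k * (5 * e 0 a * (e *m X *m e^T) 0 0 -
       (e 0 a * \tr X + (e *m X) 0 a + (X *m e^T) a 0)).
Proof.
rewrite /axial_form -scalemxAl linearZ /= mulmxBl !mulmxDl mul_scalar_mx -scalemxAl.
have tr_outer (x : 'cV[R]_3) (y : 'rV[R]_3) : \tr (x *m y *m X) = (y *m X *m x) 0 0.
  by rewrite -mulmxA mxtrace_mulC /mxtrace big_ord1.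
have trN (Z : 'M[R]_3) : \tr (- Z) = - \tr Z by rewrite linearN.
rewrite !mxtraceD trN !mxtraceD !linearZ /= !tr_outer; congr (_ * (_ - (_ + _ + _))).
  by rewrite trmx_delta -colE mxE.
by rewrite -mulmxA -rowE mxE.
Qed.

Lemma mul_axial_form k e b : e *m e^T = 1%:M ->
  e *m axial_form k e b = k *: ((3 * e 0 b) *: e - delta_mx 0 b).
Proof.
move=> ee; rewrite /axial_form -scalemxAr; congr (k *: _).
rewrite mulmxBr !mulmxDr -!scalemxAr !mulmxA ee !mul1mx mul_mx_scalar trmx_delta -colE.
have -> : col b e *m e = e 0 b *: e.
  by rewrite [col b e]mx11_scalar mul_scalar_mx mxE.
by apply/matrixP => r s; rewrite !mxE; ring.
Qed.

Lemma axial_form_gram k e : e *m e^T = 1%:M ->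
  gram (axial_form k e) = k ^+ 2 *: (2%:M + 4 *: (e^T *m e)).
Proof.
move=> ee; apply/matrixP => a b.
have sym c : (axial_form k e c)^T = axial_form k e c.
  by apply/matrixP => i j; rewrite mxE !axial_formE eq_sym; ring.
have Ke c : axial_form k e c *m e^T = (e *m axial_form k e c)^T.
  by rewrite trmx_mul sym.
have trK c : \tr (axial_form k e c) = 0.
  rewrite trace3 !axial_formE.
  have e1 : e 0 i0 * e 0 i0 + e 0 i1 * e 0 i1 + e 0 i2 * e 0 i2 = 1.
    by move: ee => /matrixP/(_ 0 0); rewrite mxE sum3 !mxE.
  transitivity (k * (5 * e 0 c * (e 0 i0 * e 0 i0 + e 0 i1 * e 0 i1 + e 0 i2 * e 0 i2 - 1))).
    by elim/ord3P: c => /=; ring.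
  by rewrite e1 subrr !mulr0.
have E0 : (e *m e^T) 0 0 = 1 by rewrite ee mxE eqxx.
have dE c d : (delta_mx 0 c : 'rV[R]_3) 0 d = (d == c)%:R by rewrite mxE eqxx.
rewrite mxE trace_axial_form trK Ke [(_^T) a 0]mxE mul_axial_form//.
have -> : (k *: (3 * e 0 b *: e - delta_mx 0 b) *m e^T) 0 0 = 2 * k * e 0 b.
  rewrite -scalemxAl mulmxBl -scalemxAl -rowE.
  have -> : (k *: (3 * e 0 b *: (e *m e^T) - row b e^T)) 0 0 =
    k * (3 * e 0 b * (e *m e^T) 0 0 - e 0 b).
    by move: (e *m e^T) => Y; rewrite !mxE.
  by rewrite E0; ring.
have -> : (k *: (3 * e 0 b *: e - delta_mx 0 b)) 0 a = k * (3 * e 0 b * e 0 a - (a == b)%:R).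
  by rewrite !mxE eqxx.
by rewrite !mxE big_ord1 !mxE -[_ *+ (a == b)]mulr_natr; ring.
Qed.

(** The Gram matrix determines [e] only up to sign. Contracting it with the form, which is odd in
    [e], recovers [e] itself, and smoothly; 8 k^3 is the factor inverted in [axis]. *)
Lemma axial_form_axis k e a : e *m e^T = 1%:M ->
  \tr (axial_form k e a *m gram (axial_form k e)) = 8 * k ^+ 3 * e 0 a.
Proof.
move=> ee; have E0 : (e *m e^T) 0 0 = 1 by rewrite ee mxE eqxx.
rewrite trace_axial_form axial_form_gram//.
pose X : 'M[R]_3 := 2%:M + 4 *: (e^T *m e).
have eX : e *m X = 6 *: e.
  rewrite /X mulmxDr mul_mx_scalar -scalemxAr mulmxA ee mul1mx -scalerDl.
  by congr (_ *: _); ring.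
have Xe : X *m e^T = 6 *: e^T.
  rewrite /X mulmxDl mul_scalar_mx -scalemxAl -mulmxA ee mulmx1 -scalerDl.
  by congr (_ *: _); ring.
have trX : \tr X = 10.
  by rewrite /X linearD linearZ /= mxtrace_scalar mxtrace_mulC /mxtrace big_ord1 E0; ring.
rewrite -/X -scalemxAr -scalemxAl linearZ /= eX Xe trX -!scalemxAl.
have Z (c : R) m n (Y : 'M[R]_(m, n)) i j : (c *: Y) i j = c * Y i j by rewrite mxE.
by rewrite !Z E0 mxE; ring.
Qed.

End AxialAlgebra.

Section AxialField.
Context {R : realType} (V : set 'rV[R]_3) (k : 'I_3 -> 'rV[R]_3 -> 'M[R]_3)
  (om : 'I_3 -> 'rV[R]_3 -> 'M[R]_3) (ka : R).
Hypotheses (Vo : open V) (sk : forall c, smx V (k c)) (ka0 : ka != 0)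
  (om_skew : forall i u, (om i u)^T = - om i u)
  (k_axial : forall u, V u -> axial ka (k^~ u)).
Let T u : 'M[R]_3 := gram (k^~ u).
Hypothesis dT : forall i u, V u -> dm i T u = om i u *m T u - T u *m om i u.

Definition axis u : 'rV[R]_3 := \row_a ((8 * ka ^+ 3)^-1 * \tr (k a u *m T u)).

Lemma axisP u : V u -> axis u *m (axis u)^T = 1%:M /\ forall c, k c u = axial_form ka (axis u) c.
Proof.
move=> Vu; have [e ee E] := axialE (k_axial Vu).
suff -> : axis u = e by split=> // c; rewrite -E.
have Ea a : k a u = axial_form ka e a by rewrite -E.
apply/rowP => a; rewrite mxE /T E Ea axial_form_axis// mulKf//.
by rewrite mulf_neq0 ?expf_neq0// pnatr_eq0.
Qed.

Lemma smx_gram : smx V T.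
Proof.
move=> a b; apply: (@sm_eq _ _ _ (fun v => \sum_k0 (k a v *m k b v) k0 k0)) => //.
  by move=> v _; rewrite mxE.
by apply: sm_sum => // k0; apply: smxM.
Qed.

Lemma smx_axis : smx V axis.
Proof.
move=> a b; apply: (@sm_eq _ _ _ (fun v => (8 * ka ^+ 3)^-1 *
  \sum_k0 (k b v *m T v) k0 k0)) => //.
  by move=> v _; rewrite mxE.
apply: smM => //; first exact: sm_cst.
by apply: sm_sum => // k0; apply: smxM => //; exact: smx_gram.
Qed.

(* [axis^T *m axis] is an affine function of the parallel tensor [T], and a
   unit vector is determined by it up to sign. *)
Lemma dm_axis i u : V u -> dm i axis u = - (axis u *m om i u).
Proof.
move=> Vu; have [aa _] := axisP Vu; have sA := smx_axis.
pose P v : 'M[R]_3 := (axis v)^T *m axis v.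
have PE v : V v -> P v = (4 * ka ^+ 2)^-1 *: (T v - (2 * ka ^+ 2)%:M).
  move=> Vv; have [ee E] := axisP Vv.
  have -> : T v = gram (axial_form ka (axis v)).
    by rewrite /T; congr gram; apply/funext => c; rewrite E.
  rewrite axial_form_gram// -/(P v); apply/matrixP => a b; rewrite !mxE.
  move: (P v a b) => x; case: (a == b); rewrite /= ?mulr1n ?mulr0n; field; exact: ka0.
have dP : dm i P u = om i u *m P u - P u *m om i u.
  rewrite (dm_eq i Vo PE Vu) PE//.
  rewrite (dmZ i (@sm_cst _ _ V _) (smxB Vo smx_gram (smx_cst (U := V) (2 * ka ^+ 2)%:M)) Vu).
  rewrite -[X in partial _ X _]/(cst (4 * ka ^+ 2)^-1) partial_cst scale0r add0r.
  rewrite (dmB i Vo smx_gram (smx_cst (U := V) (2 * ka ^+ 2)%:M) Vu) dm_cst subr0 dT//.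
  rewrite -scalemxAr -scalemxAl -scalerBr mulmxBr mulmxBl.
  by rewrite mul_scalar_mx mul_mx_scalar opprB addrA subrK.
have dA : dm i P u = (dm i axis u)^T *m axis u + (axis u)^T *m dm i axis u.
  by rewrite /P (dmM i Vo (smxT Vo sA) sA Vu) dmT.
pose D := dm i axis u + axis u *m om i u.
have H0 : D^T *m axis u + (axis u)^T *m D = 0.
  rewrite /D linearD /= trmx_mul om_skew mulmxDl mulmxDr mulNmx mulNmx !mulmxA.
  move: dP; rewrite dA /P !mulmxA.
  move: ((dm i axis u)^T *m _) (_ *m dm i axis u) (om i u *m _ *m _) (_ *m om i u).
  by move=> x y z w E; apply/matrixP => r s; move: E => /matrixP/(_ r s); rewrite !mxE; lra.
suff : D = 0 by move/eqP; rewrite addr_eq0 => /eqP.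
have E1 : D = - (axis u *m D^T *m axis u).
  have := congr1 (mulmx (axis u)) H0; rewrite mulmx0 mulmxDr !mulmxA aa mul1mx.
  by move/eqP; rewrite addrC addr_eq0 => /eqP.
have E2 : D *m (axis u)^T = 0.
  have sD : axis u *m D^T = D *m (axis u)^T.
    by rewrite -[LHS]trmxK trmx_mul trmxK; apply/matrixP => r s; rewrite !ord1 mxE.
  have := congr1 (mulmx^~ (axis u)^T) E1; rewrite /= mulNmx -[_ *m _ *m _^T]mulmxA aa mulmx1 sD.
  move: (D *m _) => x E; apply/matrixP => r s; move: E => /matrixP/(_ r s); rewrite !mxE; lra.
have sD : axis u *m D^T = 0 by rewrite -[LHS]trmxK trmx_mul trmxK E2 trmx0.
by rewrite E1 sD mul0mx oppr0.
Qed.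

(** [axial_form] is built from the axis by operations that commute with rotations, so the parallel
    axis makes the form parallel: the product rule reproduces the action of [om] on each factor. *)
Lemma dm_axial_form j c u : V u -> dm j (k c) u =
  (om j u *m k c u - k c u *m om j u) + \sum_d om j u c d *: k d u.
Proof.
move=> Vu; have sA := smx_axis; have [aa kE] := axisP Vu.
pose dl : 'rV[R]_3 := delta_mx 0 c.
have sdl : smx V (fun=> dl) by exact: smx_cst.
have s5 : smooth_on V (fun v => 5 * axis v 0 c).
  exact: (smM Vo (@sm_cst _ _ V 5) (sA 0 c)).
have sP := smxM Vo (smxT Vo sA) sA.
have sX := smxM Vo (smxT Vo sdl) sA.
have sY := smxM Vo (smxT Vo sA) sdl.
have sI : smx V (fun v => axis v 0 c *: (1%:M : 'M[R]_3)).
  exact: (smxZ Vo (sA 0 c) (@smx_cst _ _ _ _ V 1%:M)).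
have E v : V v -> k c v = ka *: ((5 * axis v 0 c) *: ((axis v)^T *m axis v) -
   (axis v 0 c *: 1%:M + dl^T *m axis v + (axis v)^T *m dl)).
  by move=> Vv; have [_ ->] := axisP Vv; rewrite /axial_form scalemx1.
rewrite (dm_eq j Vo E Vu) (dmZ j (@sm_cst _ _ V _) (smxB Vo (smxZ Vo s5 sP) (smxD Vo (smxD Vo sI sX) sY)) Vu).
rewrite -[X in partial _ X _]/(cst ka) partial_cst scale0r add0r.
rewrite (dmB j Vo (smxZ Vo s5 sP) (smxD Vo (smxD Vo sI sX) sY) Vu).
rewrite (dmZ j s5 sP Vu) (dmM j Vo (smxT Vo sA) sA Vu) dmT.
rewrite (dmD j (smxD Vo sI sX) sY Vu) (dmD j sI sX Vu).
rewrite (dmZ j (sA 0 c) (@smx_cst _ _ _ _ V 1%:M) Vu) dm_cst scaler0 addr0.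
rewrite (dmM j Vo (smxT Vo sdl) sA Vu) (dmM j Vo (smxT Vo sA) sdl Vu) !dmT dm_cst trmx0 mul0mx mulmx0 add0r addr0.
have d5 : partial j (fun v => 5 * axis v 0 c) u = 5 * dm j axis u 0 c.
  rewrite (partialM j (differentiable_cst _ _) (sm_diff (sA 0 c) Vu)).
  by rewrite -[X in partial _ X _]/(cst (5 : R)) partial_cst mul0r add0r dmE.
rewrite d5 -dmE dm_axis// kE.
under eq_bigr do rewrite kE.
move: (axis u) (om j u) (om_skew j u) => a o os.
have -> : \sum_d o c d *: axial_form ka a d = \sum_d (row c o) 0 d *: axial_form ka a d.
  by apply: eq_bigr => d _; rewrite mxE.
rewrite axial_form_sum /axial_form -/dl.
have -> : row c o = dl *m o by rewrite rowE.
have -> : (dl *m o)^T = - (o *m dl^T) by rewrite trmx_mul os mulNmx.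
have -> : (- (a *m o))^T = o *m a^T by rewrite linearN /= trmx_mul os mulNmx opprK.
have -> : (a *m - (o *m dl^T)) 0 0 = (- (a *m o)) 0 c.
  by rewrite mulmxN mulmxA trmx_delta -colE !mxE.
rewrite -scalemxAr -scalemxAl -scalerBr -scalerDr; congr (ka *: _).
rewrite scalemx1 mulmxBr mulmxBl -scalemxAr -scalemxAl !mulmxDr !mulmxDl mul_scalar_mx mul_mx_scalar.
rewrite !mulmxA !mulNmx !mulmxN !mulmxA !mxE.
move: (- _) => x; move: (o *m a^T *m a) (a^T *m a *m o) (dl^T *m a *m o) (o *m a^T *m dl).
move: (o *m dl^T *m a) (a^T *m dl *m o) (a^T *m a) (a 0 c) => y1 y2 y3 y4 y5 y6 y7 y8.
by apply/matrixP => r s; rewrite !mxE; ring.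
Qed.

End AxialField.

Section ParallelCubic.
Context {R : realType} (U : set 'rV[R]_3) (th : 'rV[R]_3 -> 'M[R]_3)
  (k om : 'I_3 -> 'rV[R]_3 -> 'M[R]_3) (S : 'I_3 -> 'I_3 -> 'rV[R]_3 -> 'M[R]_3).
Hypotheses (Uo : open U) (sk : forall c, smx U (k c)) (sS : forall d c, smx U (S d c))
  (uth : forall u, U u -> th u \in unitmx)
  (om_skew : forall i u, (om i u)^T = - om i u)
  (k_cubic : forall u, U u -> cubic (k^~ u))
  (dk : forall j c u, U u -> dm j (k c) u = \sum_d th u j d *: S d c u +
     (om j u *m k c u - k c u *m om j u) + \sum_d om j u c d *: k d u)
  (dT : forall l u, U u -> dm l (fun v => gram (k^~ v)) u =
     om l u *m gram (k^~ u) - gram (k^~ u) *m om l u)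
  (S_quartic : forall u, U u -> quartic (fun d c => S d c u))
  (tr_Sk : forall d a b u, U u -> \tr (S d a u *m k b u) = 0).

Definition cubic_norm u : R := \tr (gram (k^~ u)).

Lemma cubic_normE u : U u -> cubic_norm u = \sum_c \sum_a \sum_b k c u a b ^+ 2.
Proof.
move=> Uu; have [sy _ _] := k_cubic Uu; apply: eq_bigr => c _.
rewrite mxE; apply: eq_bigr => a _; rewrite mxE; apply: eq_bigr => b _.
by have /matrixP/(_ a b) := sy c; rewrite mxE => ->; rewrite expr2.
Qed.

Lemma cubic_norm_eq0 u : U u -> cubic_norm u = 0 -> forall c, k c u = 0.
Proof.
move=> Uu; rewrite cubic_normE// => E c; apply/matrixP => a b; rewrite [RHS]mxE.
have nn c' a' : 0 <= \sum_b k c' u a' b ^+ 2 by apply: sumr_ge0 => ? _; exact: sqr_ge0.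
have nn2 c' : 0 <= \sum_a \sum_b k c' u a b ^+ 2 by apply: sumr_ge0 => ? _; exact: nn.
move/eqP: E; rewrite psumr_eq0// => /allP/(_ c); rewrite mem_index_enum => /(_ isT) /=.
rewrite psumr_eq0// => /allP/(_ a); rewrite mem_index_enum => /(_ isT) /=.
rewrite psumr_eq0 => [/allP/(_ b)|? _]; last exact: sqr_ge0.
by rewrite mem_index_enum => /(_ isT) /=; rewrite sqrf_eq0 => /eqP.
Qed.

Lemma smx_gramk : smx U (fun v => gram (k^~ v)).
Proof. exact: smx_gram. Qed.

Lemma smooth_cubic_norm : smooth_on U cubic_norm.
Proof. by apply: sm_sum => // c; exact: smx_gramk. Qed.

Lemma partial_cubic_norm i u : U u -> partial i cubic_norm u = 0.
Proof.
move=> Uu; have [_ ->] := partial_sum (index_enum 'I_3) predT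
  (F := fun c v => gram (k^~ v) c c) (fun j => sm_diff (smx_gramk j j) Uu).
transitivity (\tr (dm i (fun v => gram (k^~ v)) u)); first by apply: eq_bigr => c _; rewrite dmE.
by rewrite dT// mxtraceB mxtrace_mulC subrr.
Qed.

Lemma cubic_norm_const u r : (forall v, ball u r v -> U v) ->
  forall v, ball u r v -> cubic_norm v = cubic_norm u.
Proof.
move=> bU; apply: constant_on_ball => [v bv|v i bv].
  exact: sm_diff smooth_cubic_norm (bU _ bv).
exact: partial_cubic_norm (bU _ bv).
Qed.

Lemma axial_cubic_norm ka u : axial ka (k^~ u) -> cubic_norm u = 10 * ka ^+ 2.
Proof.
move=> /axialE[e ee E]; rewrite /cubic_norm E axial_form_gram// linearZ /= linearD /= linearZ /=.
by rewrite mxtrace_scalar mxtrace_mulC ee mxtrace1; ring.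
Qed.

Theorem parallel_gram_cubic d c u : U u -> S d c u = 0.
Proof.
move=> Uu.
have [r r0 bU] : exists2 r, 0 < r & forall v, ball u r v -> U v.
  by have /nbhs_ballP[r /= r0 H] := open_nbhs_nbhs (conj Uo Uu); exists r.
have cN := cubic_norm_const bU.
have uu q : 0 < q -> ball u q u by exact: ballxx.
(* Where the derivative of [k] is given by the action of [om] alone, the remaining sum vanishes and
   the invertible [th u] can be removed from it. *)
have S0 : (forall j c, dm j (k c) u = (om j u *m k c u - k c u *m om j u) +
    \sum_d om j u c d *: k d u) -> forall d c, S d c u = 0.
  move=> H d' c'; have Z j : \sum_e th u j e *: S e c' u = 0.
    by have := H j c'; rewrite dk// -addrA => /eqP; rewrite -subr_eq0 addrK => /eqP.
  have : \sum_j invmx (th u) d' j *: \sum_e th u j e *: S e c' u = 0.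
    by rewrite big1// => j _; rewrite Z scaler0.
  under eq_bigr do (rewrite scaler_sumr; under eq_bigr do rewrite scalerA).
  rewrite exchange_big /= => <-; under eq_bigr => e _.
    rewrite -scaler_suml (_ : \sum_i _ = (d' == e)%:R); first over.
    by have /matrixP/(_ d' e) := mulVmx (uth Uu); rewrite !mxE.
  rewrite (bigD1 d')//= eqxx scale1r big1 ?addr0// => e ed.
  by rewrite eq_sym (negbTE ed) scale0r.
have [J0|J0] := eqVneq (cubic_norm u) 0.
  apply: S0 => j c'.
  have k0 v d' : ball u r v -> k d' v = 0.
    by move=> bv; apply: cubic_norm_eq0; [exact: bU|rewrite cN].
  rewrite (@dm_eq _ _ _ _ (ball u r) _ (fun=> 0)) ?dm_cst; last 3 first.
  - exact: ball_open.
  - by move=> v; exact: k0.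
  - exact: uu.
  rewrite k0; last exact: uu.
  by rewrite mulmx0 mul0mx subrr add0r big1// => e _; rewrite k0 ?scaler0//; exact: uu.
have [->//|/eqP] := eqVneq (S d c u) 0.
move=> Snz; exfalso; apply: (Snz).
have [a [b ab]] : exists a b, S d c u a b != 0.
  apply: contra_notP Snz => /forallNP H; apply/matrixP => a b; rewrite mxE.
  by apply/eqP; apply: contra_notT (H a) => ?; exists b.
(* An axial form of size [ka] has squared norm 10 ka^2, and the squared norm is constant; hence one
   [ka] serves on the whole ball. *)
pose ka := Num.sqrt (cubic_norm u / 10).
have [q q0 bV] : exists2 q, 0 < q & forall v, ball u q v -> ball u r v /\ S d c v a b != 0.
  have cont : {for u, continuous (fun v => S d c v a b)}.
    by apply: differentiable_continuous; exact: sm_diff (sS d c a b) Uu.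
  have N : \forall v \near u, S d c v a b != 0.
    have := cont _ (open_nbhs_nbhs (conj (@open_neq R 0) ab)); exact.
  have M : \forall v \near u, ball u r v by exact: nbhsx_ballx.
  have W : nbhs u [set v | ball u r v /\ S d c v a b != 0] by exact: filterI M N.
  by have /nbhs_ballP[q /= q0 H] := W; exists q.
have ax v : ball u q v -> axial ka (k^~ v).
  move=> /bV[bv Sv]; have Uv := bU _ bv.
  have kn0 : exists c, k c v != 0.
    apply: contrapT => /forallNP H; case/negP: J0; rewrite -(cN v)//; apply/eqP.
    rewrite cubic_normE// big1// => e _; rewrite big1// => a' _; rewrite big1// => b' _.
    by have /negP := H e; rewrite negbK => /eqP ->; rewrite mxE expr0n.
  have [H|[ka' ka0 axk]] := quartic_kernel_axial (k_cubic Uv) kn0 (S_quartic Uv)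
     (fun d' a' b' => tr_Sk d' a' b' Uv).
    by move: Sv; rewrite H mxE eqxx.
  suff -> : ka = ka' by [].
  rewrite /ka -(cN v)// (axial_cubic_norm axk) [10 * _]mulrC mulfK ?pnatr_eq0//.
  by rewrite sqrtr_sqr gtr0_norm.
apply: S0 => j c'.
have ka0 : ka != 0.
  apply: contra_neq J0 => ka0; have := axial_cubic_norm (ax _ (uu _ q0)).
  by rewrite ka0 expr0n mulr0.
have VU v : ball u q v -> U v by move=> /bV[bv _]; exact: bU.
apply: (dm_axial_form (V := ball u q) (ka := ka) (ball_open _ _)) => //.
- by move=> e a' b' s v bv; apply: sk; exact: VU.
- by move=> i v bv; apply: dT; exact: VU.
- exact: uu.
Qed.

End ParallelCubic.

(* [fr_e] is an orthonormal frame for the affine metric, with dual coframe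
   [fr_p], conormal field [fr_nu] and connection forms [fr_om]; [fr_k] is the
   difference between the induced and the Levi-Civita connection, and [fr_dk]
   says that it is parallel. *)
Record adapted_frame (R : realType) (U : set 'rV[R]_3)
    (f xi : 'rV[R]_3 -> 'rV[R]_4) (H : R) := AdaptedFrame {
  fr_e : 'rV[R]_3 -> 'M[R]_(3, 4) ;
  fr_p : 'rV[R]_3 -> 'M[R]_(4, 3) ;
  fr_nu : 'rV[R]_3 -> 'cV[R]_4 ;
  fr_th : 'rV[R]_3 -> 'M[R]_3 ;
  fr_om : 'I_3 -> 'rV[R]_3 -> 'M[R]_3 ;
  fr_k : 'I_3 -> 'rV[R]_3 -> 'M[R]_3 ;
  fr_smooth_p : smx U fr_p ;
  fr_smooth_nu : smx U fr_nu ;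
  fr_smooth_k : forall c, smx U (fr_k c) ;
  fr_unit : forall u, U u -> fr_th u \in unitmx ;
  fr_jac : forall u, U u -> jac f u = fr_th u *m fr_e u ;
  fr_ep : forall u, U u -> fr_e u *m fr_p u = 1%:M ;
  fr_enu : forall u, U u -> fr_e u *m fr_nu u = 0 ;
  fr_xip : forall u, U u -> xi u *m fr_p u = 0 ;
  fr_xinu : forall u, U u -> xi u *m fr_nu u = 1%:M ;
  fr_pe : forall u, U u -> fr_p u *m fr_e u + fr_nu u *m xi u = 1%:M ;
  fr_dp : forall i u, U u -> dm i fr_p u =
    H *: (fr_nu u *m row i (fr_th u)) -
    fr_p u *m (fr_om i u + contr (fr_k^~ u) (row i (fr_th u))) ;
  fr_dnu : forall i u, U u -> dm i fr_nu u = - (fr_p u *m (row i (fr_th u))^T) ;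
  fr_skew : forall i u, (fr_om i u)^T = - fr_om i u ;
  fr_cubic : forall u, U u -> cubic (fr_k^~ u) ;
  fr_dk : forall i c u, U u -> dm i (fr_k c) u =
    (fr_om i u *m fr_k c u - fr_k c u *m fr_om i u)
    + \sum_d fr_om i u c d *: fr_k d u ;
  fr_curvature : forall u, U u -> curvature_invariant H (fr_k^~ u)
}.

(** * Construction of the adapted frame *)

Section ChartFrame.
Context {R : realType} (U : set 'rV[R]_3) (f xi : 'rV[R]_3 -> 'rV[R]_4) (H : R)
  (th : 'rV[R]_3 -> 'M[R]_3) (h : 'rV[R]_3 -> 'M[R]_3).
Hypotheses (Uo : open U) (sf : smx U f) (sxi : smx U xi)
  (sth : smx U th).
Let Fr u : 'M[R]_(3 + 1, 4) := col_mx (jac f u) (xi u).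
Hypotheses (uFr : forall u, U u -> (Fr u : 'M[R]_4) \in unitmx)
  (dxi : forall u, U u -> jac xi u = (- H) *: jac f u)
  (h2 : forall u, U u -> h u = second_form f xi u)
  (thE : forall u, U u -> th u *m (th u)^T = h u)
  (uth : forall u, U u -> th u \in unitmx)
  (vol : forall u, U u -> \det (Fr u : 'M[R]_4) ^+ 2 = \det (h u))
  (ricci0 : forall l i j u, U u -> covariant_derivative h (ricci h) l i j u = 0).

Let th2 u : U u -> th u *m (th u)^T = second_form f xi u.
Proof. by move=> Uu; rewrite thE ?h2. Qed.

Let e := frm f th.
Let p := cofr f xi th.
Let nu := conormal f xi.
Let B i u : 'M[R]_3 := dm i e u *m p u.

Let se : smx U e. Proof. exact: (smx_frm Uo sf sth uth). Qed.
Let sp : smx U p. Proof. exact: (smx_cofr Uo sf sxi uFr sth). Qed.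
Let snu : smx U nu. Proof. exact: (smx_conormal Uo sf sxi uFr). Qed.
Let sB i : smx U (B i). Proof. by apply: smxM => //; exact: smx_dm. Qed.
Let ep u : U u -> e u *m p u = 1%:M. Proof. exact: (frm_cofr uFr uth). Qed.
Let enu u : U u -> e u *m nu u = 0. Proof. exact: (frm_conormal th uFr). Qed.
Let xip u : U u -> xi u *m p u = 0. Proof. exact: (xi_cofr th uFr). Qed.
Let xinu u : U u -> xi u *m nu u = 1%:M. Proof. exact: (xi_conormal uFr). Qed.
Let pe u : U u -> p u *m e u + nu u *m xi u = 1%:M. Proof. exact: (cofr_frm uFr uth). Qed.
Let jE u : U u -> jac f u = th u *m e u. Proof. exact: (jacE f uth). Qed.
Let de u i : U u -> dm i e u = B i u *m e u + (row i (th u))^T *m xi u.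
Proof. exact: (dm_frm Uo sf uFr sth th2 uth i). Qed.

Let dxiE i u : U u -> dm i xi u = (- H) *: (row i (th u) *m e u).
Proof. exact: (dm_xi dxi jE i). Qed.

(** Differentiating the duality relations gives the products of the derivatives of [p] and [nu] with
    [xi] and [e], and by [pe] these products determine the derivatives. *)
Let xi_dp i u : U u -> xi u *m dm i p u = H *: row i (th u).
Proof.
move=> Uu; have := dmM i Uo sxi sp Uu; rewrite dxiE// (dm_eq i Uo xip Uu) dm_cst.
rewrite -scalemxAl -(mulmxA (row i (th u))) ep// mulmx1 scaleNr => /eqP.
by rewrite eq_sym addrC subr_eq0 => /eqP.
Qed.

Let e_dp i u : U u -> e u *m dm i p u = - B i u.
Proof.
move=> Uu; have := dmM i Uo se sp Uu; rewrite (dm_eq i Uo ep Uu) dm_cst => /eqP.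
by rewrite eq_sym addrC addr_eq0 => /eqP.
Qed.

Let e_dnu i u : U u -> e u *m dm i nu u = - (row i (th u))^T.
Proof.
move=> Uu; have := dmM i Uo se snu Uu; rewrite (dm_eq i Uo enu Uu) dm_cst de//.
rewrite mulmxDl -(mulmxA (B i u)) -(mulmxA _^T) enu// xinu// mulmx0 mulmx1 add0r => /eqP.
by rewrite eq_sym addrC addr_eq0 => /eqP.
Qed.

Let xi_dnu i u : U u -> xi u *m dm i nu u = 0.
Proof.
move=> Uu; have := dmM i Uo sxi snu Uu; rewrite (dm_eq i Uo xinu Uu) dm_cst dxiE//.
by rewrite -scalemxAl -(mulmxA (row i (th u))) enu// mulmx0 scaler0 add0r.
Qed.

Let dp i u : U u -> dm i p u = H *: (nu u *m row i (th u)) - p u *m B i u.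
Proof.
move=> Uu; rewrite -[LHS]mul1mx -(pe Uu) mulmxDl -(mulmxA (p u)) -(mulmxA (nu u)) e_dp// xi_dp//.
by rewrite mulmxN -scalemxAr addrC.
Qed.

Let dnu i u : U u -> dm i nu u = - (p u *m (row i (th u))^T).
Proof.
move=> Uu; rewrite -[LHS]mul1mx -(pe Uu) mulmxDl -(mulmxA (p u)) -(mulmxA (nu u)) e_dnu// xi_dnu//.
by rewrite mulmx0 addr0 mulmxN.
Qed.

Let G u : 'M[R]_4 := (col_mx (e u) (xi u) : 'M[R]_(3 + 1)).

Let sG : smx U G.
Proof.
move=> a b; case: (@splitP 3 1 a) => k ak.
  have -> : a = lshift 1 k by exact: val_inj.
  by apply: (sm_eq Uo _ (se k b)) => v _; exact/esym/(@col_mxEu _ 3 1 4).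
have -> : a = rshift 3 k by exact: val_inj.
by apply: (sm_eq Uo _ (sxi k b)) => v _; exact/esym/(@col_mxEd _ 3 1 4).
Qed.

Let dG i u : dm i G u = (col_mx (dm i e u) (dm i xi u) : 'M[R]_(3 + 1)).
Proof.
apply/matrixP => a b; rewrite mxE; case: (@splitP 3 1 a) => k ak.
  have -> : a = lshift 1 k by exact: val_inj.
  apply: etrans (esym (@col_mxEu _ 3 1 4 _ _ k b)); rewrite mxE.
  by congr (partial i _ u); apply/funext => v; exact: (@col_mxEu _ 3 1 4).
have -> : a = rshift 3 k by exact: val_inj.
apply: etrans (esym (@col_mxEd _ 3 1 4 _ _ k b)); rewrite mxE.
by congr (partial i _ u); apply/funext => v; exact: (@col_mxEd _ 3 1 4).
Qed.

Let GV u : U u -> G u *m (row_mx (p u) (nu u) : 'M[R]_(4, 3 + 1)) = 1%:M.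
Proof.
move=> Uu; rewrite /G; have := mul_col_row (e u) (xi u) (p u) (nu u).
by rewrite ep// enu// xip// xinu// -(scalar_mx_block 3 1 1).
Qed.

Let uG u : U u -> G u \in unitmx.
Proof. by move=> Uu; have [] := mulmx1_unit (GV Uu). Qed.

(** [Fr] and [G] differ by the block [th], whose determinant squared is det h; by the volume
    condition this accounts for all of the squared determinant of [Fr]. *)
Let detG u : U u -> \det (G u) ^+ 2 = 1.
Proof.
move=> Uu; have E : Fr u = (block_mx (th u) 0 0 1%:M : 'M[R]_(3 + 1)) *m G u.
  rewrite /G /Fr jE//; have := mul_block_col (th u) 0 0 1%:M (e u) (xi u).
  by rewrite !mul0mx mul1mx add0r addr0 => <-.
have := vol Uu; rewrite E -thE// !det_mulmx det_tr (det_ublock (th u) 0 1%:M) det1 mulr1.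
have : \det (th u) != 0 by rewrite -unitfE -unitmxE uth.
rewrite exprMn -expr2 => d0; rewrite -[RHS]mulr1; apply: mulfI.
by rewrite expf_neq0.
Qed.

(** By Jacobi's formula the constant function det (G)^2 has derivative 2 tr (B) det (G)^2; the row
    [xi] does not contribute because its derivative is tangential. *)
Let trB i u : U u -> \tr (B i u) = 0.
Proof.
move=> Uu; have dd := partial_det i Uo sG Uu (uG Uu).
have sd : smooth_on U (fun v => \det (G v)) by exact: smx_det.
have GI : invmx (G u) = (row_mx (p u) (nu u) : 'M[R]_(4, 3 + 1)).
  by rewrite -[RHS](mulKmx (uG Uu)) GV// mulmx1.
have T : \tr (dm i G u *m invmx (G u)) = \tr (B i u).
  rewrite GI dG; have -> : (col_mx (dm i e u) (dm i xi u) : 'M[R]_(3 + 1)) *m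
     (row_mx (p u) (nu u) : 'M[R]_(4, 3 + 1)) =
     block_mx (dm i e u *m p u) (dm i e u *m nu u) (dm i xi u *m p u) (dm i xi u *m nu u).
    exact: mul_col_row.
  rewrite (mxtrace_block (dm i e u *m p u)) dxiE// -scalemxAl -(mulmxA (row i (th u))) enu// mulmx0 scaler0.
  by rewrite mxtrace0 addr0.
have := partialM i (sm_diff sd Uu) (sm_diff sd Uu); rewrite dd T.
rewrite (@partial_eq _ _ U _ (fun=> 1))//.
rewrite -[X in partial _ X _]/(cst (1 : R)) partial_cst /=.
move: (detG Uu); move: (\tr _) (\det _) => x y y2 E.
have : 2 * (y ^+ 2 * x) = 0 by rewrite [RHS]E; ring.
by rewrite y2; lra.
Qed.

Let O := skew_part B.
Let Kt := sym_part B.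

Let trK i u : U u -> \tr (Kt i u) = 0.
Proof. by move=> Uu; rewrite /Kt /sym_part linearZ /= linearD /= mxtrace_tr trB// addr0 mulr0. Qed.

Let t_K' i j u : U u -> row i (th u) *m Kt j u = row j (th u) *m Kt i u.
Proof. exact: (t_K Uo sf sxi sth se sB dxi ep enu xip xinu jE de). Qed.

Let torsion' i j u : U u -> row i (dm j th u) + row i (th u) *m O j u =
  row j (dm i th u) + row j (th u) *m O i u.
Proof.
move=> Uu; have := torsion_free Uo sf sxi sth se sB dxi ep enu xip xinu jE de i j Uu.
by rewrite /tangent_row !dm_row.
Qed.

Let gauss' i j u : U u ->
  dm j (O i) u - dm i (O j) u + O i u *m O j u - O j u *m O i u
  = Kt j u *m Kt i u - Kt i u *m Kt j u
    + H *: ((row i (th u))^T *m row j (th u) - (row j (th u))^T *m row i (th u)).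
Proof. exact: (gauss Uo sxi sth se sB dxi ep enu xip xinu jE de). Qed.

Let codazzi' i j u : U u ->
  dm j (Kt i) u + O i u *m Kt j u + Kt i u *m O j u =
  dm i (Kt j) u + O j u *m Kt i u + Kt j u *m O i u.
Proof. exact: (codazzi Uo sxi sth se sB dxi ep enu xip xinu jE de). Qed.

Let Osk i u : (O i u)^T = - O i u. Proof. exact: om_skew. Qed.
Let Ksy i u : (Kt i u)^T = Kt i u. Proof. exact: K_sym. Qed.
Let sO i : smx U (O i). Proof. exact: smx_om. Qed.
Let sKt i : smx U (Kt i). Proof. exact: smx_K. Qed.

Let k := Kf th Kt.
Let S := Sf th O Kt.

Let cubic_k u : U u -> cubic (k^~ u).
Proof.
move=> Uu; split=> [c|c a b|c].
- exact: (Kf_sym th Ksy).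
- rewrite -(Kf_swap uth t_K' a c b Uu).
  by have /matrixP/(_ a b) := Kf_sym th Ksy c u; rewrite mxE.
- exact: (tr_Kf th trK c Uu).
Qed.

Let quartic_S u : U u -> quartic (fun d c => S d c u).
Proof.
move=> Uu; split=> [d c|d c|d c a b|d c].
- exact: (Sf_comm Uo sth sKt uth torsion' codazzi' d c Uu).
- exact: (Sf_sym th Uo Osk Ksy d c Uu).
- exact: (Sf_swap O Uo uth t_K' d c a b Uu).
- exact: (Sf_trace O Uo sth sKt uth trK d c Uu).
Qed.

Let S0 d c u : U u -> S d c u = 0.
Proof.
move=> Uu.
have tS d' a b v (Uv : U v) :=
  tr_Sf_Kf Uo sth sO sKt uth thE Osk trK t_K' torsion' gauss' codazzi' ricci0 d' a b Uv.
have dT l v (Uv : U v) :=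
  dm_Tn Uo sth sO sKt uth thE Osk trK t_K' torsion' gauss' ricci0 l Uv.
apply: (@parallel_gram_cubic _ U th k O S) Uu => //.
- exact: (smx_Kf Uo sth sKt uth).
- exact: (smx_Sf Uo sth sO sKt uth).
- by move=> j c' v Uv; rewrite -(ScE O Kt uth j c' Uv); exact: dm_Kf.
Qed.

Theorem chart_adapted_frame : exists A : adapted_frame U f xi H, fr_th A = th.
Proof.
have BO i u : U u -> B i u = O i u + contr (k^~ u) (row i (th u)).
  move=> Uu; rewrite [LHS]skew_sym_part; congr (_ + _).
  have := KE Kt uth i Uu; rewrite -/k /Kt => ->.
  by rewrite /contr; apply: eq_bigr => c _; rewrite mxE.
unshelve eexists (@AdaptedFrame _ U f xi H e p nu th O k sp snu _ uth jE ep enu xip xinu pe _ dnu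
  Osk cubic_k _ _) => //.
- exact: (smx_Kf Uo sth sKt uth).
- by move=> i u Uu; rewrite dp// BO.
- exact: (dm_Kf0 uth S0).
- move=> u Uu a b c; exact: (ricci_identity_frame Uo sth sO sKt uth gauss' S0 a b c Uu).
Qed.

End ChartFrame.

(** * First integrals *)

Section HasPartial.
Context {R : realType} {n : nat} (i : 'I_n) (u : 'rV[R]_n).
Implicit Types (f g : 'rV[R]_n -> R).

(** Differentiability and the value of the derivative travel together, so that the derivative of a
    polynomial expression is assembled by composing the lemmas below along its syntax. *)
Definition has_partial f (d : R) := differentiable f u /\ partial i f u = d.

Lemma hpC (c : R) : has_partial (fun=> c) 0.
Proof.
split; first exact: differentiable_cst.
by rewrite -[X in partial _ X _]/(cst c) partial_cst.
Qed.

Lemma hpD f g a b : has_partial f a -> has_partial g b ->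
  has_partial (fun v => f v + g v) (a + b).
Proof. by move=> [df <-] [dg <-]; split; [exact: differentiableD|exact: partialD]. Qed.

Lemma hpN f a : has_partial f a -> has_partial (fun v => - f v) (- a).
Proof. by move=> [df <-]; split; [exact: differentiableN|exact: partialN]. Qed.

Lemma hpM f g a b : has_partial f a -> has_partial g b ->
  has_partial (fun v => f v * g v) (a * g u + f u * b).
Proof. by move=> [df <-] [dg <-]; split; [exact: differentiableM|exact: partialM]. Qed.

Lemma hpX f a m : has_partial f a ->
  has_partial (fun v => f v ^+ m) (m%:R * f u ^+ m.-1 * a).
Proof.
move=> H; elim: m => [|m IH]; first by rewrite !mul0r; exact: (hpC 1).
have -> : (fun v => f v ^+ m.+1) = (fun v => f v * f v ^+ m).
  by apply/funext => v; rewrite exprS.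
have [d p] := hpM H IH; split=> //; rewrite p /=; case: m {IH d p} => [|m] /=.
  by rewrite expr0; ring.
by rewrite exprS -(natr1 m.+1); ring.
Qed.

End HasPartial.

Section Integration.
Context {R : realType} (U : set 'rV[R]_3) (f xi : 'rV[R]_3 -> 'rV[R]_4) (H : R)
  (A : adapted_frame U f xi H).
Hypotheses (Uo : open U) (sf : smx U f).
Let om := fr_om A.
Let k := fr_k A.
Let t i u : 'rV[R]_3 := row i (fr_th A u).

(** Tangential and normal coordinates of the fixed point [y] in the moving frame at [u], as [coordE]
    confirms. *)
Definition tpart (y : 'rV[R]_4) u : 'rV[R]_3 := (y - f u) *m fr_p A u.
Definition npart (y : 'rV[R]_4) u : R := ((y - f u) *m fr_nu A u) 0 0.

Lemma coordE y u : U u -> y = f u + tpart y u *m fr_e A u + npart y u *: xi u.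
Proof.
move=> Uu; have -> : npart y u *: xi u = (y - f u) *m fr_nu A u *m xi u.
  by rewrite -mul_scalar_mx -mx11_scalar.
rewrite /tpart -!mulmxA -addrA -mulmxDr (fr_pe A Uu) mulmx1.
by rewrite addrC subrK.
Qed.

Let smx_sub y : smx U (fun u => y - f u).
Proof. by apply: smxB => //; exact: smx_cst. Qed.

Lemma smx_tpart y : smx U (tpart y).
Proof. by apply: smxM => //; exact: fr_smooth_p. Qed.

Let smx_nu y : smx U (fun u => (y - f u) *m fr_nu A u).
Proof. by apply: smxM => //; exact: fr_smooth_nu. Qed.

Lemma smooth_npart y : smooth_on U (npart y).
Proof. exact: smx_nu. Qed.

Let d_sub y i u : U u -> dm i (fun u => y - f u) u = - (t i u *m fr_e A u).
Proof.
move=> Uu; rewrite (dmB i Uo (smx_cst (U := U) y) sf Uu) dm_cst sub0r -row_jac.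
by rewrite (fr_jac A Uu) row_mul.
Qed.

(** The combination on the left is the covariant derivative. It is kept together because
    skew-symmetry of [om] removes the connection term from every inner product, by [hp_dot]. *)
Lemma dm_tpart y i u : U u -> dm i (tpart y) u + tpart y u *m om i u =
  (H * npart y u - 1) *: t i u - tpart y u *m contr (k^~ u) (t i u).
Proof.
move=> Uu; rewrite /tpart (dmM i Uo (smx_sub y) (fr_smooth_p A) Uu) d_sub//.
rewrite (fr_dp A i Uu) mulNmx -(mulmxA (t i u)) (fr_ep A Uu) mulmx1.
have E : (y - f u) *m fr_nu A u = (npart y u)%:M by exact: mx11_scalar.
rewrite mulmxBr -scalemxAr !mulmxA E mul_scalar_mx -/(t i u) mulmxDr -/om -/k -/(tpart y u).
rewrite scalerBl scale1r scalerA.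
move: (t i u) (_ *: t i u) (tpart y u *m contr _ _) (tpart y u *m om i u) => d c b a.
by apply/matrixP => r s; rewrite !mxE; ring.
Qed.

Lemma hp_npart y i u : U u -> has_partial i u (npart y) (- dot (tpart y u) (t i u)).
Proof.
move=> Uu; split; first exact: sm_diff (smooth_npart y) Uu.
have := dmM i Uo (smx_sub y) (fr_smooth_nu A) Uu; rewrite d_sub// (fr_dnu A i Uu).
rewrite mulNmx -(mulmxA (t i u)) (fr_enu A Uu) mulmx0 oppr0 add0r mulmxN mulmxA.
by move=> /matrixP/(_ 0 0); rewrite !mxE /dot /tpart => ->; rewrite mxE.
Qed.

Let skew i u : (om i u)^T = - om i u. Proof. exact: fr_skew. Qed.

Lemma hp_dot (x z : 'rV[R]_3 -> 'rV[R]_3) i u : smx U x -> smx U z -> U u ->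
  has_partial i u (fun v => dot (x v) (z v))
   (dot (dm i x u + x u *m om i u) (z u) + dot (x u) (dm i z u + z u *m om i u)).
Proof.
move=> sx sz Uu; have sz' := smxT Uo sz; split.
  exact: sm_diff (smxM Uo sx sz' 0 0) Uu.
have /matrixP/(_ 0 0) := dmM i Uo sx sz' Uu; rewrite mxE => E.
rewrite [LHS]E dmT /dot.
have -> : (dm i z u + z u *m om i u)^T = (dm i z u)^T - om i u *m (z u)^T.
  by rewrite linearD /= trmx_mul skew mulNmx.
rewrite mulmxDl mulmxBr mulmxA.
move: (dm i x u *m _) (_ *m om i u *m _) (_ *m (dm i z u)^T) => a b c.
by rewrite !mxE; ring.
Qed.

(** Since [k] is parallel, contraction with it commutes with covariant differentiation. *)
Lemma dm_contr (x : 'rV[R]_3 -> 'rV[R]_3) i u : smx U x -> U u ->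
  dm i (fun v => contr (k^~ v) (x v)) u =
  om i u *m contr (k^~ u) (x u) - contr (k^~ u) (x u) *m om i u
  + contr (k^~ u) (dm i x u + x u *m om i u).
Proof.
move=> sx Uu; have sk c : smx U (k c) by exact: fr_smooth_k.
have sZ c : smx U (fun v => x v 0 c *: k c v) by exact: smxZ.
rewrite /contr (dm_sum _ _ i Uo sZ Uu).
rewrite mulmx_sumr mulmx_suml.
transitivity (\sum_c (dm i x u 0 c *: k c u + (x u 0 c *: (om i u *m k c u - k c u *m om i u)
   + \sum_d (x u 0 c * om i u c d) *: k d u))).
  apply: eq_bigr => c _; rewrite (dmZ i (sx 0 c) (sk c) Uu) -dmE; congr (_ + _).
  rewrite (fr_dk A i c Uu) scalerDr scaler_sumr; congr (_ + _).
  by apply: eq_bigr => d _; rewrite scalerA.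
rewrite !big_split /= [X in _ + (_ + X)]exchange_big /= addrCA; congr (_ + _).
  by rewrite -sumrB; apply: eq_bigr => c _; rewrite scalerBr -scalemxAl -scalemxAr.
rewrite -big_split /=; apply: eq_bigr => d _.
have -> : (dm i x u + x u *m om i u) 0 d = dm i x u 0 d + \sum_c x u 0 c * om i u c d.
  by rewrite mxE [X in _ + X]mxE.
by rewrite scalerDl -scaler_suml.
Qed.

Section AtPoint.
Variable y : 'rV[R]_4.
Let v := tpart y.
Let a u : 'rV[R]_3 := v u *m contr (k^~ u) (v u).
Let sv : smx U v. Proof. exact: smx_tpart. Qed.
Let sc : smx U (fun u => contr (k^~ u) (v u)).
Proof. by apply: smx_sum => // c; apply: smxZ => //; exact: fr_smooth_k. Qed.
Let sa : smx U a. Proof. exact: smxM. Qed.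
Let g i u : 'rV[R]_3 := (H * npart y u - 1) *: t i u - t i u *m contr (k^~ u) (v u).

Let Dv i u : U u -> dm i v u + v u *m om i u = g i u.
Proof.
by move=> Uu; rewrite dm_tpart// (mul_contrC (fr_cubic A Uu)).
Qed.

Let Da i u : U u -> dm i a u + a u *m om i u = 2 *: (g i u *m contr (k^~ u) (v u)).
Proof.
move=> Uu; rewrite /a (dmM i Uo sv sc Uu) (dm_contr i sv Uu) Dv//.
rewrite mulmxDr (mul_contrC (fr_cubic A Uu) (v u) (g i u)) -(Dv i Uu).
move: (contr (k^~ u) (v u)) (dm i v u) (v u) (om i u) => C X w o.
rewrite mulmxBr !mulmxA mulmxDl.
move: (X *m C) (w *m o *m C) (w *m C *m o) => x z s.
by apply/matrixP => r c; rewrite !mxE; ring.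
Qed.

Let dotK u (x z : 'rV[R]_3) : U u ->
  dot (x *m contr (k^~ u) (v u)) z = dot x (z *m contr (k^~ u) (v u)).
Proof.
by move=> Uu; rewrite /dot trmx_mul (contr_sym (fr_cubic A Uu)) mulmxA.
Qed.

(** The rotation invariants <v,v>, <K(v,v),v> and |K(v,v)|^2 of the tangential part v, so that [om]
    does not enter their derivatives. *)
Definition q_nn u := dot (tpart y u) (tpart y u).
Definition q_na u := dot (a u) (tpart y u).
Definition q_aa u := dot (a u) (a u).

Lemma hp_nn i u : U u -> has_partial i u q_nn
  (2 * ((H * npart y u - 1) * dot (t i u) (v u) - dot (t i u) (a u))).
Proof.
move=> Uu; have := hp_dot i sv sv Uu; rewrite Dv// => -[d p]; split=> //.
rewrite [LHS]p /g (dotC (v u)) -[X in _ = 2 * (_ - X)]dotK//.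
move: (contr _ _) => C; rewrite !dotE !mxE; ring.
Qed.

Lemma hp_na i u : U u -> has_partial i u q_na
  (3 * ((H * npart y u - 1) * dot (t i u) (a u) -
        dot (t i u) (a u *m contr (k^~ u) (v u)))).
Proof.
move=> Uu; have := hp_dot i sa sv Uu; rewrite Dv// Da// => -[d p]; split=> //.
have E : dot (2 *: (g i u *m contr (k^~ u) (v u))) (v u) = 2 * dot (g i u) (a u).
  by rewrite -dotK// !dotE !mxE; ring.
rewrite [LHS]p E (dotC (a u)) /g -[X in _ = 3 * (_ - X)]dotK//.
move: (contr _ _) (a u) => C b; rewrite !dotE !mxE; ring.
Qed.

Lemma hp_aa i u : U u -> has_partial i u q_aa
  (4 * ((H * npart y u - 1) * dot (t i u) (a u *m contr (k^~ u) (v u)) -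
        dot (t i u) (a u *m contr (k^~ u) (v u) *m contr (k^~ u) (v u)))).
Proof.
move=> Uu; have := hp_dot i sa sa Uu; rewrite Da// => -[d p]; split=> //.
have E : dot (2 *: (g i u *m contr (k^~ u) (v u))) (a u) =
    2 * dot (g i u) (a u *m contr (k^~ u) (v u)).
  by rewrite -dotK// !dotE !mxE; ring.
rewrite [LHS]p (dotC (a u)) E /g -[X in _ = 4 * (_ - X)]dotK//.
move: (a u *m contr _ _) => b; move: (contr _ _) => C; rewrite !dotE !mxE; ring.
Qed.

(** Zero at [y = f u]. The normalization, free of the inverse of [H], covers paraboloids, [H = 0],
    together with ellipsoids and hyperboloids. *)
Definition quadric u : R := q_nn u + H * npart y u ^+ 2 - 2 * npart y u.

Lemma hp_quadric i u : U u -> (forall c, k c u = 0) -> has_partial i u quadric 0.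
Proof.
move=> Uu k0; have hs := hp_npart y i Uu.
have [d p] := hpD (hpD (hp_nn i Uu) (hpM (hpC i u H) (hpX 2 hs))) (hpN (hpM (hpC i u 2) hs)).
split; first exact: d.
rewrite [LHS]p {p d}.
have -> : a u = 0.
  by rewrite /a /contr big1 ?mulmx0// => c _; rewrite k0 scaler0.
rewrite (dotC (t i u)) (dotC (t i u)) -/(v u).
have -> : dot 0 (t i u) = 0 by rewrite /dot mul0mx mxE.
by move: (dot _ _) => x; ring.
Qed.

(** Cayley-Hamilton for the trace free matrix C = [contr K w], applied to [w], when tr C^2 = - 2 H
    <w,w> and det C = - (H / 3) <w C,w>. It closes the system, since the derivative of [q_aa]
    contains w C^3. *)
Definition tetra_relation (K : 'I_3 -> 'M[R]_3) := forall w : 'rV[R]_3,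
  w *m contr K w *m contr K w *m contr K w =
  - H *: (dot w w *: (w *m contr K w) + (dot (w *m contr K w) w / 3) *: w).

(* [H ^+ 4] times a product of four parallel affine functions of [y], written
   without choosing an order of the four vertices of the tetrahedron. *)
Definition quartic_form u : R := let s := npart y u - H^-1 in
  H ^+ 2 * (H ^+ 2 * s ^+ 4 + 2 * H * (s ^+ 2 * q_nn u) + 4 / 3 * (s * q_na u) + q_nn u ^+ 2)
  + H * q_aa u.

Lemma hp_quartic_form i u : H != 0 -> U u -> tetra_relation (k^~ u) ->
  has_partial i u quartic_form 0.
Proof.
move=> H0 Uu rel; have hs := hpD (hp_npart y i Uu) (hpC i u (- H^-1)).
have hn := hp_nn i Uu; have hm := hp_na i Uu; have hq := hp_aa i Uu.
have [d p] := hpD (hpM (hpC i u (H ^+ 2)) (hpD (hpD (hpD (hpM (hpC i u (H ^+ 2)) (hpX 4 hs))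
  (hpM (hpC i u (2 * H)) (hpM (hpX 2 hs) hn))) (hpM (hpC i u (4 / 3)) (hpM hs hm))) (hpX 2 hn)))
  (hpM (hpC i u H) hq).
split; first exact: d.
rewrite [LHS]p {p d}; have := rel (v u); rewrite -/(a u) => E.
rewrite E /= -/(q_nn u) -/(q_na u).
have -> : H * npart y u - 1 = H * (npart y u - H^-1) by rewrite mulrBr divff.
have -> : dot (t i u) (- H *: (dot (v u) (v u) *: a u + (dot (a u) (v u) / 3) *: v u)) =
   - H * (q_nn u * dot (t i u) (a u) + q_na u / 3 * dot (t i u) (v u)).
  rewrite /q_nn /q_na -/(v u); move: (dot (v u) _) (dot (a u) _) => x z; rewrite !dotE !mxE; ring.
rewrite -/(v u) (dotC (v u)).
move: (dot _ (v u)) (dot _ (a u)) (dot _ (a u *m _)) (q_nn u) (q_na u) (npart y u - H^-1).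
by move=> b1 b2 b3 b4 b5 b6; field.
Qed.

(** Product rule for the parallel [k]; in this form it feeds [dm_axis] and the constancy of the
    norm. *)
Lemma dm_gram i u : U u -> dm i (fun v => gram (k^~ v)) u =
  om i u *m gram (k^~ u) - gram (k^~ u) *m om i u.
Proof.
move=> Uu; have sk c : smx U (k c) by exact: fr_smooth_k.
apply/matrixP => b c; rewrite dmE.
have hp d : has_partial i u (fun v => (k b v *m k c v) d d) (dm i (fun v => k b v *m k c v) u d d).
  by split; [exact: sm_diff (smxM Uo (sk b) (sk c) d d) Uu|rewrite dmE].
have [_ p] := partial_sum (index_enum 'I_3) predT (fun d => (hp d).1).
have -> : partial i (fun v => gram (k^~ v) b c) u = \tr (dm i (fun v => k b v *m k c v) u).
  rewrite /mxtrace -(eq_bigr _ (fun d _ => (hp d).2)) -p.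
  by congr (partial i _ u); apply/funext => w; rewrite mxE.
rewrite (dmM i Uo (sk b) (sk c) Uu) !(fr_dk A i _ Uu) -/om -/k.
have key (o P Q X Y : 'M[R]_3) : \tr ((o *m P - P *m o + X) *m Q + P *m (o *m Q - Q *m o + Y))
    = \tr (X *m Q) + \tr (P *m Y).
  rewrite mulmxDl mulmxDr mulmxBl mulmxBr !mulmxA !mxtraceD.
  have trN (Z : 'M[R]_3) : \tr (- Z) = - \tr Z by rewrite linearN.
  rewrite !trN.
  by rewrite -(mulmxA o) (mxtrace_mulC o); ring.
rewrite key mulmx_suml mulmx_sumr !linear_sum /=.
have -> : (om i u *m gram (k^~ u) - gram (k^~ u) *m om i u) b c =
   \sum_d om i u b d * \tr (k d u *m k c u) + \sum_d om i u c d * \tr (k b u *m k d u).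
  rewrite mxE [X in X + _]mxE; congr (_ + _).
    by apply: eq_bigr => d _; rewrite mxE.
  rewrite mxE [X in - X]mxE -sumrN; apply: eq_bigr => d _; rewrite mxE mulrC -mulNr.
  by have /matrixP/(_ c d) := skew i u; rewrite !mxE => ->; rewrite opprK.
have E1 : \sum_d \tr (om i u b d *: k d u *m k c u) = \sum_d om i u b d * \tr (k d u *m k c u).
  by apply: eq_bigr => d _; rewrite -scalemxAl linearZ.
have E2 : \sum_d \tr (k b u *m (om i u c d *: k d u)) = \sum_d om i u c d * \tr (k b u *m k d u).
  by apply: eq_bigr => d _; rewrite -scalemxAr linearZ.
by rewrite E1 E2.
Qed.

Section AxialCase.
Variable ka : R.
Hypotheses (ka0 : ka != 0) (HE : H = - 3 * ka ^+ 2)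
  (k_axial : forall u, U u -> axial ka (k^~ u)).
Let e := axis k ka.

Let se : smx U e.
Proof. by apply: smx_axis => // c; exact: fr_smooth_k. Qed.

Let ee u : U u -> dot (e u) (e u) = 1.
Proof. by move=> Uu; have [E _] := axisP ka0 k_axial Uu; rewrite /dot E mxE eqxx. Qed.

Let de i u : U u -> dm i e u + e u *m om i u = 0.
Proof.
move=> Uu.
by rewrite (dm_axis Uo (fr_smooth_k A) ka0 skew k_axial dm_gram i Uu) addNr.
Qed.

Definition q_ne u := dot (v u) (e u).

Let aE u : U u -> a u = ka *: ((5 * q_ne u ^+ 2 - q_nn u) *: e u - (2 * q_ne u) *: v u).
Proof.
move=> Uu; have [_ E] := axisP ka0 k_axial Uu.
rewrite /a /q_ne /q_nn -/(v u); move: (v u) => w.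
have -> : k^~ u = axial_form ka (e u) by apply/funext => c; rewrite -E.
move: (e u) => b; rewrite /contr axial_form_sum -scalemxAr; congr (ka *: _).
rewrite mulmxBr !mulmxDr -!scalemxAr mulmx1 !mulmxA.
have -> : w *m b^T = (dot w b)%:M by exact: mx11_scalar.
have -> : w *m w^T = (dot w w)%:M by exact: mx11_scalar.
rewrite !mul_scalar_mx (_ : (b *m w^T) 0 0 = dot w b); last exact: dotC.
move: (dot w b) (dot w w) => x z.
by apply/matrixP => r s; rewrite !mxE; ring.
Qed.

Lemma hp_ne i u : U u -> has_partial i u q_ne
  (H * (npart y u - H^-1) * dot (t i u) (e u)
   - ka * (3 * q_ne u * dot (t i u) (e u) - dot (t i u) (v u))).
Proof.
move=> Uu; have := hp_dot i sv se Uu; rewrite Dv// de// => -[d p]; split=> //.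
rewrite [LHS]p /g.
have -> : dot ((H * npart y u - 1) *: t i u - t i u *m contr (k^~ u) (v u)) (e u) =
   (H * npart y u - 1) * dot (t i u) (e u) - dot (t i u *m contr (k^~ u) (v u)) (e u).
  by rewrite !dotE !mxE; ring.
rewrite dotK//.
have -> : H * npart y u - 1 = H * (npart y u - H^-1).
  by rewrite mulrBr divff// HE mulf_neq0 ?expf_neq0// oppr_eq0 pnatr_eq0.
have -> : e u *m contr (k^~ u) (v u) = ka *: ((3 * q_ne u) *: e u - v u).
  have [ee' E] := axisP ka0 k_axial Uu.
  rewrite /q_ne; move: (v u) => w.
  have -> : k^~ u = axial_form ka (e u) by apply/funext => c; rewrite -E.
  rewrite /contr axial_form_sum -scalemxAr; congr (ka *: _).
  rewrite mulmxBr !mulmxDr -!scalemxAr mulmx1 !mulmxA ee'.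
  have -> : e u *m w^T = (dot w (e u))%:M by rewrite [LHS]mx11_scalar -/(dot _ _) dotC.
  rewrite !mul_scalar_mx mxE eqxx mulr1n !scale1r.
  move: (dot w (e u)) (e u) => x b.
  by apply/matrixP => r s; rewrite !mxE; ring.
move: (H * _) (q_ne u) (t i u) (e u) (v u) => b1 b2 b3 b4 b5; rewrite !dotE !mxE; ring.
Qed.

(** Put tau = [dot (t i u) (e u)]. In direction [i] the linear factor is multiplied by - 3 ka tau
    and the quadratic factor by 2 ka tau; the exponents 2 and 3 balance the two. *)
Definition axial_octic u : R := let s := npart y u - H^-1 in
  (ka * s + q_ne u) ^+ 2 *
  ((q_ne u - 3 * ka * s) ^+ 2 - 4 * (q_nn u - q_ne u ^+ 2)) ^+ 3.

Lemma hp_axial_octic i u : U u -> has_partial i u axial_octic 0.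
Proof.
move=> Uu; have hs := hpD (hp_npart y i Uu) (hpC i u (- H^-1)).
have hn := hp_nn i Uu; have hw := hp_ne i Uu.
have hE := hpD (hpM (hpC i u ka) hs) hw.
have hG := hpD (hpX 2 (hpD hw (hpN (hpM (hpC i u (3 * ka)) hs))))
  (hpN (hpM (hpC i u 4) (hpD hn (hpN (hpX 2 hw))))).
have [d p] := hpM (hpX 2 hE) (hpX 3 hG).
split; first exact: d.
rewrite [LHS]p {p d hE hG hs hn hw}.
have H0 : H != 0 by rewrite HE mulf_neq0 ?expf_neq0// oppr_eq0 pnatr_eq0.
have -> : H * npart y u - 1 = H * (npart y u - H^-1) by rewrite mulrBr divff.
rewrite aE// -/(v u).
have -> : dot (t i u) (ka *: ((5 * q_ne u ^+ 2 - q_nn u) *: e u - (2 * q_ne u) *: v u)) =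
    ka * ((5 * q_ne u ^+ 2 - q_nn u) * dot (t i u) (e u) - 2 * q_ne u * dot (t i u) (v u)).
  by rewrite !dotE !mxE; ring.
rewrite (dotC (v u)).
move: (npart y u - H^-1) (q_ne u) (q_nn u) (dot _ (v u)) (dot _ (e u)) => b1 b2 b3 b4 b5.
by rewrite /= HE; ring.
Qed.

End AxialCase.

End AtPoint.
End Integration.

(** * Open images and coordinates on the model hypersurfaces *)

Section OpenImage.
Context {R : realType}.

Lemma smx_continuous n m (U : set 'rV[R]_n) (g : 'rV[R]_n -> 'rV[R]_m) u :
  smx U g -> U u -> {for u, continuous g}.
Proof.
move=> sg Uu B /nbhs_ballP[e /= e0 HB].
have N k : \forall v \near u, `|g u 0 k - g v 0 k| < e.
  have : {for u, continuous (fun v => g v 0 k)}.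
    by apply: differentiable_continuous; exact: sm_diff (sg 0 k) Uu.
  by move/cvgrPdist_lt => /(_ e e0).
have : nbhs u [set v | forall k, `|g u 0 k - g v 0 k| < e] by exact: (@filter_forall _ _ _ (nbhs u) (nbhs_filter u) N).
move=> W; suff : nbhs u (g @^-1` B) by [].
apply: (@filterS _ (nbhs u) (nbhs_filter u) _ _ _ W) => v H; apply: HB; rewrite -ball_normE /=.
by apply: norm_lt_coord => // k; rewrite !mxE.
Qed.

Lemma open_preimage n m (U : set 'rV[R]_n) (g : 'rV[R]_n -> 'rV[R]_m) (O : set 'rV[R]_m) :
  open U -> smx U g -> open O -> open (U `&` g @^-1` O).
Proof.
move=> Uo sg Oo; rewrite openE => u [Uu Ou]; apply: filterI.
  exact: open_nbhs_nbhs.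
by apply: (smx_continuous sg Uu); exact: open_nbhs_nbhs.
Qed.

Lemma open_mulmx_ball n m (P : 'M[R]_(n, m)) (y : 'rV[R]_m) (e : R) :
  open [set z : 'rV[R]_n | `|z *m P - y| < e].
Proof.
rewrite openE => z /= ze; have [C C0 HC] := norm_mulmx_le P.
apply/nbhs_ballP; exists ((e - `|z *m P - y|) / C) => /=; first by rewrite divr_gt0// subr_gt0.
move=> w; rewrite -ball_normE /= => zw.
have -> : w *m P - y = (z *m P - y) - (z - w) *m P by rewrite mulmxBl opprB [RHS]addrC addrA subrK.
apply: le_lt_trans (ler_normB _ _) _; rewrite -ltrBrDl.
by apply: le_lt_trans (HC _) _; rewrite mulrC -ltr_pdivlMr.
Qed.

(** After projection by [P], [g] covers a neighbourhood in R^3 by [locally_surjective]. As [P] is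
    injective on the part of [S] in [O0], every point of that part whose projection is close to that
    of [g u0] is a value of [g]. *)
Lemma open_image (U : set 'rV[R]_3) (g : 'rV[R]_3 -> 'rV[R]_4) (P : 'M[R]_(4, 3))
    (S O0 : set 'rV[R]_4) u0 : open U -> smx U g -> U u0 ->
  jac g u0 *m P \in unitmx -> open O0 -> O0 (g u0) -> (forall u, U u -> S (g u)) ->
  (forall z z', S z -> O0 z -> S z' -> O0 z' -> z *m P = z' *m P -> z = z') ->
  exists W, [/\ open W, W u0, W `<=` U & open_part (g @` W) S].
Proof.
move=> Uo sg Uu0 uP O0o O0u gS inj; pose U' := U `&` g @^-1` O0.
have U'o : open U' by exact: open_preimage.
pose pr u := g u *m P.
have sP : smx U (fun=> P) by exact: smx_cst.
have spr : smx U pr by exact: smxM.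
have jE : jac pr u0 = jac g u0 *m P.
  apply/row_matrixP => i; rewrite row_mul !row_jac (dmM i Uo sg sP Uu0) dm_cst.
  by rewrite mulmx0 addr0.
have spr' k : smooth_on U' (fun v => pr v 0 k) by move=> s u [Uu _]; exact: spr.
have [|e e0 H] := locally_surjective U'o spr' (conj Uu0 O0u); first by rewrite jE.
pose O := O0 `&` [set z | `|z *m P - pr u0| < e].
have Oo : open O by apply: openI => //; exact: open_mulmx_ball.
exists (U `&` g @^-1` O); split.
- exact: open_preimage.
- by split=> //; split=> //=; rewrite subrr normr0.
- by move=> u [].
exists O => //; apply/seteqP; split.
  by move=> _ [u [Uu Ou] <-]; split=> //; exact: gS.
move=> z [Sz [zO ze]].
have [v [Uv Ov] E] := H _ ze.
have vz : g v = z by apply: inj => //; exact: gS.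
exists v => //; split=> //; split=> //=.
by rewrite -/(pr v) E.
Qed.

End OpenImage.

Lemma unitmx_inj (R : realType) n (L : 'M[R]_n) :
  (forall w : 'rV[R]_n, w *m L = 0 -> w = 0) -> L \in unitmx.
Proof. by move=> H; rewrite -row_free_unit; exact: inj_row_free. Qed.

(** Projection forgetting the first coordinate; both model hypersurfaces are locally graphs over the
    other three. *)
Definition tail_mx (R : realType) : 'M[R]_(4, 3) := \matrix_(i, j) (i == j.+1 :> nat)%:R.

Lemma mul_tail_mx (R : realType) (z : 'rV[R]_4) j : (z *m tail_mx R) 0 j = z 0 (lift 0 j).
Proof.
rewrite mxE (bigD1 (lift 0 j))//= mxE eqxx mulr1 big1 ?addr0// => i ij.
rewrite mxE (_ : _ == _ = false) ?mulr0//; apply/negbTE; apply: contra ij => /eqP E.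
by apply/eqP/val_inj.
Qed.

Lemma mul_tail_eq (R : realType) (z z' : 'rV[R]_4) : z *m tail_mx R = z' *m tail_mx R ->
  [/\ z 0 1 = z' 0 1, z 0 2 = z' 0 2 & z 0 3 = z' 0 3].
Proof.
move=> /rowP E; split.
- by have := E i0; rewrite !mul_tail_mx (_ : lift 0 i0 = 1)//; exact: val_inj.
- by have := E i1; rewrite !mul_tail_mx (_ : lift 0 i1 = 2)//; exact: val_inj.
- by have := E i2; rewrite !mul_tail_mx (_ : lift 0 i2 = 3)//; exact: val_inj.
Qed.

Lemma rv4P (R : realType) (z z' : 'rV[R]_4) : z 0 0 = z' 0 0 -> z 0 1 = z' 0 1 ->
  z 0 2 = z' 0 2 -> z 0 3 = z' 0 3 -> z = z'.
Proof.
move=> h0 h1 h2 h3; apply/rowP => -[[|[|[|[|//]]]] p].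
- by rewrite (_ : Ordinal p = 0)//; exact: val_inj.
- by rewrite (_ : Ordinal p = 1)//; exact: val_inj.
- by rewrite (_ : Ordinal p = 2)//; exact: val_inj.
- by rewrite (_ : Ordinal p = 3)//; exact: val_inj.
Qed.

Section LocalForm.
Context {R : realType} (U : set 'rV[R]_3) (f xi : 'rV[R]_3 -> 'rV[R]_4) (H : R)
  (A : adapted_frame U f xi H).
Hypotheses (Uo : open U) (sf : smx U f).
Let k := fr_k A.

Lemma part_self u : tpart A (f u) u = 0 /\ npart A (f u) u = 0.
Proof. by rewrite /tpart /npart subrr !mul0mx mxE. Qed.

Lemma constant_along (F : 'rV[R]_4 -> 'rV[R]_3 -> R) u0 r : (forall v, ball u0 r v -> U v) ->
  (forall y i u, U u -> has_partial i u (F y) 0) ->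
  forall y v, ball u0 r v -> F y v = F y u0.
Proof.
move=> bU HF y; apply: constant_on_ball => [v bv|v i bv].
  by have [] := HF y i0 v (bU _ bv).
by have [] := HF y i v (bU _ bv).
Qed.

Section Target.
Variables (u0 : 'rV[R]_3) (Mv : 'M[R]_(3, 4)) (Ms t0 : 'rV[R]_4).
Hypotheses (Uu0 : U u0)
  (Minj : forall v (s : R), v *m Mv + s *: Ms = 0 -> v = 0 /\ s = 0).

Definition target_mx : 'M[R]_4 := fr_p A u0 *m Mv + fr_nu A u0 *m Ms.
Definition target_shift : 'rV[R]_4 := t0 - f u0 *m target_mx.

Lemma mul_target_mx (w : 'rV[R]_4) : w *m target_mx =
  w *m fr_p A u0 *m Mv + (w *m fr_nu A u0) 0 0 *: Ms.
Proof.
have E : w *m fr_nu A u0 = ((w *m fr_nu A u0) 0 0)%:M by exact: mx11_scalar.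
by rewrite /target_mx mulmxDr !mulmxA {1}E mul_scalar_mx.
Qed.

Lemma target_mx_unit : target_mx \in unitmx.
Proof.
apply: unitmx_inj => w; rewrite mul_target_mx => /Minj[wp ws].
rewrite -[w]mulmx1 -(fr_pe A Uu0) mulmxDr !mulmxA wp mul0mx add0r.
by rewrite [w *m _]mx11_scalar ws mul_scalar_mx scale0r.
Qed.

Lemma target_coordE y : y *m target_mx + target_shift =
  tpart A y u0 *m Mv + npart A y u0 *: Ms + t0.
Proof.
by rewrite /target_shift addrCA [LHS]addrC -mulmxBl mul_target_mx addrC.
Qed.

Lemma jac_target (P : 'M[R]_(4, 3)) : Mv *m P \in unitmx ->
  jac (fun u => f u *m target_mx + target_shift) u0 *m P \in unitmx.
Proof.
move=> uP; have sL : smx U (fun=> target_mx) by exact: smx_cst.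
have -> : jac (fun u => f u *m target_mx + target_shift) u0 = jac f u0 *m target_mx.
  apply/row_matrixP => i; rewrite row_mul !row_jac.
  rewrite (dmD i (smxM Uo sf sL) (smx_cst (U := U) target_shift) Uu0) dm_cst addr0.
  by rewrite (dmM i Uo sf sL Uu0) dm_cst mulmx0 addr0.
rewrite (fr_jac A Uu0) /target_mx mulmxDr !mulmxA -(mulmxA _ _ (fr_p A u0)).
rewrite (fr_ep A Uu0) mulmx1 -(mulmxA _ _ (fr_nu A u0)) (fr_enu A Uu0) mulmx0 mul0mx addr0.
by rewrite -mulmxA unitmx_mul (fr_unit A Uu0).
Qed.

Lemma smx_target : smx U (fun u => f u *m target_mx + target_shift).
Proof.
apply: smxD => //; last exact: smx_cst.
by apply: smxM => //; exact: smx_cst.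
Qed.

End Target.

Definition local_equivalence (u0 : 'rV[R]_3) (S : set 'rV[R]_4) :=
  exists W (L : 'M[R]_4) (t : 'rV[R]_4), [/\ open W, W u0, W `<=` U,
    L \in unitmx & open_part ((fun u => f u *m L + t) @` W) S].

Lemma near_ball_subset u0 : U u0 -> exists2 r, 0 < r & forall v, ball u0 r v -> U v.
Proof. by move=> Uu; have /nbhs_ballP[r /= r0 B] := open_nbhs_nbhs (conj Uo Uu); exists r. Qed.

Theorem axial_local ka u0 : U u0 -> ka != 0 -> H = - 3 * ka ^+ 2 ->
  (forall u, U u -> axial ka (k^~ u)) -> local_equivalence u0 (hypersurface_ii R).
Proof.
move=> Uu0 ka0 HE k_axial; have [r r0 bU] := near_ball_subset Uu0.
have H0 : H != 0 by rewrite HE mulf_neq0 ?expf_neq0// oppr_eq0 pnatr_eq0.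
have [ee _] := axisP ka0 k_axial Uu0.
have [b bb be] := orthogonal_unit (axis k ka u0).
have [Q [QQ Q0 _]] : exists Q : 'M[R]_3,
    [/\ Q *m Q^T = 1%:M, row i0 Q = axis k ka u0 & row i1 Q = b].
  by apply: orthonormal_frame => //; rewrite /dot ee mxE eqxx.
have QtQ := mulmx1C QQ.
(* With [Ms], this gives z_0 = 3 ka (w_0 + ka s), z_3 = ka (w_0 - 3 ka s), and z_1, z_2 equal to 2
   ka times w_1, w_2. The polynomial of the model is then 9 ka^8 times [axial_octic], whose value at
   [f u] is the inverse of 9 ka^8. *)
pose M0 : 'M[R]_(3, 4) := \matrix_(i, j)
  nth 0 (nth [::] [:: [:: 3 * ka; 0; 0; ka]; [:: 0; 2 * ka; 0; 0]; [:: 0; 0; 2 * ka; 0]] i) j.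
pose Ms : 'rV[R]_4 := \row_j nth 0 [:: 3 * ka ^+ 2; 0; 0; - 3 * ka ^+ 2] j.
have coord (w : 'rV[R]_3) (s : R) : let z := w *m M0 + s *: Ms in
   [/\ z 0 0 = 3 * ka * w 0 i0 + 3 * ka ^+ 2 * s, z 0 1 = 2 * ka * w 0 i1,
       z 0 2 = 2 * ka * w 0 i2 & z 0 3 = ka * w 0 i0 - 3 * ka ^+ 2 * s].
  by split; rewrite !mxE sum3 !mxE /=; ring.
have can (c x : R) : c != 0 -> c * x = 0 -> x = 0.
  by move=> c0 /eqP; rewrite mulf_eq0 (negbTE c0) => /eqP.
have two0 : 2 * ka != 0 by rewrite mulf_neq0 ?pnatr_eq0.
have M0inj (w : 'rV[R]_3) (s : R) : w *m M0 + s *: Ms = 0 -> w = 0 /\ s = 0.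
  have [z0 z1 z2 z3] := coord w s.
  move=> Z; rewrite Z !mxE in z0 z1 z2 z3.
  have w0 : w 0 i0 = 0 by apply: (can (4 * ka)); [rewrite mulf_neq0 ?pnatr_eq0|lra].
  have w1 := can _ _ two0 (esym z1); have w2 := can _ _ two0 (esym z2).
  split; first by apply: rv3P; rewrite mxE.
  apply: (can (3 * ka ^+ 2)); first by rewrite mulf_neq0 ?expf_neq0// pnatr_eq0.
  by move: z0; rewrite w0; lra.
pose Mv := Q^T *m M0.
have Minj (v : 'rV[R]_3) (s : R) : v *m Mv + s *: Ms = 0 -> v = 0 /\ s = 0.
  rewrite /Mv mulmxA => /M0inj[v0 ->]; split=> //.
  by rewrite -[v]mulmx1 -QtQ mulmxA v0 mul0mx.
(* Moves the origin to the center of the hypersphere, where s = 1 / H. *)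
pose t0 := - H^-1 *: Ms.
pose g u := f u *m target_mx u0 Mv Ms + target_shift u0 Mv Ms t0.
have gE u : g u = (tpart A (f u) u0 *m Q^T) *m M0 + (npart A (f u) u0 - H^-1) *: Ms.
  by rewrite /g target_coordE /Mv /t0 mulmxA -addrA scalerBl scaleNr.
have uP : Mv *m tail_mx R \in unitmx.
  rewrite /Mv -mulmxA unitmx_mul; apply/andP; split; first by have [] := mulmx1_unit QtQ.
  apply: unitmx_inj => w; rewrite mulmxA => Z.
  have [_ z1 z2 z3] := coord w 0; rewrite scale0r addr0 in z1 z2 z3.
  have [|y1 y2 y3] := @mul_tail_eq _ (w *m M0) 0; first by rewrite Z mul0mx.
  rewrite z1 mxE in y1; rewrite z2 mxE in y2; rewrite z3 mxE mulr0 subr0 in y3.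
  by apply: rv3P; rewrite mxE; [exact: can y3|exact: can y1|exact: can y2].
have gS u : ball u0 r u -> hypersurface_ii R (g u).
  move=> bu; rewrite /hypersurface_ii /= gE.
  have [-> -> -> ->] := coord (tpart A (f u) u0 *m Q^T) (npart A (f u) u0 - H^-1).
  have E : axial_octic A (f u) ka u0 = axial_octic A (f u) ka u.
    apply/esym/(constant_along (F := fun y u => axial_octic A y ka u) bU _ (f u) bu) => y i v Uv.
    exact: (hp_axial_octic Uo sf y ka0 HE k_axial i Uv).
  have [v0 s0] := part_self u.
  have E1 : axial_octic A (f u) ka u = (9 * ka ^+ 8)^-1.
    rewrite /axial_octic /q_ne /q_nn v0 s0 /dot !mul0mx mxE HE.
    by field; rewrite ka0.
  have w0 : (tpart A (f u) u0 *m Q^T) 0 i0 = q_ne A (f u) ka u0.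
    rewrite /q_ne -Q0 dotE mxE sum3 !mxE; ring.
  have nn : q_nn A (f u) u0 = dot (tpart A (f u) u0 *m Q^T) (tpart A (f u) u0 *m Q^T).
    by rewrite dot_rot// trmxK.
  move: E; rewrite E1 /axial_octic -w0 nn dotE.
  move: (tpart A (f u) u0 *m Q^T) (npart A (f u) u0 - H^-1) => w s E.
  transitivity (9 * ka ^+ 8 * (9 * ka ^+ 8)^-1); last first.
    by rewrite divff// mulf_neq0 ?expf_neq0// pnatr_eq0.
  by rewrite -E; ring.
(* The first coordinate enters the equation through its square; fixing its sign selects one sheet, a
   graph over the other coordinates. *)
pose O0 := [set z : 'rV[R]_4 | 0 < z 0 0 * g u0 0 0].
have sg : smx U g by exact: smx_target.
have bo : open (ball u0 r) by exact: ball_open.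
have bu0 : ball u0 r u0 by exact: ballxx.
have sg' : smx (ball u0 r) g by move=> a c s v bv; apply: sg; exact: bU.
have S0 z : hypersurface_ii R z -> z 0 0 != 0.
  by move=> Sz; apply/eqP => z0; move: Sz; rewrite /hypersurface_ii /= z0 expr0n mul0r => /eqP; rewrite eq_sym oner_eq0.
have [|||||W [Wo Wu0 WU WS]] := @open_image _ (ball u0 r) g (tail_mx R) (hypersurface_ii R) O0 u0 bo sg' bu0.
- exact: jac_target.
- have c0 : continuous (fun z : 'rV[R]_4 => z 0 0 * g u0 0 0).
    by move=> z; apply: continuousM; [exact: coord_continuous|exact: cst_continuous].
  have := @open_comp _ _ (fun z : 'rV[R]_4 => z 0 0 * g u0 0 0) [set x : R | 0 < x].
  by apply => [z _|]; [exact: c0|exact: open_gt].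
- by rewrite /O0 /= -expr2 exprn_even_gt0//= S0//; exact: gS.
- exact: gS.
- move=> z z' Sz Oz Sz' Oz' /mul_tail_eq[h1 h2 h3]; apply: rv4P => //.
  have := Sz'; have := Sz; rewrite /hypersurface_ii /= h1 h2 h3.
  move: Oz Oz'; rewrite /O0 /=; move: (z 0 0) (z' 0 0) (g u0 0 0) (_ ^+ 3) => x x' y c xy xy' E E'.
  have c0 : c != 0 by apply/eqP => c0; move: E; rewrite c0 mulr0 => /eqP; rewrite eq_sym oner_eq0.
  have s0 : x + x' != 0.
    have sy : 0 < (x + x') * y by rewrite mulrDl addr_gt0.
    by apply/eqP => s0; move: sy; rewrite s0 mul0r ltxx.
  have : (c * (x + x')) * (x - x') = 0 by move: E E'; rewrite !expr2; lra.
  by move/(can _ _ (mulf_neq0 c0 s0))/eqP; rewrite subr_eq0 => /eqP.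
by exists W, (target_mx u0 Mv Ms), (target_shift u0 Mv Ms t0); split=> //;
  [move=> v /WU /bU|exact: target_mx_unit].
Qed.

End LocalForm.

(** * The tetrahedral form *)

Section Tetrahedral.
Context {R : realType}.
Implicit Types (K : 'I_3 -> 'M[R]_3) (Q : 'M[R]_3).

Lemma rot3_comp Q Q' K : rot3 Q (rot3 Q' K) = rot3 (Q *m Q') K.
Proof. by apply/funext => a; rewrite /rot3 contr_rot row_mul trmx_mul !mulmxA. Qed.

(* The polynomial takes opposite signs at [0] and [r]. *)
Lemma cubic_root (r : R) : exists t, t ^+ 3 - 3 * r * t ^+ 2 - 3 * t + r = 0.
Proof.
pose P : {poly R} := 'X^3 - (3 * r) *: 'X^2 - 3 *: 'X + r%:P.
have PE t : P.[t] = t ^+ 3 - 3 * r * t ^+ 2 - 3 * t + r.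
  by rewrite /P !hornerE /=; ring.
have Pr : P.[r] = - (2 * r * (1 + r ^+ 2)) by rewrite PE; ring.
have P0 : P.[0] = r by rewrite PE; ring.
have r2 : 0 <= r ^+ 2 by exact: sqr_ge0.
case: (leP 0 r) => r0.
  have [||t _ /rootP E] := @poly_ivt _ (- P) 0 r => //.
    by rewrite !hornerN P0 Pr; apply/andP; split; [lra|nra].
  by exists t; rewrite -PE; move: E; rewrite hornerN => /eqP; rewrite oppr_eq0 => /eqP.
have [||t _ /rootP E] := @poly_ivt _ (- P) r 0; first exact: ltW.
  by rewrite !hornerN P0 Pr; apply/andP; split; [nra|lra].
by exists t; rewrite -PE; move: E; rewrite hornerN => /eqP; rewrite oppr_eq0 => /eqP.
Qed.

(** The tangent t = s / c of the angle solves the cubic of [cubic_root] with r = q / p. A rotation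
    by this angle about the first axis removes the parameter [q] of the normal form. *)
Lemma trisection (p q : R) : exists c s,
  c ^+ 2 + s ^+ 2 = 1 /\ q * c ^+ 3 - 3 * p * c ^+ 2 * s - 3 * q * c * s ^+ 2 + p * s ^+ 3 = 0.
Proof.
have [->|p0] := eqVneq p 0.
  by exists 0, 1; split; ring.
have [t tE] := cubic_root (q / p).
have t1 : 0 < 1 + t ^+ 2 by rewrite ltr_pwDl ?ltr01 ?sqr_ge0.
pose c := (Num.sqrt (1 + t ^+ 2))^-1.
have c2 : c ^+ 2 * (1 + t ^+ 2) = 1.
  by rewrite /c exprVn sqr_sqrtr ?mulVf ?gt_eqF// ltW.
exists c, (t * c); split; first by rewrite -[RHS]c2; ring.
transitivity (p * c ^+ 3 * (t ^+ 3 - 3 * (q / p) * t ^+ 2 - 3 * t + q / p)); first by field.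
by rewrite tE mulr0.
Qed.

Lemma contr_nf l1 l2 l3 p q (w : 'rV[R]_3) : contr (nf l1 l2 l3 p q) w =
  mx3 (l1 * w 0 i0) (l2 * w 0 i1) (l3 * w 0 i2)
      (l2 * w 0 i1) (l2 * w 0 i0 + p * w 0 i1 + q * w 0 i2) (q * w 0 i1 - p * w 0 i2)
      (l3 * w 0 i2) (q * w 0 i1 - p * w 0 i2) (l3 * w 0 i0 - p * w 0 i1 - q * w 0 i2).
Proof. by apply: mx3P; rewrite contrE !mxE /=; ring. Qed.

Lemma tetrahedral_nf l K : cubic K -> tetrahedral l K ->
  exists Q p, [/\ Q *m Q^T = 1%:M, rot3 Q K = nf l (- (l / 2)) (- (l / 2)) p 0 &
    2 * p ^+ 2 = l ^+ 2].
Proof.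
move=> cK [Q [p [q [QQ E pq]]]]; have [c [s [cs q0]]] := trisection p q.
pose Q' := mx3 1 0 0 0 c s 0 (- s) c.
have Q'Q' : Q' *m Q'^T = 1%:M by apply: mx3P; rewrite !mxE sum3 !mxE /=; lra.
have QQ' : (Q' *m Q) *m (Q' *m Q)^T = 1%:M.
  by rewrite trmx_mul mulmxA -(mulmxA Q') QQ mulmx1.
pose p' := p * c ^+ 3 + 3 * q * c ^+ 2 * s - 3 * p * c * s ^+ 2 - q * s ^+ 3.
exists (Q' *m Q), p'; split=> //.
  rewrite -rot3_comp E; have cN := rot_cubic QQ cK; rewrite E in cN.
  have cN' := rot_cubic Q'Q' cN.
  have RE a b d : rot3 Q' (nf l (- (l / 2)) (- (l / 2)) p q) a b d =
     (row b Q' *m contr (nf l (- (l / 2)) (- (l / 2)) p q) (row a Q') *m (row d Q')^T) 0 0.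
    exact: rot_tri.
  have c2 : c * c = 1 - s * s by lra.
  by apply: nf_of_cubic => //; rewrite RE contr_nf mulmx3E !mxE /= !sum3 !mxE /= /p'; first [ring: c2|lra].
have -> : 2 * p' ^+ 2 = 2 * (p' ^+ 2 +
   (q * c ^+ 3 - 3 * p * c ^+ 2 * s - 3 * q * c * s ^+ 2 + p * s ^+ 3) ^+ 2).
  by rewrite q0; ring.
transitivity (2 * (p ^+ 2 + q ^+ 2) * (c ^+ 2 + s ^+ 2) ^+ 3); first by rewrite /p'; ring.
by rewrite cs expr1n mulr1.
Qed.

Lemma tetra_relation_rot H Q K : Q *m Q^T = 1%:M ->
  tetra_relation H (rot3 Q K) -> tetra_relation H K.
Proof.
move=> QQ rel w; have QtQ := mulmx1C QQ.
have := rel (w *m Q^T); rewrite contr_rot -(mulmxA w Q^T Q) QtQ mulmx1.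
move: (contr K w) => C.
have E (x : 'rV[R]_3) : x *m Q^T *m (Q *m C *m Q^T) = x *m C *m Q^T.
  by rewrite !mulmxA -(mulmxA x Q^T Q) QtQ mulmx1.
have QTT : Q^T *m Q^T^T = 1%:M by rewrite trmxK.
rewrite !E !(dot_rot _ _ QTT) !scalemxAl -mulmxDl scalemxAl => /(congr1 (mulmx^~ Q)) /=.
by rewrite -!(mulmxA _ Q^T Q) QtQ !mulmx1.
Qed.

Lemma tetra_relation_nf (l p : R) : 2 * p ^+ 2 = l ^+ 2 ->
  tetra_relation (- (3 / 4) * l ^+ 2) (nf l (- (l / 2)) (- (l / 2)) p 0).
Proof.
move=> pp w; rewrite contr_nf !mul0r !add0r !addr0 !subr0.
have ll : l * l = 2 * p * p by rewrite -expr2 -pp; ring.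
pose x := w 0 i0; pose y := w 0 i1; pose z := w 0 i2.
have -> : w = rv3 x y z by apply: rv3P; rewrite mxE.
rewrite !mxE /=.
pose C := mx3 (l * x) (- (l / 2) * y) (- (l / 2) * z)
  (- (l / 2) * y) (- (l / 2) * x + p * y) (- (p * z))
  (- (l / 2) * z) (- (p * z)) (- (l / 2) * x - p * y).
rewrite -/C.
have Cm (a b c : R) : rv3 a b c *m C = rv3
   (a * (l * x) + b * (- (l / 2) * y) + c * (- (l / 2) * z))
   (a * (- (l / 2) * y) + b * (- (l / 2) * x + p * y) + c * (- (p * z)))
   (a * (- (l / 2) * z) + b * (- (p * z)) + c * (- (l / 2) * x - p * y)).
  by apply: rv3P; rewrite !mxE sum3 !mxE.
rewrite !Cm !dotE; apply: rv3P; rewrite !mxE /=; move: x y z => x y z in C Cm *.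
- by field: ll.
- by field: ll.
- by field: ll.
Qed.

Lemma gram_rot Q K : Q *m Q^T = 1%:M -> gram (rot3 Q K) = Q *m gram K *m Q^T.
Proof.
move=> QQ; have QtQ := mulmx1C QQ; apply/matrixP => a b; rewrite mxE /rot3.
have -> : \tr (Q *m contr K (row a Q) *m Q^T *m (Q *m contr K (row b Q) *m Q^T)) =
   \tr (contr K (row a Q) *m contr K (row b Q)).
  rewrite !mulmxA -(mulmxA (Q *m _)) QtQ mulmx1 mxtrace_mulC !mulmxA QtQ mul1mx //.
rewrite /contr mulmx_sum2 linear_sum /= mxE.
under eq_bigr do rewrite linear_sum /=.
rewrite exchange_big /=; apply: eq_bigr => d _; rewrite !mxE mulr_suml.
by apply: eq_bigr => c _; rewrite linearZ /= !mxE; ring.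
Qed.

Lemma tr_gram_tetrahedral l K : tetrahedral l K -> \tr (gram K) = 9 / 2 * l ^+ 2.
Proof.
move=> [Q [p [q [QQ E pq]]]]; have QtQ := mulmx1C QQ.
have -> : \tr (gram K) = \tr (gram (rot3 Q K)).
  by rewrite gram_rot// mxtrace_mulC mulmxA QtQ mul1mx.
rewrite E trace3 !mxE !trace3 !mxE !sum3 !mxE /=.
by move: pq; rewrite !expr2; lra.
Qed.

End Tetrahedral.

Lemma nf_square (R : realType) (l p : R) (w : 'rV[R]_3) :
  w *m contr (nf l (- (l / 2)) (- (l / 2)) p 0) w =
  rv3 (l * w 0 i0 ^+ 2 - l / 2 * (w 0 i1 ^+ 2 + w 0 i2 ^+ 2))
      (- (l * w 0 i0 * w 0 i1) + p * (w 0 i1 ^+ 2 - w 0 i2 ^+ 2))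
      (- (l * w 0 i0 * w 0 i2) - 2 * p * w 0 i1 * w 0 i2).
Proof. by rewrite contr_nf; apply: rv3P; rewrite !mxE sum3 !mxE /=; field. Qed.

Section LocalForm.
Context {R : realType} (U : set 'rV[R]_3) (f xi : 'rV[R]_3 -> 'rV[R]_4) (H : R)
  (A : adapted_frame U f xi H).
Hypotheses (Uo : open U) (sf : smx U f).
Let k := fr_k A.

Theorem tetrahedral_local l u0 : U u0 -> 0 < l -> H = - (3 / 4) * l ^+ 2 ->
  (forall u, U u -> tetrahedral l (k^~ u)) ->
  local_equivalence U f u0 (hypersurface_i R).
Proof.
move=> Uu0 l0 HE k_tet; have [r r0 bU] := near_ball_subset Uo Uu0.
have ln0 : l != 0 by rewrite gt_eqF.
have H0 : H != 0 by rewrite HE mulf_neq0 ?expf_neq0// oppr_eq0 mulf_neq0 ?invr_eq0 ?pnatr_eq0.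
have [Q [p [QQ QK pp]]] := tetrahedral_nf (fr_cubic A Uu0) (k_tet _ Uu0).
have p0 : p != 0.
  apply/eqP => p0; move: pp; rewrite p0 expr0n mulr0 => /esym/eqP.
  by rewrite sqrf_eq0 (negbTE ln0).
have QtQ := mulmx1C QQ.
pose r3 : R := Num.sqrt 3; have r33 : r3 * r3 = 3 by rewrite -expr2 sqr_sqrtr.
have r30 : r3 != 0 by rewrite gt_eqF// sqrtr_gt0.
(* The columns are the vertices of a regular tetrahedron of circumradius 3 l / 2, since 2 p^2 = l^2,
   the first one on the axis. The common term in [Ms] is - H s, with s measured from the center,
   which makes each of the four affine functions equal to 1 at the base point of the frame. *)
pose M0 : 'M[R]_(3, 4) := \matrix_(i, j)
  nth 0 (nth [::] [:: [:: 3 * (l / 2); - (l / 2); - (l / 2); - (l / 2)];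
    [:: 0; 2 * p; - p; - p]; [:: 0; 0; r3 * p; - (r3 * p)]] i) j.
pose Ms : 'rV[R]_4 := const_mx (3 / 4 * l ^+ 2).
have coord (w : 'rV[R]_3) (s : R) : let z := w *m M0 + s *: Ms in
   [/\ z 0 0 = 3 * (l / 2) * w 0 i0 + 3 / 4 * l ^+ 2 * s,
       z 0 1 = - (l / 2) * w 0 i0 + 2 * p * w 0 i1 + 3 / 4 * l ^+ 2 * s,
       z 0 2 = - (l / 2) * w 0 i0 - p * w 0 i1 + r3 * p * w 0 i2 + 3 / 4 * l ^+ 2 * s &
       z 0 3 = - (l / 2) * w 0 i0 - p * w 0 i1 - r3 * p * w 0 i2 + 3 / 4 * l ^+ 2 * s].
  by split; rewrite !mxE sum3 !mxE /=; ring.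
have can (c x : R) : c != 0 -> c * x = 0 -> x = 0.
  by move=> c0 /eqP; rewrite mulf_eq0 (negbTE c0) => /eqP.
have can3 (w : 'rV[R]_3) : l * w 0 i0 = 0 -> 2 * p * w 0 i1 = 0 -> r3 * p * w 0 i2 = 0 -> w = 0.
  move=> e0 e1 e2; apply: rv3P; rewrite mxE.
  - exact: can e0.
  - by apply: can e1; rewrite mulf_neq0 ?pnatr_eq0.
  - by apply: can e2; rewrite mulf_neq0.
have M0inj (w : 'rV[R]_3) (s : R) : w *m M0 + s *: Ms = 0 -> w = 0 /\ s = 0.
  have [z0 z1 z2 z3] := coord w s.
  move=> Z; rewrite Z !mxE in z0 z1 z2 z3.
  have s0 : 3 / 4 * l ^+ 2 * s = 0 by lra.
  rewrite s0 in z0 z1 z2 z3; split; first by apply: can3; lra.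
  by apply: can s0; rewrite mulf_neq0 ?expf_neq0// mulf_neq0 ?invr_eq0 ?pnatr_eq0.
pose Mv := Q^T *m M0.
have Minj (v : 'rV[R]_3) (s : R) : v *m Mv + s *: Ms = 0 -> v = 0 /\ s = 0.
  rewrite /Mv mulmxA => /M0inj[v0 ->]; split=> //.
  by rewrite -[v]mulmx1 -QtQ mulmxA v0 mul0mx.
pose t0 := - H^-1 *: Ms.
pose g u := f u *m target_mx A u0 Mv Ms + target_shift A u0 Mv Ms t0.
have gE u : g u = (tpart A (f u) u0 *m Q^T) *m M0 + (npart A (f u) u0 - H^-1) *: Ms.
  by rewrite /g target_coordE /Mv /t0 mulmxA -addrA scalerBl scaleNr.
have uP : Mv *m tail_mx R \in unitmx.
  rewrite /Mv -mulmxA unitmx_mul; apply/andP; split; first by have [] := mulmx1_unit QtQ.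
  apply: unitmx_inj => w; rewrite mulmxA => Z.
  have [_ z1 z2 z3] := coord w 0; rewrite scale0r addr0 mulr0 addr0 in z1 z2 z3.
  have [|y1 y2 y3] := @mul_tail_eq _ (w *m M0) 0; first by rewrite Z mul0mx.
  rewrite z1 mxE in y1; rewrite z2 mxE in y2; rewrite z3 mxE in y3.
  by apply: can3; lra.
have gS u : ball u0 r u -> hypersurface_i R (g u).
  move=> bu; rewrite /hypersurface_i /= gE.
  have [-> -> -> ->] := coord (tpart A (f u) u0 *m Q^T) (npart A (f u) u0 - H^-1).
  have E : quartic_form A (f u) u0 = quartic_form A (f u) u.
    apply/esym/(constant_along (F := quartic_form A) bU _ (f u) bu) => y i v Uv.
    apply: (hp_quartic_form Uo sf y i H0 Uv).
    have [Q' [p' [QQ' E' pp']]] := tetrahedral_nf (fr_cubic A Uv) (k_tet _ Uv).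
    by apply: (tetra_relation_rot QQ'); rewrite E' HE; exact: tetra_relation_nf.
  have [v0 s0] := part_self A u.
  have E1 : quartic_form A (f u) u = 1.
    rewrite /quartic_form /q_na /q_aa /q_nn v0 s0 /dot !mul0mx !mxE.
    by field.
  have QTT : Q^T *m Q^T^T = 1%:M by rewrite trmxK.
  move: E; rewrite E1 /quartic_form /q_na /q_aa /q_nn.
  have D x y : dot x y = dot (x *m Q^T) (y *m Q^T) by rewrite dot_rot.
  rewrite (D (tpart A (f u) u0) (tpart A (f u) u0)).
  rewrite (D (tpart A (f u) u0 *m contr (fr_k A^~ u0) (tpart A (f u) u0)) (tpart A (f u) u0)).
  rewrite (D (tpart A (f u) u0 *m contr (fr_k A^~ u0) (tpart A (f u) u0))
    (tpart A (f u) u0 *m contr (fr_k A^~ u0) (tpart A (f u) u0))).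
  have -> : tpart A (f u) u0 *m contr (fr_k A^~ u0) (tpart A (f u) u0) *m Q^T =
    (tpart A (f u) u0 *m Q^T) *m contr (rot3 Q (k^~ u0)) (tpart A (f u) u0 *m Q^T).
    rewrite contr_rot -(mulmxA _ Q^T Q) QtQ mulmx1.
    by rewrite !mulmxA -(mulmxA (tpart _ _ _) Q^T Q) QtQ mulmx1.
  rewrite QK nf_square.
  move: (tpart A (f u) u0 *m Q^T) (npart A (f u) u0 - _) => w s.
  rewrite !dotE !mxE /= HE => E; rewrite -[RHS]E {E}.
  have ll : l * l = 2 * p * p by rewrite -expr2 -pp; ring.
  by field: ll r33.
have sg : smx U g by exact: smx_target.
have bo : open (ball u0 r) by exact: ball_open.
have bu0 : ball u0 r u0 by exact: ballxx.
have sg' : smx (ball u0 r) g by move=> a c s v bv; apply: sg; exact: bU.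
have [|||||W [Wo Wu0 WU WS]] := @open_image _ (ball u0 r) g (tail_mx R) (hypersurface_i R) setT u0 bo sg' bu0.
- exact: jac_target.
- exact: openT.
- by [].
- exact: gS.
- move=> z z' Sz _ Sz' _ /mul_tail_eq[h1 h2 h3]; apply: rv4P => //.
  have := Sz'; have := Sz; rewrite /hypersurface_i /= h1 h2 h3 -!mulrA.
  move: (z 0 0) (z' 0 0) (z' 0 1 * _) => x x' c E E'.
  have c0 : c != 0 by apply/eqP => c0; move: E; rewrite c0 mulr0 => /eqP; rewrite eq_sym oner_eq0.
  have : c * (x - x') = 0 by lra.
  by move/(can _ _ c0)/eqP; rewrite subr_eq0 => /eqP.
by exists W, (target_mx A u0 Mv Ms), (target_shift A u0 Mv Ms t0); split=> //;
  [move=> v /WU /bU|exact: target_mx_unit].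
Qed.

End LocalForm.

Lemma derive_of_quadratic (R : realType) n (g : 'rV[R]_n -> R) (y v : 'rV[R]_n) (a b : R) :
  (forall r : R, g (r *: v + y) = g y + r * a + r ^+ 2 * b) -> 'D_v g y = a.
Proof.
move=> E; rewrite /derive; apply: cvg_lim => //.
have C : (fun r : R => a + r * b) @ 0^' --> a.
  have : {for (0 : R), continuous (fun r : R => a + r * b)}.
    by apply: continuousD; [exact: cst_continuous|apply: continuousM; [exact: cvg_id|exact: cst_continuous]].
  by move=> /continuous_withinNx; rewrite mul0r addr0.
apply: cvg_trans C; apply: near_eq_cvg; near=> r.
have r0 : r != 0 by near: r; exact: nbhs_dnbhs_neq.
rewrite -[RHS]/(r^-1 * (g (r *: v + y) - g y)) E.
by field.
Unshelve. all: by end_near.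
Qed.

(** * The quadric as a locally strongly convex level set *)

Section QuadricLevel.
Context {R : realType} (H : R) (f0 xi0 : 'rV[R]_4) (e : 'M[R]_(3, 4)) (p : 'M[R]_(4, 3))
  (nu : 'cV[R]_4).
Hypotheses (ep : e *m p = 1%:M) (enu : e *m nu = 0) (xip : xi0 *m p = 0)
  (xinu : xi0 *m nu = 1%:M) (pe : p *m e + nu *m xi0 = 1%:M).

Let V (y : 'rV[R]_4) : 'rV[R]_3 := y *m p.
Let s (y : 'rV[R]_4) : R := (y *m nu) 0 0.

Definition quadric_level (y : 'rV[R]_4) : R :=
  dot (V (y - f0)) (V (y - f0)) + H * s (y - f0) ^+ 2 - 2 * s (y - f0).

(** Quadratic part, linear part and constant of [quadric_level], expanded about the origin instead
    of [f0]. *)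
Let B : 'M[R]_4 := p *m p^T + H *: (nu *m nu^T).
Let b : 'rV[R]_4 := - (f0 *m B) - nu^T.
Let c : R := (f0 *m B *m f0^T) 0 0 + 2 * s f0.

Let quad (x y : 'rV[R]_4) : (x *m B *m y^T) 0 0 = dot (V x) (V y) + H * (s x * s y).
Proof.
rewrite /B mulmxDr mulmxDl -scalemxAr -scalemxAl mxE [X in _ + X]mxE; congr (_ + _ * _).
  by rewrite /dot /V trmx_mul !mulmxA.
have -> : x *m (nu *m nu^T) *m y^T = (x *m nu) *m (y *m nu)^T by rewrite trmx_mul !mulmxA.
by rewrite mxE big_ord1 [(_^T) _ _]mxE.
Qed.

Let BT : B^T = B.
Proof. by rewrite /B linearD linearZ /= !trmx_mul !trmxK. Qed.

Let nuT (y : 'rV[R]_4) : (nu^T *m y^T) 0 0 = s y.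
Proof. by rewrite -trmx_mul mxE. Qed.

Let VB x y : V (x - y) = V x - V y. Proof. exact: mulmxBl. Qed.
Let sB x y : s (x - y) = s x - s y. Proof. by rewrite /s mulmxBl !mxE. Qed.

Let bE y : (b *m y^T) 0 0 = - (dot (V f0) (V y) + H * (s f0 * s y)) - s y.
Proof. by rewrite /b mulmxBl mulNmx mxE [X in X + _]mxE quad [X in _ + X]mxE nuT. Qed.

Let levelE y : quadratic_function B b c y = quadric_level y.
Proof.
rewrite /quadratic_function /quadric_level quad.
rewrite bE /c quad VB sB; move: (s y) (s f0) (V y) (V f0) => s1 s2 v1 v2.
by rewrite !dotE !mxE; ring.
Qed.

Let decomp (w : 'rV[R]_4) : V w = 0 -> s w = 0 -> w = 0.
Proof.
move=> Vw sw; rewrite -[w]mulmx1 -pe mulmxDr !mulmxA -/(V w) Vw mul0mx add0r.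
by rewrite [w *m nu]mx11_scalar -/(s w) sw mul_scalar_mx scale0r.
Qed.

Let Ve (v : 'rV[R]_3) : V (v *m e) = v. Proof. by rewrite /V -mulmxA ep mulmx1. Qed.
Let se (v : 'rV[R]_3) : s (v *m e) = 0. Proof. by rewrite /s -mulmxA enu mulmx0 mxE. Qed.
Let Vxi : V xi0 = 0. Proof. exact: xip. Qed.
Let sxi : s xi0 = 1. Proof. by rewrite /s xinu mxE eqxx. Qed.

Let dot0 (v : 'rV[R]_3) : dot v v = 0 -> v = 0.
Proof.
move=> v0; apply: rv3P; rewrite mxE; apply/eqP; rewrite -sqrf_eq0 eq_le sqr_ge0 andbT -v0;
  exact: sqr_coord_le.
Qed.

(** For a kernel vector (x, r), the first block says that z = x - r f0 satisfies B(z, y) = r s(y)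
    for all [y]. Tangential [y] give V z = 0, [y = xi0] gives r = H s(z), and the last block then
    gives s(z) = 0. There is no division by [H], so paraboloids are included. *)
Let block_unit : (block_mx B b^T b c%:M : 'M[R]_(4 + 1)) \in unitmx.
Proof.
apply: unitmx_inj => w; rewrite -[w]hsubmxK; move: (lsubmx w) (rsubmx w) => x r'.
pose r := r' 0 0; rewrite (mul_row_block x r') [r']mx11_scalar -/r -[0]row_mx0.
move=> /eq_row_mx[]; rewrite !mul_scalar_mx => E1 E2.
pose z := x - r *: f0.
have E3 y : (z *m B *m y^T) 0 0 = r * s y.
  have := congr1 (fun X : 'rV[R]_4 => (X *m y^T) 0 0) E1.
  rewrite /= mul0mx mulmxDl -scalemxAl mxE [X in _ + X]mxE [RHS]mxE.
  rewrite bE !quad.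
  have -> : V z = V x - r *: V f0 by rewrite VB /V scalemxAl.
  have -> : s z = s x - r * s f0 by rewrite sB /s -scalemxAl [X in _ - X]mxE.
  move: (V x) (V f0) (V y) (s x) (s f0) (s y) => v1 v2 v3 s1 s2 s3.
  by rewrite !dotE !mxE; lra.
have Vz : V z = 0.
  by apply: dot0; have := E3 (V z *m e); rewrite quad Ve se !mulr0 addr0.
have rE : r = H * s z by have := E3 xi0; rewrite quad Vxi sxi /dot trmx0 mulmx0 mxE; lra.
have bx : (x *m b^T) 0 0 = - (dot (V f0) (V x) + H * (s f0 * s x)) - s x.
  by rewrite -bE -[in LHS](trmxK x) -trmx_mul mxE.
have zE : z = x - r *: f0 by [].
have sz : s z = 0.
  have := congr1 (fun X : 'M[R]_1 => X 0 0) E2.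
  have rc : (r *: (c%:M : 'M[R]_1)) 0 0 = r * c by rewrite !mxE eqxx mulr1n.
  rewrite /= mxE bx rc [RHS]mxE /c quad.
  have Vx : V x = r *: V f0.
    have : V x - r *: V f0 = 0 by rewrite -Vz zE VB /V scalemxAl.
    by move/eqP; rewrite subr_eq0 => /eqP.
  have sx : s x = s z + r * s f0 by rewrite zE sB /s -scalemxAl [X in _ - X]mxE subrK.
  rewrite Vx sx rE; move: (V f0) (s f0) (s z) => v1 s1 s2; rewrite !dotE !mxE; lra.
have z0 := decomp Vz sz; have r0 : r = 0 by rewrite rE sz mulr0.
have x0 : x = 0 by move/eqP: z0; rewrite zE r0 scale0r subr0 => /eqP.
by rewrite x0 r0 raddf0 row_mx0.
Qed.

Let addE (r : R) v y : quadric_level (r *: v + y) = quadric_level y +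
  r * (2 * (dot (V v) (V (y - f0)) + (H * s (y - f0) - 1) * s v)) +
  r ^+ 2 * (dot (V v) (V v) + H * s v ^+ 2).
Proof.
rewrite /quadric_level.
have -> : V (r *: v + y - f0) = r *: V v + V (y - f0) by rewrite -addrA /V mulmxDl scalemxAl.
have -> : s (r *: v + y - f0) = r * s v + s (y - f0).
  by rewrite -addrA /s mulmxDl -scalemxAl mxE [X in X + _]mxE.
move: (V v) (V (y - f0)) (s v) (s (y - f0)) => v1 v2 s1 s2; rewrite !dotE !mxE; ring.
Qed.

Let DE v y : 'D_v quadric_level y =
  2 * (dot (V v) (V (y - f0)) + (H * s (y - f0) - 1) * s v).
Proof. by apply: derive_of_quadratic => r; exact: addE. Qed.

Let DDE v y : 'D_v ('D_v quadric_level) y = 2 * (dot (V v) (V v) + H * s v ^+ 2).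
Proof.
apply: (@derive_of_quadratic _ _ _ _ _ _ 0) => r; rewrite mulr0 addr0 !DE.
have -> : V (r *: v + y - f0) = r *: V v + V (y - f0) by rewrite -addrA /V mulmxDl scalemxAl.
have -> : s (r *: v + y - f0) = r * s v + s (y - f0).
  by rewrite -addrA /s mulmxDl -scalemxAl mxE [X in X + _]mxE.
move: (V v) (V (y - f0)) (s v) (s (y - f0)) => v1 v2 s1 s2; rewrite !dotE !mxE; ring.
Qed.

Let dot_ge0 (v : 'rV[R]_3) : 0 <= dot v v.
Proof. by rewrite dotE !addr_ge0// -expr2 sqr_ge0. Qed.

Let cauchy (v w : 'rV[R]_3) : dot v w ^+ 2 <= dot v v * dot w w.
Proof.
rewrite -subr_ge0 !dotE; move: (v 0 i0) (v 0 i1) (v 0 i2) (w 0 i0) (w 0 i1) (w 0 i2).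
move=> a1 a2 a3 b1 b2 b3.
have -> : (a1 * a1 + a2 * a2 + a3 * a3) * (b1 * b1 + b2 * b2 + b3 * b3)
  - (a1 * b1 + a2 * b2 + a3 * b3) ^+ 2 =
  (a1 * b2 - a2 * b1) ^+ 2 + (a1 * b3 - a3 * b1) ^+ 2 + (a2 * b3 - a3 * b2) ^+ 2 by ring.
by rewrite !addr_ge0 ?sqr_ge0.
Qed.

(** Half of the second derivative is |V v|^2 + H s(v)^2. For positive [H] this is positive definite;
    otherwise it is positive on the tangent spaces of the level set, by the Cauchy-Schwarz
    inequality and the tangency condition. *)
Let convex_level : locally_strongly_convex_level quadric_level.
Proof.
move=> y y0; have {}y0 : dot (V (y - f0)) (V (y - f0)) + H * s (y - f0) ^+ 2
    - 2 * s (y - f0) = 0 by [].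
split.
  have [Vy|Vy] := eqVneq (V (y - f0)) 0.
    exists xi0; rewrite DE Vxi sxi Vy; apply/eqP.
    rewrite mulr1 {1}/dot mul0mx mxE add0r => E.
    move: y0; rewrite Vy {1}/dot mul0mx mxE add0r.
    move: (s (y - f0)) E => t E; rewrite expr2 mulrA => F.
    have Ht : H * t = 1 by lra.
    have t0 : t = 0 by move: F; rewrite Ht; lra.
    by move: Ht; rewrite t0 mulr0 => /eqP; rewrite eq_sym oner_eq0.
  exists (V (y - f0) *m e); rewrite DE Ve se mulr0 addr0 mulf_neq0 ?pnatr_eq0//.
  by apply: contra_neq Vy => /dot0.
left => v v0; rewrite DDE DE => E0.
have {E0} : dot (V v) (V (y - f0)) + (H * s (y - f0) - 1) * s v = 0 by lra.
have cs := cauchy (V v) (V (y - f0)).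
have nn := dot_ge0 (V v); have nY := dot_ge0 (V (y - f0)).
have nz : ~ (dot (V v) (V v) = 0 /\ s v = 0).
  by move=> [/dot0 V0 s0]; move: v0; rewrite (decomp V0 s0) eqxx.
move: (dot (V v) (V v)) (dot (V v) _) (dot (V (y - f0)) _) (s v) (s (y - f0)) y0 cs nn nY nz.
move=> a m n t q y0 cs nn nY nz E0.
have [H0|H0] := ltP 0 H.
  have [a0|a0] := eqVneq a 0; last first.
    have ap : 0 < a by rewrite lt_neqAle eq_sym a0.
    by rewrite mulr_gt0// ltr_pwDl// mulr_ge0 ?sqr_ge0// ltW.
  have t2 : 0 < t ^+ 2 by rewrite exprn_even_gt0//=; apply/eqP => t0; exact: nz.
  have Ht : 0 < H * t ^+ 2 by exact: mulr_gt0.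
  by rewrite a0 add0r mulr_gt0.
(* Tangency gives m = - (H q - 1) t and the level equation n = 2 q - H q^2, so that (H q - 1)^2 = 1
   - H n. *)
have m2 : m ^+ 2 = (1 - H * n) * t ^+ 2.
  have -> : m = - ((H * q - 1) * t) by lra.
  have -> : n = 2 * q - H * q ^+ 2 by lra.
  by ring.
have Hn : 1 <= 1 - H * n by nra.
have a0 : 0 < a.
  rewrite lt_neqAle nn andbT eq_sym; apply/eqP => a0; apply: nz; split=> //.
  rewrite a0 mul0r m2 in cs.
  by apply/eqP; rewrite -sqrf_eq0 eq_le sqr_ge0 andbT -(pmulr_rle0 _ (lt_le_trans ltr01 Hn)).
have : 0 < (a + H * t ^+ 2) * (1 - H * n).
  have -> : (a + H * t ^+ 2) * (1 - H * n) = a + (- H) * (a * n - m ^+ 2) by rewrite m2; ring.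
  by rewrite ltr_pwDl// mulr_ge0// ?oppr_ge0// subr_ge0.
by rewrite pmulr_lgt0 ?(lt_le_trans ltr01 Hn)// => P; rewrite mulr_gt0.
Qed.

Theorem quadric_levelP :
  locally_strongly_convex_hyperquadric [set y | quadric_level y = 0].
Proof.
have E : quadratic_function B b c = quadric_level by apply/funext => y; exact: levelE.
exists B, b, c; split; [exact: BT|exact: block_unit| |]; by rewrite E.
Qed.

End QuadricLevel.

(** * Globalization *)

Section ChainRule.
Context {R : realType} {n m : nat}.

Lemma partial_comp_vector (g : 'rV[R]_m -> R) (t : 'rV[R]_n -> 'rV[R]_m) u i :
  differentiable t u -> differentiable g (t u) ->
  partial i (g \o t) u = \sum_j jac t u i j * partial j g (t u).
Proof.
move=> dt dg; rewrite partialE; last exact: differentiable_comp.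
rewrite diff_comp//= diff_sum//; apply: eq_bigr => j _; congr (_ * _).
by rewrite mxE -partial_coordinate// /partial deriveE.
Qed.

Lemma dm_comp p q (U : set 'rV[R]_n) (V : set 'rV[R]_m) (F : 'rV[R]_m -> 'M[R]_(p, q))
    (t : 'rV[R]_n -> 'rV[R]_m) u i : U u -> smooth_on U t -> smx V F -> V (t u) ->
  dm i (F \o t) u = \sum_j jac t u i j *: dm j F (t u).
Proof.
move=> Uu st sF Vtu; apply/matrixP => a b; rewrite dmE summxE.
rewrite (partial_comp_vector (g := fun w => F w a b) i (st [::] u Uu) (sF a b [::] _ Vtu)).
by apply: eq_bigr => j _; rewrite [RHS]mxE; congr (_ * _); exact/esym/dmE.
Qed.

End ChainRule.

(** p p^T is the metric, extended to R^4 by zero on [xi], and is the same for all orthonormal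
    frames. Skew-symmetry removes [om] from its derivative, which thus exhibits [fr_k] in terms that
    can be compared between charts. *)
Lemma dm_gramp (R : realType) (H : R) (U : set 'rV[R]_3) f xi (A : adapted_frame U f xi H) i u :
  open U -> U u ->
  fr_e A u *m dm i (fun v => fr_p A v *m (fr_p A v)^T) u *m (fr_e A u)^T =
  (- 2) *: contr (fr_k A^~ u) (row i (fr_th A u)).
Proof.
move=> Uo Uu; have sp := fr_smooth_p A; rewrite (dmM i Uo sp (smxT Uo sp) Uu) dmT.
set X := fr_om A i u + contr (fr_k A^~ u) (row i (fr_th A u)).
have edp : fr_e A u *m dm i (fr_p A) u = - X.
  rewrite (fr_dp A i Uu) mulmxBr -scalemxAr !mulmxA (fr_enu A Uu) (fr_ep A Uu).
  by rewrite mul0mx scaler0 mul1mx add0r.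
have pe1 : (fr_p A u)^T *m (fr_e A u)^T = 1%:M by rewrite -trmx_mul (fr_ep A Uu) trmx1.
rewrite mulmxDr mulmxDl -!mulmxA pe1 mulmx1 edp (mulmxA (fr_e A u) (fr_p A u)) (fr_ep A Uu) mul1mx.
have XT : (- X)^T = fr_om A i u - contr (fr_k A^~ u) (row i (fr_th A u)).
  have -> : (- X)^T = - ((fr_om A i u)^T + (contr (fr_k A^~ u) (row i (fr_th A u)))^T).
    by apply/matrixP => r s; rewrite !mxE.
  by rewrite (fr_skew A i u) (contr_sym (fr_cubic A Uu)) opprD opprK.
rewrite -trmx_mul edp XT /X.
move: (fr_om A i u) (contr _ _) => O C.
by apply/matrixP => r s; rewrite !mxE; ring.
Qed.

Section CompareFrames.
Context {R : realType} (H : R) (U V : set 'rV[R]_3) (f xi g eta : 'rV[R]_3 -> 'rV[R]_4)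
  (t : 'rV[R]_3 -> 'rV[R]_3)
  (A : adapted_frame U f xi H) (B : adapted_frame V g eta H) (W : set 'rV[R]_3).
Hypotheses (Uo : open U) (Vo : open V) (Wo : open W) (st : smooth_on W t)
  (sf : smx U f) (sg : smx V g)
  (WU : W `<=` U) (WV : forall w, W w -> V (t w))
  (fg : forall w, W w -> f w = g (t w)) (xe : forall w, W w -> xi w = eta (t w)).

(** The change between the two frames at the same point. [adapted_frame] does not mention the
    metric, so its orthogonality is derived in [rot_orth]. *)
Let rot w := invmx (fr_th A w) *m (jac t w *m fr_th B (t w)).

Let jac_fg w : W w -> jac f w = jac t w *m jac g (t w).
Proof.
move=> Ww; apply/row_matrixP => i; rewrite row_mul row_jac (dm_eq (G := g \o t) i Wo fg Ww).
rewrite (dm_comp i Ww st sg (WV Ww)) mulmx_sum_row.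
by apply: eq_bigr => j _; rewrite -(row_jac g); congr (_ *: _); rewrite [RHS]mxE.
Qed.

Let th_rot w : W w -> fr_th A w *m rot w = jac t w *m fr_th B (t w).
Proof. by move=> Ww; rewrite /rot mulKVmx// (fr_unit A (WU Ww)). Qed.

Let e_rot w : W w -> fr_e A w = rot w *m fr_e B (t w).
Proof.
move=> Ww; have := jac_fg Ww; rewrite (fr_jac A (WU Ww)) (fr_jac B (WV Ww)) mulmxA -th_rot//.
rewrite -mulmxA => /(congr1 (mulmx (invmx (fr_th A w)))).
by rewrite !mulKmx// (fr_unit A (WU Ww)).
Qed.

Lemma compare_nu w : W w -> fr_nu A w = fr_nu B (t w).
Proof.
move=> Ww; rewrite -[RHS]mul1mx -(fr_pe A (WU Ww)) mulmxDl -!mulmxA e_rot//.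
rewrite -(mulmxA (rot w)) (fr_enu B (WV Ww)) !mulmx0 add0r xe//.
by rewrite (fr_xinu B (WV Ww)) mulmx1.
Qed.

Let p_rot w : W w -> fr_p B (t w) = fr_p A w *m rot w.
Proof.
move=> Ww; rewrite -[LHS]mul1mx -(fr_pe A (WU Ww)) mulmxDl -!mulmxA e_rot//.
rewrite -(mulmxA (rot w)) (fr_ep B (WV Ww)) mulmx1 xe//.
by rewrite (fr_xip B (WV Ww)) mulmx0 addr0.
Qed.

Let row_sum (X : 'M[R]_3) i w : \sum_j jac t w i j *: row j X = row i (jac t w *m X).
Proof.
by rewrite row_mul mulmx_sum_row; apply: eq_bigr => j _; congr (_ *: _); rewrite [RHS]mxE.
Qed.

(** Both charts have the same conormal. Differentiating it and using [fr_dnu] on either side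
    compares the products th th^T, that is, the metrics. *)
Let rot_orth w : W w -> rot w *m (rot w)^T = 1%:M.
Proof.
move=> Ww; have dn i : fr_p A w *m (row i (fr_th A w))^T =
    fr_p A w *m (rot w *m (rot w)^T *m (row i (fr_th A w))^T).
  apply: oppr_inj; rewrite -(fr_dnu A i (WU Ww)).
  rewrite (dm_eq (G := fr_nu B \o t) i Wo compare_nu Ww).
  rewrite (dm_comp i Ww st (fr_smooth_nu B) (WV Ww)).
  transitivity (- (fr_p B (t w) *m (\sum_j jac t w i j *: row j (fr_th B (t w)))^T)).
    rewrite linear_sum mulmx_sumr -sumrN; apply: eq_bigr => j _.
    by rewrite (fr_dnu B j (WV Ww)) linearZ /= -scalemxAr scalerN.
  by rewrite row_sum -th_rot// row_mul trmx_mul p_rot// !mulmxA.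
have E : (fr_th A w)^T = rot w *m (rot w)^T *m (fr_th A w)^T.
  apply: trmx_inj; rewrite trmxK; apply/row_matrixP => i.
  have := congr1 (mulmx (fr_e A w)) (dn i); rewrite !(mulmxA (fr_e A w)) (fr_ep A (WU Ww)) !mul1mx.
  move=> /(congr1 trmx); rewrite trmxK => ->.
  by rewrite !trmx_mul !trmxK row_mul.
have uT : (fr_th A w)^T \in unitmx by rewrite unitmx_tr (fr_unit A (WU Ww)).
by rewrite -[LHS](mulmxK uT) -E mulmxV.
Qed.

Let gramp_rot w : W w -> fr_p A w *m (fr_p A w)^T = fr_p B (t w) *m (fr_p B (t w))^T.
Proof. by move=> Ww; rewrite p_rot// trmx_mul mulmxA -(mulmxA _ (rot w)) rot_orth// mulmx1. Qed.

Lemma compare_quadric y w : W w -> quadric A y w = quadric B y (t w).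
Proof.
move=> Ww; rewrite /quadric /npart compare_nu// -fg//; congr (_ + _ - _).
by rewrite /q_nn /dot /tpart !trmx_mul !mulmxA -(mulmxA _ _ (fr_p A w)^T) gramp_rot// -fg// !mulmxA.
Qed.

(** Both sides are read off the derivative of the common matrix p p^T through [dm_gramp]. This gives
    equal contractions with the rows of [fr_th A w], which form a basis. *)
Let k_rot w : W w -> fr_k A^~ w = rot3 (rot w) (fr_k B^~ (t w)).
Proof.
move=> Ww; have N i : contr (fr_k A^~ w) (row i (fr_th A w)) =
    contr (rot3 (rot w) (fr_k B^~ (t w))) (row i (fr_th A w)).
  have := dm_gramp A i Uo (WU Ww).
  rewrite (dm_eq (G := (fun v => fr_p B v *m (fr_p B v)^T) \o t) i Wo gramp_rot Ww).
  have sp := fr_smooth_p B.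
  rewrite (dm_comp i Ww st (smxM Vo sp (smxT Vo sp)) (WV Ww)) e_rot// trmx_mul.
  rewrite mulmx_sumr mulmx_suml.
  under eq_bigr => j _.
    rewrite -scalemxAr -scalemxAl !mulmxA -(mulmxA (rot w)) -(mulmxA (rot w)).
    rewrite (dm_gramp B j Vo (WV Ww)) -scalemxAr -scalemxAl scalerA mulrC -scalerA.
  over.
  rewrite -scaler_sumr => /(scalerI _) <-; last by rewrite oppr_eq0 pnatr_eq0.
  rewrite contr_rot -row_mul th_rot// -row_sum contr_sum mulmx_sumr mulmx_suml.
  by apply: eq_bigr => j _; rewrite contrZ -scalemxAr -scalemxAl.
apply/funext => c; rewrite -(contr_delta (fr_k A^~ w) c) -[RHS](contr_delta _ c).
have -> : delta_mx 0 c = \sum_i invmx (fr_th A w) c i *: row i (fr_th A w).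
  have : row c (invmx (fr_th A w) *m fr_th A w) = delta_mx 0 c.
    by rewrite mulVmx ?row1// (fr_unit A (WU Ww)).
  by move=> <-; rewrite row_mul mulmx_sum_row; apply: eq_bigr => j _; rewrite mxE.
by rewrite !contr_sum; apply: eq_bigr => j _; rewrite !contrZ N.
Qed.

Lemma compare_cubic_norm w : W w -> cubic_norm (fr_k A) w = cubic_norm (fr_k B) (t w).
Proof.
move=> Ww; have Q := rot_orth Ww; rewrite /cubic_norm k_rot// gram_rot//.
by rewrite mxtrace_mulC mulmxA (mulmx1C Q) mul1mx.
Qed.

End CompareFrames.

Lemma connected_constant (M : topologicalType) (T : Type) (g : M -> T) (p q : M) :
  connected [set: M] -> (forall p, \forall q \near p, g q = g p) -> g q = g p.
Proof.
move=> cM lc; pose B := [set q | g q = g p].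
have Bo : open B.
  rewrite openE => r Br; apply: filterS (lc r) => z zr; exact: etrans zr Br.
have Bc : open (~` B).
  rewrite openE => r /= Br; apply: filterS (lc r) => z zr Bz; apply: Br.
  exact: etrans (esym zr) Bz.
suff E : B = setT by have : B q by rewrite E.
apply: cM; first by exists p.
  by exists B => //; rewrite setTI.
by exists B; rewrite ?setTI// -[B]setCK; exact: open_closedC.
Qed.

Lemma open_preimage_within (S T : topologicalType) (D : set S) (f : S -> T) (O : set T) :
  open D -> {within D, continuous f} -> open O -> open (D `&` f @^-1` O).
Proof.
move=> Do cf Oo; rewrite openE => u [Du Ou]; apply: filterI; first exact: open_nbhs_nbhs.
move: cf; rewrite continuous_open_subspace// => /(_ u (mem_set Du)); apply.
exact: open_nbhs_nbhs.
Qed.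

Section Atlas.
Context {R : realType} {M : topologicalType} (A : smooth_atlas R 3 M).

Lemma open_chart_preimage (a : chart_index A) (W : set 'rV[R]_3) : open W ->
  open (chart_dom a `&` chart a @^-1` W).
Proof.
by move=> Wo; apply: open_preimage_within => //; [exact: chart_dom_open|exact: chart_continuous].
Qed.

Lemma open_overlap (a b : chart_index A) : open (chart_codom a `&` param a @^-1` chart_dom b).
Proof.
apply: open_preimage_within; [exact: chart_codom_open|exact: param_continuous|].
exact: chart_dom_open.
Qed.

(** A compatible family on charts defines a locally constant function on the manifold. [T] is
    arbitrary because the values are real numbers in some uses and whole functions, such as the
    equation of the quadric, in another. *)
Lemma chart_constant (T : Type) (g : chart_index A -> 'rV[R]_3 -> T) :
  connected [set: M] ->
  (forall (a b : chart_index A) u, chart_codom a u -> chart_dom b (param a u) ->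
     g a u = g b (chart b (param a u))) ->
  (forall (a : chart_index A) u, chart_codom a u -> \forall v \near u, g a v = g a u) ->
  forall (a b : chart_index A) u v, chart_codom a u -> chart_codom b v -> g a u = g b v.
Proof.
move=> cM inv lc.
pose c p := projT1 (cid (chart_dom_cover A p)).
have cP p : chart_dom (c p) p := projT2 (cid (chart_dom_cover A p)).
pose G p := g (c p) (chart (c p) p).
have GE a p : chart_dom a p -> G p = g a (chart a p).
  move=> ap; rewrite /G [RHS](inv a (c p)); first by rewrite chartK.
    exact: chart_fun.
  by rewrite chartK.
have GP a u : chart_codom a u -> g a u = G (param a u).
  by move=> au; rewrite (GE a) ?paramK//; exact: param_fun.
move=> a b u v au bv; rewrite !GP//; apply: connected_constant => // p.
have cp := cP p; have := lc _ _ (chart_fun cp) => N.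
have cc : {for p, continuous (chart (c p))}.
  have := @chart_continuous _ _ _ A (c p); rewrite continuous_open_subspace.
    by move/(_ p (mem_set cp)).
  exact: chart_dom_open.
have N1 : \forall q \near p, chart_dom (c p) q.
  by apply: open_nbhs_nbhs; split=> //; exact: chart_dom_open.
have := cc _ N; rewrite /= => N2.
have : nbhs p [set q | chart_dom (c p) q /\ g (c p) (chart (c p) q) = g (c p) (chart (c p) p)].
  exact: filterI N1 N2.
by apply: filterS => q [dq E]; rewrite (GE _ _ dq) (GE _ _ cp).
Qed.

Lemma locally_equivalent_of_charts (x : M -> 'rV[R]_4) (S : set 'rV[R]_4) :
  (forall (a : chart_index A) u, chart_codom a u ->
     local_equivalence (chart_codom a) (x \o param a) u S) ->
  locally_affinely_equivalent x S.
Proof.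
move=> H p; have [a ap] := chart_dom_cover A p.
have [W [L [t [Wo Wu WU uL E]]]] := H a _ (chart_fun ap).
exists (chart_dom a `&` chart a @^-1` W), L, t; split=> //.
  exact: open_chart_preimage.
suff -> : (fun q => x q *m L + t) @` (chart_dom a `&` chart a @^-1` W) =
  (fun u => (x \o param a) u *m L + t) @` W by [].
apply/seteqP; split=> [_ [q [dq Wq] <-]|_ [u Wu' <-]].
  by exists (chart a q) => //=; rewrite chartK.
exists (param a u) => //; split; first exact/param_fun/WU.
by rewrite /= paramK//; exact: WU.
Qed.

End Atlas.

(** * From the geometric hypotheses to an adapted frame *)

Section ChartData.
Context {R : realType} (U : set 'rV[R]_3) (f nu : 'rV[R]_3 -> 'rV[R]_(3 + 1)).
Hypotheses (Uo : open U) (sf0 : smooth_on U f) (sn0 : smooth_on U nu)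
  (uF : forall u, U u -> frame f nu u \in unitmx)
  (tang : forall u, U u -> ('J nu u <= 'J f u)%MS).

Lemma smx_chart : smx U f /\ smx U nu.
Proof. by split; exact: smooth_coordinate. Qed.

Let sf : smx U (f : 'rV[R]_3 -> 'rV[R]_4). Proof. by have [] := smx_chart. Qed.
Let sn : smx U (nu : 'rV[R]_3 -> 'rV[R]_4). Proof. by have [] := smx_chart. Qed.

Lemma frameE u : U u -> frame f nu u = col_mx (jac f u) (nu u).
Proof. by move=> Uu; rewrite /frame (jacobianE Uo sf0 Uu). Qed.

Lemma chart_unit u : U u -> (col_mx (jac f u) (nu u) : 'M[R]_(3 + 1)) \in unitmx.
Proof. by move=> Uu; rewrite -frameE// uF. Qed.

Let co := conormal f nu.

Let sco : smx U co. Proof. exact: (smx_conormal Uo sf sn chart_unit). Qed.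

Let f_co u : U u -> jac f u *m co u = 0.
Proof. by move=> Uu; have [_ E _ _] := FrV chart_unit Uu. Qed.

Let nu_co u : U u -> (nu u : 'rV[R]_4) *m co u = 1%:M.
Proof. by move=> Uu; have [_ _ _ E] := FrV chart_unit Uu. Qed.

Let dnu_co i u : U u -> dm i nu u *m co u = 0.
Proof.
move=> Uu; have /submxP[D E] := tang Uu.
rewrite (jacobianE Uo sf0 Uu) (jacobianE Uo sn0 Uu) in E.
by rewrite -row_jac E row_mul -mulmxA f_co// mulmx0.
Qed.

Let nu_dco i u : U u -> (nu u : 'rV[R]_4) *m dm i co u = 0.
Proof.
move=> Uu; have := dmM i Uo sn sco Uu.
by rewrite (dm_eq i Uo nu_co Uu) dm_cst dnu_co// add0r.
Qed.

(** Regularity of [t] is not given, but [t] equals (c - f) times the conormal, which is smooth. The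
    derivative vanishes because the conormal annihilates the derivatives of [f] and its own
    derivatives annihilate [nu]. *)
Lemma proper_locally_constant (c : 'rV[R]_(3 + 1)) (t : 'rV[R]_3 -> R) u :
  (forall v, U v -> c = f v + t v *: nu v) -> U u -> \forall v \near u, t v = t u.
Proof.
move=> E Uu; pose T v : 'M[R]_1 := (c - f v : 'rV[R]_4) *m co v.
have sub v : U v -> c - f v = t v *: nu v by move=> Uv; rewrite {1}(E v Uv) addrC addKr.
have TE v : U v -> T v = (t v)%:M.
  move=> Uv; rewrite /T sub// -(scalemxAl (t v) (nu v : 'rV[R]_4)) nu_co//.
  by rewrite scalemx1.
have sc : smx U (fun _ : 'rV[R]_3 => c : 'rV[R]_4) by exact: smx_cst.
have sT : smx U T by apply: smxM => //; exact: smxB.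
have [r r0 bU] := near_ball_subset Uo Uu.
have := nbhsx_ballx u r r0; apply: filterS => v bv.
have : T v = T u.
  apply: (dm_constant_on_ball (r := r)) => //.
    by move=> a b s w bw; apply: sT; exact: bU.
  move=> w i /bU Uw; rewrite /T (dmM i Uo (smxB Uo sc sf) sco Uw) (dmB i Uo sc sf Uw) dm_cst.
  rewrite sub// -(scalemxAl (t w) (nu w : 'rV[R]_4)) nu_dco// scaler0 addr0 sub0r mulNmx.
  by rewrite -row_jac -row_mul f_co// row0 oppr0.
rewrite !TE//; last exact: bU.
by move/matrixP => /(_ 0 0); rewrite !mxE eqxx !mulr1n.
Qed.

Lemma proper_shape (c : 'rV[R]_(3 + 1)) (t : R) u : (forall v, U v -> c = f v + t *: nu v) ->
  U u -> jac nu u = (- t^-1) *: jac f u.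
Proof.
move=> E Uu; have st : smooth_on U (fun _ : 'rV[R]_3 => t) by exact: sm_cst.
have D i : dm i f u = - (t *: dm i nu u).
  have := dm_cst (c : 'rV[R]_4) i u; rewrite (dm_eq i Uo E Uu).
  rewrite (dmD i sf (smxZ Uo st sn) Uu) (dmZ i st sn Uu).
  rewrite -[X in partial _ X _]/(cst t) partial_cst scale0r add0r => /eqP.
  by rewrite addr_eq0 => /eqP.
have t0 : t != 0.
  apply/eqP => t0; have J0 : jac f u = 0.
    by apply/row_matrixP => i; rewrite row_jac D t0 scale0r oppr0 row0.
  have [+ _ _ _] := FrV chart_unit Uu; rewrite J0 mul0mx => /matrixP/(_ i0 i0).
  by rewrite !mxE /= => /eqP; rewrite eq_sym oner_eq0.
apply/row_matrixP => i; rewrite linearZ /= !row_jac D scalerN scaleNr opprK scalerA.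
by rewrite mulVf// scale1r.
Qed.

(** The derivative of [nu] is both a multiple of [w] and tangential, while [w] is transversal. *)
Lemma improper_shape (w : 'rV[R]_(3 + 1)) u : (forall v, U v -> exists t : R, nu v = t *: w) ->
  U u -> jac nu u = 0.
Proof.
move=> E Uu; pose w' : 'rV[R]_4 := w.
have wco v (Uv : U v) : (w' *m co v) 0 0 != 0.
  apply/eqP => w0; have [t nut] := E v Uv; have := nu_co Uv; rewrite nut.
  rewrite -[(t *: w : 'rV_4)]/(t *: w') -scalemxAl [w' *m _]mx11_scalar w0 raddf0 scaler0.
  by move/matrixP/(_ 0 0); rewrite !mxE eqxx => /eqP; rewrite eq_sym oner_eq0.
have [k wk] : exists k, w' 0 k != 0.
  apply: contrapT => /forallNP H; have := wco u Uu; rewrite (_ : w' = 0) ?mul0mx ?mxE ?eqxx//.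
  by apply/rowP => k; rewrite [RHS]mxE; apply/eqP; rewrite -[_ == _]negbK; apply/negP/H.
have sn' : smooth_on U (fun v => (w' 0 k)^-1 * (nu v : 'rV[R]_4) 0 k).
  exact: (smM Uo (@sm_cst _ _ U (w' 0 k)^-1) (sn 0 k)).
have nuE v : U v -> (nu v : 'rV[R]_4) = ((w' 0 k)^-1 * (nu v : 'rV[R]_4) 0 k) *: w'.
  move=> Uv; have [t ->] := E v Uv; rewrite -[(t *: w : 'rV_4)]/(t *: w') mxE mulrCA mulVf//.
  by rewrite mulr1.
apply/row_matrixP => i; rewrite row_jac row0.
have D : dm i nu u = partial i (fun v => (w' 0 k)^-1 * (nu v : 'rV[R]_4) 0 k) u *: w'.
  rewrite (dm_eq i Uo nuE Uu) (dmZ i sn' (smx_cst (U := U) w') Uu).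
  by rewrite dm_cst scaler0 addr0.
have := dnu_co i Uu; rewrite D -scalemxAl => /matrixP/(_ 0 0); rewrite mxE [RHS]mxE => /eqP.
by rewrite mulf_eq0 (negbTE (wco u Uu)) orbF => /eqP ->; rewrite scale0r.
Qed.

Let h := affine_metric f nu.

Lemma second_formP u : U u -> h u = second_form f nu u.
Proof.
move=> Uu; apply/matrixP => i j; rewrite [LHS]mxE [RHS]mxE frameE//.
by rewrite (partial2_coordinate i j Uo sf0 Uu).
Qed.

Lemma smx_metric : smx U h.
Proof.
move=> i j; apply: (sm_eq Uo (f := fun v => (dm j (jac f) v *m co v) i 0)); last first.
  by apply: smxM => //; apply: smx_dm => //; exact: smx_jac.
by move=> v Uv; rewrite second_formP// (second_formE nu Uo sf j Uv) mxE.
Qed.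

Lemma metric_sym u : U u -> (h u)^T = h u.
Proof.
move=> Uu; rewrite second_formP//; apply/matrixP => i j.
by rewrite [LHS]mxE [LHS]mxE [RHS]mxE (jac_sym i j Uo sf Uu).
Qed.

Theorem chart_frame (H : R) : (forall u, U u -> jac nu u = (- H) *: jac f u) ->
  (forall u, U u -> positive_definite (h u)) ->
  (forall u, U u -> `|\det (frame f nu u)| = Num.sqrt `|\det (h u)|) ->
  (forall l i j u, U u -> covariant_derivative h (ricci h) l i j u = 0) ->
  exists A : adapted_frame U f nu H, True.
Proof.
move=> dnu pd vol ric; have [th [sth thE uth]] := cholesky Uo smx_metric metric_sym pd.
have [|A _] := @chart_adapted_frame _ U f nu H th h Uo sf sn sth chart_unit dnu
  second_formP thE uth _ ric; last by exists A.
move=> u Uu; have := vol u Uu; rewrite frameE// => /(congr1 (fun x => x ^+ 2)).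
rewrite real_normK ?num_real// sqr_sqrtr// => ->; rewrite ger0_norm//.
by rewrite -thE// det_mulmx det_tr -expr2 sqr_ge0.
Qed.

End ChartData.

Section QuadricLocal.
Context {R : realType} (U : set 'rV[R]_3) (f xi : 'rV[R]_3 -> 'rV[R]_4) (H : R)
  (A : adapted_frame U f xi H).
Hypotheses (Uo : open U) (sf : smx U f) (k0 : forall c u, U u -> fr_k A c u = 0).

Lemma quadric_locally_constant u : U u ->
  \forall v \near u, (quadric A)^~ v = (quadric A)^~ u.
Proof.
move=> Uu; have [r r0 bU] := near_ball_subset Uo Uu.
have := nbhsx_ballx u r r0; apply: filterS => v bv; apply/funext => y.
apply: (constant_along (F := quadric A) bU _ y bv) => z i w Uw.
by apply: (hp_quadric Uo sf z i Uw) => c; exact: k0.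
Qed.

Theorem quadric_local u0 : U u0 -> exists W, [/\ open W, W u0, W `<=` U &
  open_part (f @` W) [set y | quadric A y u0 = 0]].
Proof.
move=> Uu0; have [r r0 bU] := near_ball_subset Uo Uu0.
have bo : open (ball u0 r) by exact: ball_open.
have bu0 : ball u0 r u0 by exact: ballxx.
have sg' : smx (ball u0 r) f by move=> a c s v bv; apply: sf; exact: bU.
pose N : 'M[R]_(4, 1) := H *: fr_nu A u0.
(* On a line parallel to [xi u0] the quadric has at most two points, and two distinct ones satisfy H
   (s + s') = 2. So at most one of them has H s < 1, the side that contains [f u0], where s = 0. *)
pose O0 := [set z : 'rV[R]_4 | `|z *m N - f u0 *m N| < 1].
have O0lt z : O0 z -> H * npart A z u0 < 1.
  move=> Oz; apply: le_lt_trans (ler_norm _) _; apply: le_lt_trans Oz.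
  have -> : H * npart A z u0 = (z *m N - f u0 *m N) 0 0.
    by rewrite -mulmxBl /N -scalemxAr mxE.
  exact: norm_coord.
have fS u : ball u0 r u -> [set y | quadric A y u0 = 0] (f u).
  move=> bu; have E := @constant_along _ U (quadric A) u0 r bU _ (f u) u bu.
  rewrite /= -E; last by move=> z i w Uw; apply: (hp_quadric Uo sf z i Uw) => c; exact: k0.
  have [v0 s0] := part_self A u.
  by rewrite /quadric /q_nn v0 s0 /dot mul0mx mxE; ring.
have [|||||W [Wo Wu0 WU WS]] := @open_image _ (ball u0 r) f (fr_p A u0)
  [set y | quadric A y u0 = 0] O0 u0 bo sg' bu0.
- by rewrite (fr_jac A Uu0) -mulmxA (fr_ep A Uu0) mulmx1 (fr_unit A Uu0).
- exact: open_mulmx_ball.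
- by rewrite /O0 /= subrr normr0.
- exact: fS.
- move=> z z' Sz /O0lt Oz Sz' /O0lt Oz' E.
  have V : tpart A z u0 = tpart A z' u0 by rewrite /tpart !mulmxBl E.
  have s : npart A z u0 = npart A z' u0.
    move: Sz Sz' Oz Oz'; rewrite /= /quadric /q_nn V.
    move: (dot _ _) (npart A z u0) (npart A z' u0) => d s s' E1 E2 L1 L2.
    have : (2 - H * s - H * s') * (s - s') = 0 by move: E1 E2; rewrite !expr2; lra.
    move/eqP; rewrite mulf_eq0 => /orP[/eqP Z|]; first by exfalso; lra.
    by rewrite subr_eq0 => /eqP.
  apply: etrans (coordE A z Uu0) _; apply: etrans (esym (coordE A z' Uu0)).
  by rewrite V s.
by exists W; split=> // v /WU /bU.
Qed.

End QuadricLocal.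

Section Classification.
Context {R : realType} {M : topologicalType} (A : smooth_atlas R 3 M)
  (x xi : M -> 'rV[R]_(3 + 1)).
Hypotheses (M_connected : connected [set: M]) (x_immersion : immersion A x)
  (x_convex : locally_strongly_convex A x xi) (x_sphere : affine_hypersphere x xi)
  (x_ricci : parallel_ricci A x xi).

Let dom (a : chart_index A) := chart_codom a.
Let f (a : chart_index A) := x \o param a.
Let nu (a : chart_index A) := xi \o param a.

Let domo a : open (dom a). Proof. exact: chart_codom_open. Qed.
Let sf a : smooth_on (dom a) (f a). Proof. by have [H _] := x_immersion; exact: H. Qed.
Let sn a : smooth_on (dom a) (nu a). Proof. by have [[H _] _] := x_convex; exact: H. Qed.
Let uF a u : dom a u -> frame (f a) (nu a) u \in unitmx.
Proof. by move=> au; have [[_ H] _] := x_convex; have [] := H a u au. Qed.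
Let tang a u : dom a u -> ('J (nu a) u <= 'J (f a) u)%MS.
Proof. by move=> au; have [[_ H] _] := x_convex; have [] := H a u au. Qed.

Let overlap (a b : chart_index A) := dom a `&` param a @^-1` chart_dom b.
Let trans (a b : chart_index A) := chart b \o param a.

Let trans_dom a b u : overlap a b u -> dom b (trans a b u).
Proof. by move=> [_ bu]; exact: chart_fun. Qed.

Let f_trans a b u : overlap a b u -> f a u = f b (trans a b u).
Proof. by move=> [_ bu]; rewrite /f /trans /= chartK. Qed.

Let nu_trans a b u : overlap a b u -> nu a u = nu b (trans a b u).
Proof. by move=> [_ bu]; rewrite /nu /trans /= chartK. Qed.

Let shape_const : exists H : R, forall a u, dom a u -> jac (nu a) u = (- H) *: jac (f a) u.
Proof.
case: x_sphere => [[c Hc]|[v Hv]]; last first.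
  exists 0 => a u au; rewrite oppr0 scale0r.
  apply: (improper_shape (w := v) (@domo a) (@sf a) (@sn a) (@uF a) (@tang a)) => // w aw.
  exact: Hv.
pose t p := projT1 (cid (Hc p)).
have tE p : c = x p + t p *: xi p := projT2 (cid (Hc p)).
have tc : forall (a b : chart_index A) u v, dom a u -> dom b v -> t (param a u) = t (param b v).
  apply: (chart_constant (g := fun a u => t (param a u)) M_connected).
    by move=> a b u au bu; rewrite chartK.
  move=> a u au.
  apply: (proper_locally_constant (c := c) (t := t \o param a) (@domo a) (@sf a) (@sn a) (@uF a) (@tang a)) => //.
  by move=> v av; exact: tE.
have [[a0 [u0 au0]]|none] := pselect (exists (a : chart_index A) u, dom a u); last first.
  by exists 0 => a u au; exfalso; apply: none; exists a, u.
exists (t (param a0 u0))^-1 => a u au.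
apply: (proper_shape (c := c) (@domo a) (@sf a) (@sn a) (@uF a)) => // v av.
by rewrite (tc _ a _ v au0 av); exact: tE.
Qed.

Let frames H : (forall a u, dom a u -> jac (nu a) u = (- H) *: jac (f a) u) ->
  forall a, exists B : adapted_frame (dom a) (f a) (nu a) H, True.
Proof.
move=> HE a; have [[_ N] pd] := x_convex.
apply: (chart_frame (@domo a) (@sf a) (@sn a) (@uF a) (HE a)).
- by move=> u au; exact: pd.
- by move=> u au; have [] := N a u au.
- by move=> l i j u au; exact: x_ricci.
Qed.

Theorem hypersphere_classification :
  (exists2 Q : set 'rV[R]_4, locally_strongly_convex_hyperquadric Q &
     open_part (range x) Q) \/
  (locally_affinely_equivalent x (hypersurface_i R) \/
   locally_affinely_equivalent x (hypersurface_ii R)).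
Proof.
have [H HE] := shape_const.
pose F a := projT1 (cid (frames HE a)).
have sfx a : smx (dom a) (f a) by exact: smooth_coordinate.
have oo a b : open (overlap a b) by exact: open_overlap.
have st a b : smooth_on (overlap a b) (trans a b) by exact: transition_smooth.
have sub a b : overlap a b `<=` dom a by move=> u [].
(* If no chart has a point, the manifold is empty and a local equivalence holds vacuously. *)
have [[a0 [u0 au0]]|none] := pselect (exists (a : chart_index A) u, dom a u); last first.
  right; left; apply: (locally_equivalent_of_charts (A := A)) => a u au.
  by exfalso; apply: none; exists a, u.
have norm_const a u : dom a u -> cubic_norm (fr_k (F a)) u = cubic_norm (fr_k (F a0)) u0.
  move=> au; apply: (chart_constant (g := fun a u => cubic_norm (fr_k (F a)) u) M_connected) => //.
    move=> b c v bv cv.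
    exact: (compare_cubic_norm (F b) (F c) (@domo b) (@domo c) (oo b c) (st b c) (sfx c)
      (sub b c) (@trans_dom b c) (@f_trans b c) (@nu_trans b c) (conj bv cv)).
  move=> b v bv; have [r r0 bU] := near_ball_subset (@domo b) bv.
  have := nbhsx_ballx v r r0; apply: filterS => w bw.
  exact: (cubic_norm_const (@domo b) (fr_smooth_k (F b)) (dm_gram (F b) (@domo b)) bU bw).
have [J0|J0] := eqVneq (cubic_norm (fr_k (F a0)) u0) 0.
  left; have k0 a c u : dom a u -> fr_k (F a) c u = 0.
    by move=> au; apply: (cubic_norm_eq0 (fr_cubic (F a)) au); rewrite norm_const.
  pose Phi a u := (quadric (F a))^~ u.
  have PhiE a u : dom a u -> Phi a u = Phi a0 u0.
    move=> au; apply: (chart_constant (g := Phi) M_connected) => //.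
      move=> b c v bv cv; apply/funext => y.
      exact: (compare_quadric (F b) (F c) (oo b c) (st b c) (sfx c)
        (sub b c) (@trans_dom b c) (@f_trans b c) (@nu_trans b c) y (conj bv cv)).
    move=> b v bv; apply: quadric_locally_constant => // c w; exact: k0.
  exists [set y | Phi a0 u0 y = 0].
    exact: (quadric_levelP H (f a0 u0) (fr_ep (F a0) au0) (fr_enu (F a0) au0)
      (fr_xip (F a0) au0) (fr_xinu (F a0) au0) (fr_pe (F a0) au0)).
  have loc p : exists G : set 'rV[R]_4, [/\ open G, G (x p), Phi a0 u0 (x p) = 0 &
      [set y | Phi a0 u0 y = 0] `&` G `<=` range x].
    have [a ap] := chart_dom_cover A p; have au := chart_fun ap.
    have [W [Wo Wu WU [G Go E]]] := quadric_local (@domo a) (sfx a) (fun c v => @k0 a c v) au.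
    have S : [set y | quadric (F a) y (chart a p) = 0] = [set y | Phi a0 u0 y = 0].
      by rewrite -(PhiE a _ au).
    rewrite S in E.
    have xp : (f a @` W) (x p) by exists (chart a p) => //; rewrite /f /= chartK.
    have := xp; rewrite E => -[xQ xG]; exists G; split=> // y yQG.
    by have : (f a @` W) y by [rewrite E]; case=> u _ <-; exists (param a u).
  (* Union of all open sets whose part on the quadric lies in the image; overlapping pieces and a
     noninjective [x] cause no trouble. *)
  exists [set y | exists2 G : set 'rV[R]_4, open G & G y /\
      [set y | Phi a0 u0 y = 0] `&` G `<=` range x].
    rewrite openE => y [G Go [Gy GS]]; have N : nbhs y G by exact: open_nbhs_nbhs.
    by apply: (@filterS _ (nbhs y) (nbhs_filter y) _ _ _ N) => z Gz; exists G.
  apply/seteqP; split=> [_ [p _ <-]|y [yQ [G _ [Gy GS]]]]; last exact: GS.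
  by have [G [Go xG xQ GS]] := loc p; split=> //; exists G.
right.
have cases a u : dom a u -> exists2 l, 0 < l & H = - (3 / 4) * l ^+ 2 /\
    (axial (l / 2) (fr_k (F a)^~ u) \/ tetrahedral l (fr_k (F a)^~ u)).
  move=> au; apply: curvature_invariant_cases; first exact: (fr_cubic (F a) au).
    apply: contrapT => /forallNP K0; case/negP: J0; apply/eqP.
    rewrite -(norm_const a u au) (cubic_normE (fr_cubic (F a)) au).
    rewrite big1// => c _; rewrite big1// => i _; rewrite big1// => j _.
    by have /negP := K0 c; rewrite negbK => /eqP ->; rewrite mxE expr0n.
  exact: (fr_curvature (F a) au).
have [l l0 [HlE case0]] := cases a0 u0 au0.
(* [H] determines the positive number [l], so the same [l] serves at all points. *)
have cases' a u : dom a u ->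
    axial (l / 2) (fr_k (F a)^~ u) \/ tetrahedral l (fr_k (F a)^~ u).
  move=> au; have [l' l0' [HlE' C]] := cases a u au.
  suff -> : l = l' by [].
  apply/eqP; rewrite -(eqrXn2 (n := 2))// ?ltW//; apply/eqP.
  by move: HlE'; rewrite HlE; lra.
have lsq : 0 < l ^+ 2 by rewrite exprn_gt0.
(* The squared norm is 5/2 l^2 in the axial and 9/2 l^2 in the tetrahedral case; being constant, it
   keeps the two cases from occurring on the same manifold. *)
have Jax a u : dom a u -> axial (l / 2) (fr_k (F a)^~ u) ->
    cubic_norm (fr_k (F a0)) u0 = 5 / 2 * l ^+ 2.
  by move=> au /axial_cubic_norm E; rewrite -(norm_const a u au) E; field.
have Jte a u : dom a u -> tetrahedral l (fr_k (F a)^~ u) ->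
    cubic_norm (fr_k (F a0)) u0 = 9 / 2 * l ^+ 2.
  by move=> au /tr_gram_tetrahedral E; rewrite -(norm_const a u au).
case: case0 => [ax|te]; [right|left]; apply: (locally_equivalent_of_charts (A := A)) => a u au.
  have l2 : l / 2 != 0 by rewrite mulf_neq0 ?invr_eq0 ?pnatr_eq0// gt_eqF.
  apply: (axial_local (A := F a) (@domo a) (sfx a) au l2); first by rewrite HlE; field.
  move=> v av; case: (cases' a v av) => // te.
  by have := Jax _ _ au0 ax; rewrite (Jte _ _ av te); lra.
apply: (tetrahedral_local (A := F a) (@domo a) (sfx a) au l0 HlE) => v av.
case: (cases' a v av) => // ax.
by have := Jte _ _ au0 te; rewrite (Jax _ _ av ax); lra.
Qed.

End Classification.

Theorem corollary1p1 (R : realType) (M : topologicalType)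
    (A : smooth_atlas R 3 M)
    (M_hausdorff : hausdorff_space M)
    (M_second_countable : @second_countable M)
    (M_connected : connected [set: M])
    (x xi : M -> 'rV[R]_4)
    (x_immersion : immersion A x)
    (x_convex : locally_strongly_convex A x xi)
    (x_sphere : affine_hypersphere x xi)
    (x_ricci : parallel_ricci A x xi) :
  (exists2 Q : set 'rV[R]_4, locally_strongly_convex_hyperquadric Q &
     open_part (range x) Q) \/
  (locally_affinely_equivalent x (hypersurface_i R) \/
   locally_affinely_equivalent x (hypersurface_ii R)).
Proof. exact: (hypersphere_classification M_connected x_immersion x_convex x_sphere x_ricci). Qed.
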